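(* Let $\overline M=M\cup\partial M$ be a smooth manifold with boundary $\partial M$ and interior $M$ and, for some integer $N\geq3$, let $\mathcal G$ be an equivalence class of ALH metrics on $M$ for the relation $\sim_{N-2}$. Let $[\mathcal G_\infty]$ be the conformal structure on $\partial M$ defined by the conformal infinity of $\mathcal G$ and $\operatorname{Conf}(\partial M,[\mathcal G_\infty])$ the group of its conformal isometries. Then: (1) $\operatorname{Diff}_0^{N+1}(\overline M)$ is a normal subgroup in $\operatorname{Diff}(\overline M)$ and is contained in $\operatorname{Diff}_{\mathcal G}(\overline M)$. (2) Restriction of diffeomorphisms to the boundary induces a homomorphism $\operatorname{Diff}_{\mathcal G}(\overline M)\to\operatorname{Conf}(\partial M,[\mathcal G_\infty])$ with kernel $\operatorname{Diff}_0^{N+1}(\overline M)$.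
   Context: All objects are $C^\infty$, and $\dim\overline M=n\ge3$. A local defining function for $\partial M$ is a smooth $\rho:U\to[0,\infty)$, $U\subset\overline M$ open, with $U\cap\partial M=\rho^{-1}(0)$ and $d\rho$ nowhere zero on $U\cap\partial M$. For an integer $k>0$, functions or tensor fields $t_1,t_2$ smooth up to the boundary satisfy $t_1\sim_kt_2$ if near boundary points $t_1-t_2=\rho^k\tilde t$ with $\tilde t$ smooth up to the boundary, for a (equivalently any) local defining function $\rho$. A pseudo-Riemannian metric $g$ on $M$ is conformally compact if near each boundary point $\rho^2g$ extends smoothly to the boundary with non-degenerate boundary values, for some (equivalently any) local defining function; it is ALH if in addition $(\rho^2g)^{-1}(d\rho,d\rho)\equiv1$ along $\partial M$. For conformally compact $g,h$ write $g\sim_{N-2}h$ if $\rho^2g\sim_N\rho^2h$; this is an equivalence relation. All metrics in $\mathcal G$ induce the same conformal class on $\partial M$, that of the metrics on $\partial M$ induced by the boundary values of $\rho^2g$; this is the conformal infinity $[\mathcal G_\infty]$. $\operatorname{Diff}(\overline M)$ is the group of diffeomorphisms of the manifold with boundary $\overline M$. $\operatorname{Diff}_{\mathcal G}(\overline M)$ is the subgroup of those $\Psi$ with $\Psi^*\mathcal G=\mathcal G$. $\operatorname{Diff}_0^{k}(\overline M)$ is the set of diffeomorphisms $\Psi$ with $f\circ\Psi\sim_kf$ for every $f\in C^\infty(\overline M,\mathbb R)$ (''asymptotic to the identity of order $k$''). *)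

(* Defs.v *)
From HB Require Import structures.
From mathcomp Require Export all_boot all_order all_algebra.
From mathcomp Require Export all_classical all_reals all_analysis.

Set Implicit Arguments.
Unset Strict Implicit.
Unset Printing Implicit Defensive.

Export Order.TTheory GRing.Theory Num.Theory.
Export numFieldNormedType.Exports.
Local Open Scope classical_set_scope.
Local Open Scope ring_scope.

Section Calculus.
Context {R : realType}.

Fixpoint Ck {n : nat} {W : normedModType R} (k : nat) (U : set 'rV[R]_n)
    (F : 'rV[R]_n -> W) : Prop :=
  match k with
  | 0%N => forall x, U x -> {for x, continuous F}
  | k'.+1 => (forall x, U x -> differentiable F x) /\
             forall i : 'I_n, Ck k' U (fun x => 'D_(delta_mx 0 i) F x)
  end.

(* [S] need not be open, e.g. relatively open in a half-space: [f] is smooth on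
   [S] if near each point of [S] it has a smooth extension. *)
Definition smooth_on {n : nat} {W : normedModType R} (S : set 'rV[R]_n)
    (f : 'rV[R]_n -> W) : Prop :=
  forall x, S x -> exists (U : set 'rV[R]_n) (F : 'rV[R]_n -> W),
    [/\ open U, U x, forall k, Ck k U F & forall y, S y -> U y -> f y = F y].

(* Right-sided difference quotients stay inside the half-space [0 <= x 0 0] and,
   for functions smooth up to its boundary, agree with the partial derivatives
   of any smooth extension. *)
Definition partial {n : nat} (i : 'I_n) (f : 'rV[R]_n -> R) (x : 'rV[R]_n) : R :=
  lim ((h^-1 * (f (x + h *: delta_mx 0 i) - f x)) @[h --> 0^'+]).

Definition gradient {n : nat} (f : 'rV[R]_n -> R) (x : 'rV[R]_n) : 'rV[R]_n :=
  \row_i partial i f x.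

(* Same convention as the library's ['J f x]: the differential of [f] at [x] is
   [v |-> v *m jac f x]. *)
Definition jac {m n : nat} (f : 'rV[R]_m -> 'rV[R]_n) (x : 'rV[R]_m) : 'M[R]_(m, n) :=
  \matrix_(i, j) partial i (fun y => f y 0 j) x.

End Calculus.

(* Values of [cmap] outside [cdom] are irrelevant. *)
Record chart (R : realType) (T : Type) (n : nat) := Chart {
  cdom : set T;
  cmap :> T -> 'rV[R]_n
}.

Section Charts.
Context {R : realType} {T : Type} {n : nat}.
Implicit Types (c d : chart R T n) (A : set (chart R T n)) (D : set T).

Definition cimage c D : set 'rV[R]_n := c @` (cdom c `&` D).

(* The coordinate expression [f \o c^-1]; it is 0 outside the image of [c]. *)
Definition coord {W : normedModType R} c (f : T -> W) : 'rV[R]_n -> W :=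
  fun x => xget 0 [set f p | p in [set p | cdom c p /\ c p = x]].

Definition smooth_fun {W : normedModType R} A D (f : T -> W) : Prop :=
  forall c, A c -> smooth_on (cimage c D) (coord c f).

Definition tensor : Type := chart R T n -> T -> 'M[R]_n.

(* A smooth (0,2)-tensor field on [D], given classically by its components
   [t c p i j = t_p (d/dx_i, d/dx_j)] in each chart [c] of the atlas [A];
   components at other charts and points are irrelevant. *)
Definition is_tensor A D (t : tensor) : Prop :=
  (forall c, A c -> smooth_on (cimage c D) (coord c (t c))) /\
  (forall c d, A c -> A d -> forall p, D p -> cdom c p -> cdom d p ->
     let J := jac (coord c d) (c p) in t c p = J *m t d p *m J^T).

Definition signature_mx (k : nat) : 'M[R]_n :=
  diag_mx (\row_(i < n) (if (i < k)%N then 1 else -1)).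

(* Pseudo-Riemannian metric on [D]: smooth, symmetric, of constant signature
   (hence nondegenerate). *)
Definition is_metric A D (g : tensor) : Prop :=
  [/\ is_tensor A D g,
      forall c, A c -> forall p, D p -> cdom c p -> (g c p)^T = g c p &
      exists k : nat, forall c, A c -> forall p, D p -> cdom c p ->
        exists2 P : 'M[R]_n, P \in unitmx & P *m g c p *m P^T = signature_mx k].

(* [h] is the pullback of [g] along [f : T -> T], over the points of [D]. *)
Definition is_pullback A D (f : T -> T) (g h : tensor) : Prop :=
  forall c d, A c -> A d -> forall p, D p -> cdom c p -> cdom d (f p) ->
    let J := jac (coord c (d \o f)) (c p) in h c p = J *m g d (f p) *m J^T.

Definition pullback_class A D (f : T -> T) (G : set tensor) : set tensor :=
  [set h | exists2 g, G g & is_pullback A D f g h].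

Definition smooth_map A (f : T -> T) : Prop :=
  forall p, exists c d (V : set 'rV[R]_n),
    [/\ A c /\ A d, cdom c p, open V /\ V (c p),
        forall q, cdom c q -> V (c q) -> cdom d (f q) &
        smooth_on (cimage c (c @^-1` V)) (coord c (d \o f))].

Definition Diff A : set (T -> T) :=
  [set f | smooth_map A f /\
           exists g, [/\ smooth_map A g, cancel f g & cancel g f]].

End Charts.
Arguments tensor : clear implicits.

Section TransformationGroups.
Context {T : Type}.

Definition is_group (G : set (T -> T)) : Prop :=
  [/\ G id,
      forall f g, G f -> G g -> G (f \o g) &
      forall f, G f -> exists g, [/\ G g, cancel f g & cancel g f]].

Definition is_normal_subgroup (S G : set (T -> T)) : Prop :=
  [/\ is_group G, is_group S, S `<=` G &
      forall s f f', S s -> G f -> G f' -> cancel f f' -> cancel f' f ->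
        S (f \o s \o f')].

End TransformationGroups.

Definition is_group_hom {T T' : Type} (G : set (T -> T)) (H : set (T' -> T'))
    (r : (T -> T) -> (T' -> T')) : Prop :=
  [/\ is_group G, is_group H, forall f, G f -> H (r f) &
      forall f g, G f -> G g -> r (f \o g) = r f \o r g].

Definition kernel {T T' : Type} (G : set (T -> T))
    (r : (T -> T) -> (T' -> T')) : set (T -> T) :=
  [set f | G f /\ r f = id].

Section ManifoldWithBoundary.
Context {R : realType} {n : nat} {T : topologicalType}.
Variable A : set (chart R T n.+1).
Implicit Types (c d : chart R T n.+1) (U D : set T) (rho : T -> R)
  (g h s t : tensor R T n.+1).

Definition halfspace : set 'rV[R]_n.+1 := [set x | 0 <= x 0 0].

(* A homeomorphism from an open set onto a relatively open subset of the
   half-space. *)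
Definition is_chart c : Prop :=
  [/\ open (cdom c),
      forall p q, cdom c p -> cdom c q -> c p = c q -> p = q,
      forall p, cdom c p -> {for p, continuous c} &
      forall O, open O ->
        exists2 V : set 'rV[R]_n.+1, open V & cimage c O = V `&` halfspace].

(* [A] is a smooth atlas, making [T] a smooth manifold with (possibly empty)
   boundary, of dimension [n.+1]. *)
Definition manifold_with_boundary : Prop :=
  [/\ hausdorff_space T, @second_countable T,
      forall p, exists2 c, A c & cdom c p,
      forall c, A c -> is_chart c &
      forall c d, A c -> A d -> smooth_on (cimage c (cdom d)) (coord c d)].

Definition boundary : set T :=
  [set p | exists2 c, A c & cdom c p /\ c p 0 0 = 0].

Definition interior_part : set T := ~` boundary.

(* The boundary as a manifold of dimension [n]: its charts are the restrictions
   of those of [A], with the coordinate 0 (which vanishes) dropped. *)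
Definition bdT : Type := set_type boundary.

Definition bchart c : chart R bdT n :=
  Chart [set p : bdT | cdom c (val p)] (fun p => col' 0 (c (val p))).

Definition batlas : set (chart R bdT n) := bchart @` A.

Definition local_defining_function U rho : Prop :=
  [/\ open U, smooth_fun A U (rho : T -> R^o),
      forall p, U p -> 0 <= rho p,
      forall p, U p -> (boundary p <-> rho p = 0) &
      forall c p, A c -> cdom c p -> U p -> boundary p ->
        gradient (coord c (rho : T -> R^o)) (c p) != 0].

(* [f1 ~_k f2] *)
Definition fun_sim (k : nat) (f1 f2 : T -> R) : Prop :=
  forall p, boundary p -> exists U rho (f : T -> R),
    [/\ local_defining_function U rho, U p, smooth_fun A U (f : T -> R^o) &
        forall q, U q -> f1 q - f2 q = rho q ^+ k * f q].

(* [s ~_k t], for tensor fields [s], [t] defined on the domain [U] of [rho] *)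
Definition tensor_sim_on U rho (k : nat) s t : Prop :=
  exists2 w, is_tensor A U w & forall c q, A c -> cdom c q -> U q ->
    s c q - t c q = rho q ^+ k *: w c q.

(* [t] is the smooth extension of [rho^2 g] to [U], up to the boundary, and is
   nondegenerate there. *)
Definition compactification g U rho t : Prop :=
  [/\ local_defining_function U rho, is_tensor A U t,
      forall c q, A c -> cdom c q -> U q -> interior_part q ->
        t c q = rho q ^+ 2 *: g c q &
      forall c q, A c -> cdom c q -> U q -> boundary q -> t c q \in unitmx].

Definition conformally_compact g : Prop :=
  is_metric A interior_part g /\
  forall p, boundary p -> exists U rho t, U p /\ compactification g U rho t.

(* Asymptotically locally hyperbolic: [(rho^2 g)^-1 (d rho, d rho) = 1] along the
   boundary. *)
Definition ALH g : Prop :=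
  conformally_compact g /\
  forall p, boundary p -> exists U rho t,
    [/\ U p, compactification g U rho t &
        forall c q, A c -> cdom c q -> U q -> boundary q ->
          let drho := gradient (coord c (rho : T -> R^o)) (c q) in
          (drho *m invmx (t c q) *m drho^T) 0 0 = 1].

(* [g ~_k h], i.e. [rho^2 g ~_(k + 2) rho^2 h] *)
Definition metric_sim (k : nat) g h : Prop :=
  forall p, boundary p -> exists U rho s t,
    [/\ U p, compactification g U rho s, compactification h U rho t &
        tensor_sim_on U rho k.+2 s t].

Definition is_ALH_class (k : nat) (G : set (tensor R T n.+1)) : Prop :=
  exists2 g, ALH g & G = [set h | ALH h /\ metric_sim k g h].

(* The conformal infinity, as the set of all metrics on the boundary that are
   locally positive multiples of the one induced by the boundary value of
   [rho^2 g] with [g] in [G]. *)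
Definition conformal_infinity (G : set (tensor R T n.+1)) : set (tensor R bdT n) :=
  [set gam | is_metric batlas setT gam /\
    exists2 g, G g & forall p : bdT,
      exists U rho t (phi : bdT -> R),
        [/\ U (val p), compactification g U rho t,
            smooth_fun batlas [set q : bdT | U (val q)] (phi : bdT -> R^o),
            forall q : bdT, U (val q) -> 0 < phi q &
            forall c (q : bdT), A c -> cdom c (val q) -> U (val q) ->
              gam (bchart c) q = phi q *: row' 0 (col' 0 (t c (val q)))]].

Definition Conf (C : set (tensor R bdT n)) : set (bdT -> bdT) :=
  [set f | Diff batlas f /\ pullback_class batlas setT f C = C].

Definition Diff_class (G : set (tensor R T n.+1)) : set (T -> T) :=
  [set f | Diff A f /\ pullback_class A interior_part f G = G].

(* Diffeomorphisms asymptotic to the identity of order [k] *)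
Definition Diff0 (k : nat) : set (T -> T) :=
  [set Psi | Diff A Psi /\
    forall f : T -> R, smooth_fun A setT (f : T -> R^o) -> fun_sim k (f \o Psi) f].

Definition is_restriction (Psi : T -> T) (psi : bdT -> bdT) : Prop :=
  forall p : bdT, val (psi p) = Psi (val p).

End ManifoldWithBoundary.
Arguments Conf {R n T} A C.
Arguments conformal_infinity {R n T} A G _.
Arguments is_restriction {R n T} A Psi psi.

(* Main.v *)
(* Near a boundary point take a chart whose coordinate [x0] vanishes exactly on the
   boundary, and let [h = x0^2 g].

   Suppose a diffeomorphism [Psi] reads [x + x0^K B(x)] there, with [B] smooth up to
   the boundary. Then [Psi^* g = x0^-2 (1 + x0^(K-1) B_0)^-2 J h(Psi) J^T] with
   [J = 1 + K x0^(K-1) e0 B + O(x0^K)], where [e0] is the first basis column, so that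
   [x0^2 Psi^* g - h = x0^(K-1) (K (e0 B h + h (e0 B)^T) - 2 B_0 h) + O(x0^K)]
   when [K >= 2].
   For [K = N + 1] this is [O(x0^N)], so [Psi] preserves the class. Conversely, if
   [Psi] preserves the class and [K <= N], the coefficient of [x0^(K-1)] vanishes on
   the boundary; its tangential block gives [B_0 = 0], then the other entries give
   [B h = 0], hence [B = 0] on the boundary and [K] can be raised by one (Hadamard).
   The case [K = 1] has quadratic terms in [B] and uses [1 + B_0 >= 0]. Starting from
   [Psi = id] on the boundary one reaches [K = N + 1].

   On the boundary the normal derivatives of [Psi] drop out of the tangential block
   of [J h J^T], so the restriction pulls back the conformal infinity as it should. *)

(* Metrics live in the interior, so the identities between them hold only there. They reach the
   boundary by a limit: both sides are expressed through maps smooth up to the boundary, a power of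
   [x0] is divided out where it is positive, and the interior is dense. The bound [1 + B_0 >= 0] at
   [K = 1] arises in the same way, as the limit of the ratio of [x0 \o Psi] to [x0]. It excludes the
   root [-2] of [2 B_0 + B_0^2], whose vanishing is all that the tangential block gives at that
   order.

   The dimension enters because that block must have a nonzero entry: an invertible matrix with at
   least two tangential directions cannot vanish on all pairs of them.

   Raising [K] needs quotients by [x0] that are again smooth up to the boundary. They are averages
   of derivatives along segments, whence the integrals depending on a parameter; they are formed for
   the local extensions across the boundary.

   [Diff0] tests [Psi] on global functions only, whereas the expansion of [Psi] lives in one chart.
   Passing from the former to the latter requires cutoff functions, and through them the Hausdorff
   property. *)
From HB Require Import structures.
From mathcomp Require Import perm ring.
Require Import Defs.
Set Implicit Arguments.
Unset Strict Implicit.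
Unset Printing Implicit Defensive.
Local Open Scope classical_set_scope.
Local Open Scope ring_scope.

(** * Smooth functions on open subsets of R^n *)

Section Ck_theory.
Context {R : realType}.

(** The first-order expansion of [f] at [x] is also one of [g], and uniqueness of the differential
    then identifies ['d g x] with ['d f x]. *)
Lemma differentiable_ext (V W : normedModType R) (f g : V -> W) (x : V) :
  (\near x, f x = g x) -> differentiable f x -> differentiable g x.
Proof.
move=> fg /diff_locallyP [cf /eqaddoP ef].
have fx : f x = g x := nbhs_singleton fg.
have E : g \o shift x = cst (g x) + 'd f x +o_ 0 id.
  apply/eqaddoP => e e0; apply: filter_app (ef e e0).
  have H0 : \forall h \near 0, f (h + x) = g (h + x).
    by move: fg; rewrite (near_shift 0); apply: filterS => h; rewrite /= subr0.
  by apply: filterS H0 => h /= H1; rewrite !fctE /= H1 fx.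
have H := diff_unique cf E.
by apply/diff_locallyP; rewrite H.
Qed.

Lemma near_open_eq (V W : normedModType R) (U : set V) (f g : V -> W) x :
  open U -> U x -> (forall y, U y -> f y = g y) -> \near x, f x = g x.
Proof. by move=> oU Ux H; have := open_nbhs_nbhs (conj oU Ux); apply: filterS. Qed.

Lemma diff_partials n (W : normedModType R) (F : 'rV[R]_n -> W) x v :
  differentiable F x ->
  'D_v F x = \sum_i v 0 i *: 'D_(delta_mx 0 i) F x.
Proof.
move=> dF; rewrite deriveE // {1}(row_sum_delta v) linear_sum.
by apply: eq_bigr => i _; rewrite linearZ /= -deriveE.
Qed.

Section general.
Context {n : nat} {W : normedModType R}.
Implicit Types (U : set 'rV[R]_n) (F G : 'rV[R]_n -> W).

Definition smooth U F := forall k, Ck k U F.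

Lemma Ck_continuous k U F : Ck k U F -> forall x, U x -> {for x, continuous F}.
Proof.
case: k => [//|k] [dF _] x Ux.
exact/differentiable_continuous/dF.
Qed.

Lemma Ck_pred k U F : Ck k.+1 U F -> Ck k U F.
Proof.
elim: k F => [|k IH] F HF; first exact: Ck_continuous HF.
by case: HF => dF pF; split => // i; apply: IH.
Qed.

Lemma Ck_subset k U U' F : U' `<=` U -> Ck k U F -> Ck k U' F.
Proof.
move=> s; elim: k F => [|k IH] F /=; first by move=> H x /s /H.
by case=> dF pF; split => [x /s /dF|i] //; apply: IH.
Qed.

(** Since [U] is open, the two maps agree near each of its points, so the equality passes to partial
    derivatives of every order. *)
Lemma Ck_eq k U F G : open U -> (forall x, U x -> F x = G x) ->
  Ck k U F -> Ck k U G.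
Proof.
move=> oU; elim: k F G => [|k IH] F G FG /=.
  move=> cF x Ux; rewrite /prop_for /continuous_at -(FG x Ux).
  apply: cvg_trans (cF x Ux).
  exact: (near_eq_cvg (near_open_eq oU Ux FG)).
case=> dF pF; split=> [x Ux|i].
  by apply: differentiable_ext (dF x Ux); exact: near_open_eq FG.
apply: IH (pF i) => x Ux; apply: near_eq_derive; exact: near_open_eq FG.
Qed.

Lemma smooth_differentiable U F x : smooth U F -> U x -> differentiable F x.
Proof. by move=> /(_ 1%N) [+ _] => /[apply]. Qed.

Lemma smooth_continuous U F x : smooth U F -> U x -> {for x, continuous F}.
Proof. by move=> /(_ 0%N); apply. Qed.

Lemma smooth_partial U F i : smooth U F -> smooth U ('D_(delta_mx 0 i) F).
Proof. by move=> sF k; have [_] := sF k.+1; exact. Qed.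

Lemma smooth_subset U U' F : U' `<=` U -> smooth U F -> smooth U' F.
Proof. by move=> s sF k; apply: Ck_subset s _. Qed.

Lemma smooth_eq U F G : open U -> (forall x, U x -> F x = G x) ->
  smooth U F -> smooth U G.
Proof. by move=> oU e sF k; apply: Ck_eq oU e (sF k). Qed.

Lemma Ck_cst k U (a : W) : Ck k U (cst a).
Proof.
elim: k a => [|k IH] a /=; first by move=> x _; exact: cst_continuous.
split=> [x _|i]; first exact: differentiable_cst.
rewrite (_ : (fun x => _) = cst 0); first exact: IH.
by apply/funext => x; rewrite derive_cst.
Qed.

Lemma CkD k U F G : open U -> Ck k U F -> Ck k U G -> Ck k U (F + G).
Proof.
move=> oU; elim: k F G => [|k IH] F G /=.
  by move=> cF cG x Ux; exact: (continuousD (cF x Ux) (cG x Ux)).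
case=> dF pF [dG pG]; split=> [x Ux|i].
  by apply: differentiableD; [exact: dF|exact: dG].
apply: Ck_eq (IH _ _ (pF i) (pG i)) => // x Ux.
by rewrite deriveD //; apply: diff_derivable; [exact: dF|exact: dG].
Qed.

End general.

Section scalar.
Context {n : nat}.
Implicit Types (U : set 'rV[R]_n) (F G : 'rV[R]_n -> R^o).

Lemma CkM k U F G : open U -> Ck k U F -> Ck k U G -> Ck k U (F * G).
Proof.
move=> oU; elim: k F G => [|k IH] F G HF HG /=.
  by move=> x Ux; exact: (continuousM (HF x Ux) (HG x Ux)).
case: (HF) (HG) => dF pF [dG pG]; split=> [x Ux|i].
  by apply: differentiableM; [exact: dF|exact: dG].
have E x : U x -> (F * 'D_(delta_mx 0 i) G + G * 'D_(delta_mx 0 i) F) x =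
    'D_(delta_mx 0 i) (F * G) x.
  by move=> Ux; rewrite deriveM //; apply: diff_derivable; [exact: dF|exact: dG].
apply: Ck_eq E _ => //.
(* The undifferentiated factors are lowered to order [k], where the induction hypothesis applies. *)
exact: CkD oU (IH _ _ (Ck_pred HF) (pG i)) (IH _ _ (Ck_pred HG) (pF i)).
Qed.

Lemma CkV k U F : open U -> (forall x, U x -> F x != 0) -> Ck k U F ->
  Ck k U (fun x => (F x)^-1 : R^o).
Proof.
move=> oU F0; elim: k => [|k IH] HF /=.
  by move=> x Ux; exact: (continuousV (F0 x Ux) (HF x Ux)).
case: (HF) => dF pF; split=> [x Ux|i].
  by apply: differentiableV; [exact: dF|exact: F0].
(* The derivative of [1/F] is [- (1/F)^2] times that of [F], so the induction hypothesis is applied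
   to [1/F] itself. *)
pose I : 'rV[R]_n -> R^o := fun x => (F x)^-1.
have E x : U x -> (cst (-1) * (I * I) * 'D_(delta_mx 0 i) F) x =
    'D_(delta_mx 0 i) (fun x => (F x)^-1 : R^o) x.
  move=> Ux; rewrite deriveV ?F0 //; last by apply: diff_derivable; exact: dF.
  by rewrite !fctE /I expr2 invfM !mulN1r; rewrite /GRing.scale /= mulNr.
apply: Ck_eq E _ => //.
have HI : Ck k U I by apply: IH; exact: Ck_pred.
exact: CkM oU (CkM oU (Ck_cst _ _ _) (CkM oU HI HI)) (pF i).
Qed.

Lemma Ck_sum (I : finType) k U (F : I -> 'rV[R]_n -> R^o) : open U ->
  (forall i, Ck k U (F i)) -> Ck k U (fun x => \sum_i F i x : R^o).
Proof.
move=> oU H.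
rewrite (_ : (fun x => _) = \sum_i F i); last by apply/funext => x; rewrite fct_sumE.
apply: (big_ind (fun G => Ck k U G)); [exact: Ck_cst| |by move=> i _].
by move=> *; exact: CkD.
Qed.

Lemma derive_coord_delta (x : 'rV[R]_n) i j :
  'D_(delta_mx 0 j) (fun y : 'rV[R]_n => y 0 i : R^o) x = (j == i)%:R.
Proof.
rewrite deriveE; last exact: differentiable_coord.
have @f : {linear 'rV[R]_n -> R^o}.
  by exists (fun N : 'rV[R]_n => N 0 i); do 2![eexists]; do ?[constructor];
     rewrite ?mxE// => ? *; rewrite ?mxE//; move=> ?; rewrite !mxE.
rewrite (_ : (fun _ => _) = f) // diff_lin; last exact: coord_continuous.
by rewrite /= /f /= mxE eqxx /= eq_sym.
Qed.

Lemma Ck_coord k U i : Ck k U (fun x : 'rV[R]_n => x 0 i : R^o).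
Proof.
case: k => [|k] /=; first by move=> x _; exact: coord_continuous.
split=> [x _|j]; first exact: differentiable_coord.
rewrite (_ : (fun x => _) = cst ((j == i)%:R)); first exact: Ck_cst.
by apply/funext => x; rewrite derive_coord_delta.
Qed.

End scalar.

Section matrixvalued.
Context {n p q : nat}.
Implicit Types (U : set 'rV[R]_n) (F : 'rV[R]_n -> 'M[R]_(p, q)).

Lemma differentiable_mx (V : normedModType R) (F : V -> 'M[R]_(p, q)) x :
  (forall i j, differentiable (fun y => F y i j : R^o) x) -> differentiable F x.
Proof.
move=> H; have -> : F = \sum_i \sum_j (fun y => F y i j *: delta_mx i j).
  apply/funext => y; rewrite fct_sumE {1}(matrix_sum_delta (F y)).
  by apply: eq_bigr => i _; rewrite fct_sumE.
apply: differentiable_sum => i; apply: differentiable_sum => j.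
exact: differentiableZl.
Qed.

Lemma continuous_mx (V : topologicalType) (F : V -> 'M[R]_(p, q)) x :
  (forall i j, {for x, continuous (fun y => F y i j : R^o)}) ->
  {for x, continuous F}.
Proof.
move=> H; apply/cvgrPdist_lt => e e0.
near=> y; rewrite [ltLHS]/Num.Def.normr/= mx_normrE.
apply: bigmax_lt => //= k _; rewrite !mxE /=.
move: k; near: y; apply: filter_forall => -[i j] /=.
by have /cvgrPdist_lt := H i j; exact.
Unshelve. all: by end_near. Qed.

Lemma derive_coord (V : normedModType R) (F : V -> 'M[R]_(p, q)) x v i j :
  differentiable F x ->
  ('D_v F x) i j = 'D_v (fun y => F y i j : R^o) x.
Proof.
by move=> dF; rewrite derive_mx ?mxE //; exact: diff_derivable.
Qed.

Lemma Ck_mxP k U F : open U ->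
  Ck k U F <-> forall i j, Ck k U (fun x => F x i j : R^o).
Proof.
move=> oU; elim: k F => [|k IH] F /=; split.
- move=> H i j x Ux.
  exact: (continuous_comp (H x Ux) (@coord_continuous _ _ _ i j (F x))).
- by move=> H x Ux; apply: continuous_mx => i j; exact: H.
- case=> dF pF i j; split=> [x Ux|l].
    have := differentiable_comp (dF x Ux) (differentiable_coord (F x) i j).
    exact.
  have /IH /(_ i j) := pF l; apply: Ck_eq => // x Ux.
  by rewrite derive_coord //; exact: dF.
- move=> H; have dF x : U x -> differentiable F x.
    by move=> Ux; apply: differentiable_mx => i j; have [+ _] := H i j; exact.
  split=> // l; apply/IH => i j; have [_ /(_ l)] := H i j.
  by apply: Ck_eq => // x Ux; rewrite derive_coord //; exact: dF.
Qed.

Lemma smooth_mxP U F : open U ->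
  smooth U F <-> forall i j, smooth U (fun x => F x i j : R^o).
Proof.
move=> oU; split=> [sF i j k|sF k]; last by apply/Ck_mxP => // i j; exact: sF.
by move: i j; apply/Ck_mxP.
Qed.

End matrixvalued.

Lemma derive_compE n m (W : normedModType R) (F : 'rV[R]_m -> 'rV[R]_n)
    (G : 'rV[R]_n -> W) x v :
  differentiable F x -> differentiable G (F x) ->
  'D_v (G \o F) x =
  \sum_j 'D_v (fun y => F y 0 j : R^o) x *: 'D_(delta_mx 0 j) G (F x).
Proof.
move=> dF dG; rewrite deriveE; last exact: differentiable_comp.
rewrite diff_comp //= -deriveE // diff_partials //.
by apply: eq_bigr => j _; rewrite -deriveE // derive_coord.
Qed.

Lemma Ck_comp n m k (U : set 'rV[R]_m) (V : set 'rV[R]_n)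
    (F : 'rV[R]_m -> 'rV[R]_n) (G : 'rV[R]_n -> R^o) :
  open U -> open V -> (forall x, U x -> V (F x)) ->
  Ck k U F -> Ck k V G -> Ck k U (G \o F).
Proof.
move=> oU oV UV; elim: k F G UV => [|k IH] F G UV HF HG /=.
  by move=> x Ux; apply: continuous_comp; [exact: HF|apply: HG; exact: UV].
case: (HF) (HG) => dF pF [dG pG]; split=> [x Ux|i].
  by apply: differentiable_comp; [exact: dF|apply: dG; exact: UV].
have E x : U x -> \sum_j ('D_(delta_mx 0 i) (fun y => F y 0 j : R^o) *
    ('D_(delta_mx 0 j) G \o F)) x = 'D_(delta_mx 0 i) (G \o F) x.
  move=> Ux; rewrite derive_compE //; [exact: dF|apply: dG; exact: UV].
apply: Ck_eq E _ => //; apply: Ck_sum => // j; apply: CkM => //.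
  by have /(Ck_mxP _ _ oU)/(_ 0 j) [_] := HF; exact.
exact: IH UV (Ck_pred HF) (pG j).
Qed.

Lemma smooth_comp n m (U : set 'rV[R]_m) (V : set 'rV[R]_n)
    (F : 'rV[R]_m -> 'rV[R]_n) (G : 'rV[R]_n -> R^o) :
  open U -> open V -> (forall x, U x -> V (F x)) ->
  smooth U F -> smooth V G -> smooth U (G \o F).
Proof. by move=> oU oV UV sF sG k; apply: (Ck_comp oU oV). Qed.

Lemma smooth_comp_mx n m p q (U : set 'rV[R]_m) (V : set 'rV[R]_n)
    (F : 'rV[R]_m -> 'rV[R]_n) (G : 'rV[R]_n -> 'M[R]_(p, q)) :
  open U -> open V -> (forall x, U x -> V (F x)) ->
  smooth U F -> smooth V G -> smooth U (G \o F).
Proof.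
move=> oU oV UV sF /(smooth_mxP _ oV) sG; apply/smooth_mxP => // i j.
exact: smooth_comp (sG i j).
Qed.

End Ck_theory.

(** * Averages along segments and Hadamard's lemma *)

Section mean_value.
Context {R : realType}.

Lemma is_derive_line (V W : normedModType R) (F : V -> W) x h s :
  differentiable F (x + s *: h) ->
  is_derive (s : R^o) 1 (fun s => F (x + s *: h)) ('D_h F (x + s *: h)).
Proof.
move=> /diff_derivable dF.
have E : (fun k : R => k^-1 *: (((fun s => F (x + s *: h)) \o shift (s : R^o)) (k *: (1 : R^o))
      - F (x + s *: h))) =
    (fun k : R => k^-1 *: ((F \o shift (x + s *: h)) (k *: h) - F (x + s *: h))).
  apply/funext => k /=; congr (_ *: (F _ - _)).
  have -> : k *: (1 : R^o) = k by exact: mulr1.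
  by rewrite scalerDl addrCA.
split; first by rewrite /derivable E; exact: dF.
by rewrite /derive E.
Qed.

Lemma segment_mean_value (V : normedModType R) (F : V -> R^o) x h :
  (forall c : R, 0 <= c <= 1 -> differentiable F (x + c *: h)) ->
  exists2 c, 0 <= c <= 1 & F (x + h) - F x = 'D_h F (x + c *: h).
Proof.
move=> dF; pose f (s : R^o) : R^o := F (x + s *: h).
have dff (s : R^o) : 0 <= s <= 1 -> is_derive s 1 f ('D_h F (x + s *: h)).
  by move=> s01; apply: is_derive_line; exact: dF.
have [|s s01|s|c] := @MVT_segment R f (fun s => 'D_h F (x + s *: h)) 0 1.
- by rewrite ler01.
- by apply: dff; rewrite !ltW ?(itvP s01).
- apply: continuous_in_subspaceT => {}s; rewrite inE /= in_itv /= => s01.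
  have [ds _] := dff s s01; apply: differentiable_continuous.
  exact/derivable1_diffP.
- rewrite in_itv /= => c01; rewrite /f scale1r scale0r addr0 subr0 mulr1 => E.
  by exists c.
Qed.

Lemma is_diff_linear (V W : normedModType R) (F : V -> W) (L : {linear V -> W}) x :
  continuous L ->
  (forall e : R, 0 < e -> \forall h \near (0 : V),
     `|F (x + h) - F x - L h| <= e * `|h|) ->
  differentiable F x /\ 'd F x = L :> (V -> W).
Proof.
move=> cL H; have E : F \o shift x = cst (F x) + L +o_ 0 id.
  apply/eqaddoP => e e0; apply: filterS (H e e0) => h /=.
  by rewrite !fctE /= opprD addrA [h + x]addrC.
have D := diff_unique cL E; split => //.
by apply/diff_locallyP; rewrite D.
Qed.

(** Allows the partial derivatives to be guessed in advance: the error estimate alone identifies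
    them. It is meant for integrals, whose candidate derivatives are the integrals of
    derivatives. *)
Lemma differentiable_partialsP n (F : 'rV[R]_n -> R^o) x (a : 'I_n -> R) :
  (forall e : R, 0 < e -> \forall h \near (0 : 'rV[R]_n),
     `|F (x + h) - F x - \sum_i h 0 i * a i| <= e * `|h|) ->
  differentiable F x /\ forall i, 'D_(delta_mx 0 i) F x = a i.
Proof.
move=> H; pose L (h : 'rV[R]_n) : R^o := \sum_i h 0 i * a i.
have lL : linear L.
  move=> k u v; rewrite /L scaler_sumr -big_split; apply: eq_bigr => i _ /=.
  by rewrite !mxE mulrDl -mulrA.
pose LM := GRing.isLinear.Build _ _ _ _ _ lL.
pose LL : {linear 'rV[R]_n -> R^o} := HB.pack L LM.
have cL : continuous LL.
  move=> y; have : Ck 0 setT L; last by apply.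
  apply: Ck_sum; first exact: openT.
  by move=> i; apply: CkM; [exact: openT|exact: Ck_coord|exact: Ck_cst].
have [dF D] := is_diff_linear cL H.
split=> // i; rewrite deriveE // D /= /L (bigD1 i) //= big1 ?addr0.
  by rewrite mxE !eqxx mul1r.
by move=> j ji; rewrite mxE eqxx (negbTE ji) mul0r.
Qed.

End mean_value.

Section int01.
Context {R : realType}.
Implicit Types f g : R -> R^o.

Definition int01 f : R := Rintegral (@lebesgue_measure R) `[0, 1]%classic f.

(** Continuity is two-sided even at the end points. The integrands below allow this, since their
    segments lie in open sets. *)
Definition cont01 f := forall t, 0 <= t <= 1 -> {for t, continuous f}.

Lemma cont01_integrable f : cont01 f ->
  (@lebesgue_measure R).-integrable `[0, 1]%classic (EFin \o f).
Proof.
move=> cf; apply: continuous_compact_integrable; first exact: segment_compact.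
by apply: continuous_in_subspaceT => t; rewrite inE /= in_itv /=; exact: cf.
Qed.

Lemma int01_eq f g : (forall t, 0 <= t <= 1 -> f t = g t) -> int01 f = int01 g.
Proof.
by move=> fg; apply: eq_Rintegral => t; rewrite inE /= in_itv /=; exact: fg.
Qed.

Lemma int01D f g : cont01 f -> cont01 g ->
  int01 (fun t => f t + g t) = int01 f + int01 g.
Proof. by move=> cf cg; apply: RintegralD => //; exact: cont01_integrable. Qed.

Lemma int01B f g : cont01 f -> cont01 g ->
  int01 (fun t => f t - g t) = int01 f - int01 g.
Proof. by move=> cf cg; apply: RintegralB => //; exact: cont01_integrable. Qed.

Lemma int01Z f (r : R) : cont01 f -> int01 (fun t => r * f t) = r * int01 f.
Proof. by move=> cf; apply: RintegralZl => //; exact: cont01_integrable. Qed.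

Lemma cont01_sum (I : finType) (f : I -> R -> R^o) :
  (forall i, cont01 (f i)) -> cont01 (fun t => \sum_i f i t : R^o).
Proof.
move=> H t t01.
rewrite (_ : (fun t => _) = \sum_i f i); last by apply/funext => y; rewrite fct_sumE.
apply: (big_ind (fun g : R -> R^o => {for t, continuous g})).
- exact: cst_continuous.
- by move=> g h cg ch; exact: (continuousD cg ch).
- by move=> i _; exact: H.
Qed.

Lemma int01_sum (I : finType) (f : I -> R -> R^o) : (forall i, cont01 (f i)) ->
  int01 (fun t => \sum_i f i t) = \sum_i int01 (f i).
Proof.
(* Additivity of the integral needs continuity of the partial sums, so the induction carries both
   facts. *)
move=> H; pose K (g : R -> R^o) (s : R) := cont01 g /\ int01 g = s.
suff [] : K (\sum_i f i) (\sum_i int01 (f i)).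
  by move=> _ <-; apply: int01_eq => t _; rewrite fct_sumE.
apply: (big_ind2 K).
- split; first by move=> t _; exact: cst_continuous.
  by rewrite /int01 Rintegral_cst // mul0r.
- move=> g s h r [cg <-] [ch <-]; split.
    by move=> t t01; exact: (continuousD (cg t t01) (ch t t01)).
  exact: int01D.
- by move=> i _; split.
Qed.

Lemma int01_bound f (e : R) : cont01 f -> (forall t, 0 <= t <= 1 -> `|f t| <= e) ->
  `|int01 f| <= e.
Proof.
move=> cf fe; have If := cont01_integrable cf.
apply: le_trans (le_normr_Rintegral _ If) _ => //.
have cn : cont01 (fun t => `|f t| : R^o).
  move=> t t01; apply: continuous_comp; first exact: cf.
  exact: norm_continuous.
have ce : cont01 (fun=> e : R^o) by move=> t _; exact: cst_continuous.
apply: (le_trans (le_Rintegral _ (cont01_integrable cn) (cont01_integrable ce) _)) => //.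
by rewrite Rintegral_cst //= lebesgue_measure_itv /= lte_fin ltr01 sube0 /= mulr1.
Qed.

Lemma int01_FTC (F f : R -> R^o) :
  (forall t : R^o, 0 <= t <= 1 -> is_derive t 1 F (f t)) -> cont01 f ->
  int01 f = F 1 - F 0.
Proof.
move=> dF cf; have cF t : 0 <= t <= 1 -> {for t, continuous F}.
  move=> /dF [dFt _]; apply: differentiable_continuous.
  exact/derivable1_diffP.
rewrite /int01 /Rintegral (@continuous_FTC2 R f F 0 1) //.
- by apply: continuous_in_subspaceT => t; rewrite inE /= in_itv /=; exact: cf.
- split.
  + by move=> t t01; have [|+ _] := dF t; rewrite ?ltW ?(itvP t01).
  + by apply: cvg_at_right_filter; apply: cF; rewrite lexx ler01.
  + by apply: cvg_at_left_filter; apply: cF; rewrite lexx ler01.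
- move=> t t01; rewrite derive1E; have [|_ ->//] := dF t.
  by rewrite !ltW ?(itvP t01).
Qed.

End int01.

Lemma continuous_pairr (X Y : topologicalType) (x : X) (y : Y) :
  {for y, continuous (fun y : Y => (x, y))}.
Proof.
have := @cvg_pair _ _ _ (nbhs y) (nbhs x) (nbhs y) _ _ _ (fun=> x) id.
by apply; [exact: cvg_cst|exact: cvg_id].
Qed.

(** * Differentiation under the integral sign *)

Section parametric.
Context {R : realType} {m : nat}.

(** Tube argument: joint continuity gives a product neighbourhood of each [(x, t)], and compactness
    of [[0, 1]] makes the neighbourhood of [x] independent of [t]. *)
Lemma uniform_in_parameter (D : 'rV[R]_m -> R -> R) x (e : R) : 0 < e ->
  (forall t, 0 <= t <= 1 ->
    {for (x, t), continuous (fun z : 'rV[R]_m * R => D z.1 z.2 : R^o)}) ->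
  \forall y \near x, forall t, 0 <= t <= 1 -> `|D y t - D x t| <= e.
Proof.
move=> e0 cD.
have /compact_near_coveringP NC := @segment_compact R 0 1.
suff C : forall t : R, `[0, 1]%classic t ->
    \forall t' \near t & y \near x, `|D y t' - D x t'| <= e.
  apply: filterS (NC _ (nbhs x) (fun y t => `|D y t - D x t| <= e) _ C) => y H t t01.
  by apply: H; rewrite /= in_itv.
move=> t; rewrite /= in_itv /= => t01.
have e20 : 0 < e / 2 by rewrite divr_gt0.
have /cvgrPdist_lt/(_ _ e20) := cD t t01.
move=> [[A B] /= [nA nB] AB].
exists (B, A) => //= -[s y] [/= Bs Ay].
have /= H1 := AB (y, s) (conj Ay Bs).
have /= H2 := AB (x, s) (conj (nbhs_singleton nA) Bs).
rewrite (_ : D y s - D x s = (D x t - D x s) - (D x t - D y s)); last by ring.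
rewrite (splitr e) (le_trans (ler_normB _ _)) // lerD // ltW //.
Qed.

Variables (F : 'rV[R]_m -> R -> R) (D : 'I_m -> 'rV[R]_m -> R -> R).
Variable U : set 'rV[R]_m.
Hypothesis oU : open U.
Hypothesis cF : forall x, U x -> cont01 (F x : R -> R^o).
Hypothesis dF : forall x t, U x -> 0 <= t <= 1 ->
  differentiable (fun y => F y t : R^o) x.
Hypothesis DF : forall i x t, U x -> 0 <= t <= 1 ->
  'D_(delta_mx 0 i) (fun y => F y t : R^o) x = D i x t.
Hypothesis cD : forall i x t, U x -> 0 <= t <= 1 ->
  {for (x, t), continuous (fun z : 'rV[R]_m * R => D i z.1 z.2 : R^o)}.

Lemma cont01_partial i x : U x -> cont01 (D i x : R -> R^o).
Proof.
move=> Ux t t01.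
have cp : {for t, continuous (fun t : R => (x, t))} by exact: continuous_pairr.
exact: (continuous_comp cp (cD Ux t01)).
Qed.

Lemma coord_le_norm n (h : 'rV[R]_n) i : `|h 0 i| <= `|h|.
Proof.
rewrite [leRHS]/Num.Def.normr /= mx_normrE.
exact: (le_bigmax _ (fun ij => `|h ij.1 ij.2|) (0, i)).
Qed.

(** For each [t] the mean value theorem replaces the increment of [F] by a derivative at an
    intermediate point. Uniform continuity of the derivatives bounds the error independently of [t],
    and the bound survives integration. *)
Lemma differentiable_int01 x : U x ->
  differentiable (fun y => int01 (F y) : R^o) x /\
  forall i, 'D_(delta_mx 0 i) (fun y => int01 (F y) : R^o) x = int01 (D i x).
Proof.
move=> Ux; apply: differentiable_partialsP => e e0.
pose e' := e / m.+1%:R.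
have e'0 : 0 < e' by rewrite divr_gt0.
have NU : \forall y \near x, U y by exact: open_nbhs_nbhs.
have ND i : \forall y \near x, forall t, 0 <= t <= 1 -> `|D i y t - D i x t| <= e'.
  exact: (uniform_in_parameter e'0 (fun t => @cD i x t Ux)).
have [d d0 Hd] := (nbhs_ballP _ _).1 (filterI NU (filter_forall _ ND)).
apply/nbhs_ballP; exists d => // h; rewrite -ball_normE /= sub0r normrN => hd.
have seg c : 0 <= c <= 1 -> ball x d (x + c *: h).
  move=> /andP[c0 c1]; rewrite -ball_normE /= opprD addNKr normrN normrZ.
  by rewrite ger0_norm // (le_lt_trans _ hd) // ler_piMl.
have Uh : U (x + h).
  by have [] := Hd (x + 1 *: h) (seg 1 _); rewrite ?scale1r // ler01 lexx.
have cDh i : cont01 (fun t => h 0 i * D i x t : R^o).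
  move=> t t01; have := @cont01_partial i x Ux t t01.
  by apply: continuousM; exact: cst_continuous.
have cS := cont01_sum cDh.
have -> : int01 (F (x + h)) - int01 (F x) - \sum_i h 0 i * int01 (D i x) =
    int01 (fun t => F (x + h) t - F x t - \sum_i h 0 i * D i x t).
  rewrite int01B //; last first.
    by move=> t t01; exact: (continuousB (cF Uh t01) (cF Ux t01)).
  rewrite int01B; [|exact: cF|exact: cF]; congr (_ - _).
  rewrite int01_sum //; apply: eq_bigr => i _.
  by rewrite int01Z //; exact: cont01_partial.
apply: int01_bound => [t t01|t t01].
  exact: (continuousB (continuousB (cF Uh t01) (cF Ux t01)) (cS t t01)).
(* The intermediate point depends on [t], which is why the bound in [Hd] had to be uniform in
   [t]. *)
have [|c c01 ->] := @segment_mean_value R _ (fun y => F y t : R^o) x h.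
  by move=> c c01; have [Uc _] := Hd _ (seg c c01); exact: dF.
have [Uc Dc] := Hd _ (seg c c01).
rewrite diff_partials; last exact: dF.
rewrite -sumrB; apply: le_trans (ler_norm_sum _ _ _) _.
have -> : e * `|h| = \sum_(i < m.+1) `|h| * e'.
  by rewrite sumr_const card_ord -mulr_natr /e'; field.
rewrite big_ord_recr /=; apply: ler_wpDr; first by rewrite mulr_ge0 // ltW.
apply: ler_sum => i _; rewrite DF // -mulrBr normrM.
by apply: ler_pM => //; [exact: coord_le_norm|exact: Dc].
Qed.

End parametric.

(** * Integrals along segments that depend smoothly on their end points *)

Section smooth_integral.
Context {R : realType} {m n : nat} (U : set 'rV[R]_m) (V : set 'rV[R]_n).
Variables (ga W : 'rV[R]_m -> 'rV[R]_n).
Hypotheses (oU : open U) (oV : open V) (sga : smooth U ga) (sW : smooth U W).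
Hypothesis seg : forall x t, U x -> 0 <= t <= 1 -> V (ga x + t *: W x).

(* The weights [t ^+ d] make this family of integrals stable under
   differentiation. *)
Definition moment d (g : 'rV[R]_n -> R^o) (x : 'rV[R]_m) : R^o :=
  int01 (fun t => t ^+ d * g (ga x + t *: W x)).

Let cseg x t : U x ->
  {for (x, t), continuous (fun z : 'rV[R]_m * R => ga z.1 + z.2 *: W z.1)}.
Proof.
move=> Ux.
have c1 : {for (x, t), continuous (fun z : 'rV[R]_m * R => z.1)} by exact: cvg_fst.
have c2 : {for (x, t), continuous (fun z : 'rV[R]_m * R => z.2)} by exact: cvg_snd.
have cg := continuous_comp c1 (smooth_continuous sga Ux).
have cW := continuous_comp c1 (smooth_continuous sW Ux).
exact: (continuousD cg (continuousZ c2 cW)).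
Qed.

Let cmom d (g : 'rV[R]_n -> R^o) x t : smooth V g -> U x -> 0 <= t <= 1 ->
  {for (x, t), continuous (fun z : 'rV[R]_m * R =>
     z.2 ^+ d * g (ga z.1 + z.2 *: W z.1) : R^o)}.
Proof.
move=> sg Ux t01.
have c2 : {for (x, t), continuous (fun z : 'rV[R]_m * R => z.2 ^+ d : R^o)}.
  have c2 : {for (x, t), continuous (fun z : 'rV[R]_m * R => z.2)} by exact: cvg_snd.
  exact: (continuous_comp c2 (@exprn_continuous _ d t)).
have cg := continuous_comp (@cseg x t Ux) (smooth_continuous sg (seg Ux t01)).
exact: (continuousM c2 cg).
Qed.

Let ccoord i j (K : 'rV[R]_m -> 'rV[R]_n) x t : smooth U K -> U x ->
  {for (x, t), continuous
     (fun z : 'rV[R]_m * R => 'D_(delta_mx 0 i) (fun y => K y 0 j : R^o) z.1 : R^o)}.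
Proof.
move=> sK Ux.
have c1 : {for (x, t), continuous (fun z : 'rV[R]_m * R => z.1)} by exact: cvg_fst.
have /(smooth_mxP _ oU)/(_ 0 j)/(@smooth_partial _ _ _ _ _ i) sKj := sK.
exact: (continuous_comp c1 (smooth_continuous sKj Ux)).
Qed.

Let dK (K : 'rV[R]_m -> 'rV[R]_n) j : smooth U K ->
  smooth U (fun y => K y 0 j : R^o).
Proof. by move=> /(smooth_mxP _ oU); exact. Qed.

(** The derivative of a segment point is that of [ga] plus [t] times that of [W]. A partial
    derivative of [moment d g] thus combines moments of orders [d] and [d.+1] of the partial
    derivatives of [g], so the induction on [k] keeps [d] and [g] general. *)
Lemma Ck_moment k d (g : 'rV[R]_n -> R^o) : smooth V g -> Ck k U (moment d g).
Proof.
pose pd i (K : 'rV[R]_m -> 'rV[R]_n) j : 'rV[R]_m -> R^o :=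
  'D_(delta_mx 0 i) (fun y => K y 0 j : R^o).
pose Dg (g : 'rV[R]_n -> R^o) j : 'rV[R]_n -> R^o := 'D_(delta_mx 0 j) g.
pose D d (g : 'rV[R]_n -> R^o) i x t : R^o := \sum_j
  (pd i ga j x * (t ^+ d * Dg g j (ga x + t *: W x)) +
   pd i W j x * (t ^+ d.+1 * Dg g j (ga x + t *: W x))).
have main d' (g' : 'rV[R]_n -> R^o) x : smooth V g' -> U x ->
    differentiable (moment d' g') x /\ forall i,
    'D_(delta_mx 0 i) (moment d' g') x = int01 (D d' g' i x).
  move=> sg Ux.
  apply: (@differentiable_int01 _ _
    (fun x t => t ^+ d' * g' (ga x + t *: W x)) (D d' g') U) => //.
  - move=> y Uy t t01.
    have cp : {for t, continuous (fun t : R => (y, t))} by exact: continuous_pairr.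
    exact: (continuous_comp cp (cmom (d:=d') sg Uy t01)).
  - move=> y t Uy t01.
    have dl : differentiable (fun y => ga y + t *: W y) y.
      apply: differentiableD; first exact: smooth_differentiable Uy.
      by apply: differentiableZ; exact: smooth_differentiable Uy.
    apply: differentiableM; first exact: differentiable_cst.
    apply: differentiable_comp dl _.
    by apply: smooth_differentiable sg _; exact: seg.
  - move=> i y t Uy t01.
    have dl : differentiable (fun y => ga y + t *: W y) y.
      apply: differentiableD; first exact: smooth_differentiable Uy.
      by apply: differentiableZ; exact: smooth_differentiable Uy.
    have dg : differentiable g' (ga y + t *: W y).
      by apply: smooth_differentiable sg _; exact: seg.
    have dc : differentiable (g' \o (fun y => ga y + t *: W y)) y.
      exact: differentiable_comp.
    have -> : (fun y => t ^+ d' * g' (ga y + t *: W y)) =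
      (t ^+ d' : R) *: (g' \o (fun y => ga y + t *: W y)) by apply/funext.
    rewrite deriveZ; last exact: diff_derivable.
    rewrite derive_compE // scaler_sumr; apply: eq_bigr => j _.
    have -> : 'D_(delta_mx 0 i) (fun y => (ga y + t *: W y) 0 j : R^o) y =
        pd i ga j y + t * pd i W j y.
      have -> : (fun y => (ga y + t *: W y) 0 j : R^o) =
          (fun y => ga y 0 j : R^o) + (t : R) *: (fun y => W y 0 j : R^o).
        by apply/funext => z; rewrite !mxE.
      have dga : derivable (fun y => ga y 0 j : R^o) y (delta_mx 0 i).
        by apply: diff_derivable; apply: smooth_differentiable Uy; exact: (dK _).
      have dW : derivable (fun y => W y 0 j : R^o) y (delta_mx 0 i).
        by apply: diff_derivable; apply: smooth_differentiable Uy; exact: (dK _).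
      by rewrite deriveD //; [rewrite deriveZ|exact: derivableZ].
    by rewrite /GRing.scale /= exprS /Dg; ring.
  - move=> i y t Uy t01; rewrite /D.
    pose h j (z : 'rV[R]_m * R) : R^o :=
      pd i ga j z.1 * (z.2 ^+ d' * Dg g' j (ga z.1 + z.2 *: W z.1)) +
      pd i W j z.1 * (z.2 ^+ d'.+1 * Dg g' j (ga z.1 + z.2 *: W z.1)).
    rewrite (_ : (fun z => _) = \sum_j h j); last by apply/funext => z; rewrite fct_sumE.
    apply: (big_ind (fun g : 'rV[R]_m * R -> R^o => {for (y, t), continuous g})).
    + exact: cst_continuous.
    + by move=> a b ca cb; exact: (continuousD ca cb).
    + move=> j _; have sg' := @smooth_partial _ _ _ _ _ j sg.
      exact: (continuousD
        (continuousM (ccoord (i:=i) (j:=j) (t:=t) sga Uy) (cmom (d:=d') sg' Uy t01))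
        (continuousM (ccoord (i:=i) (j:=j) (t:=t) sW Uy) (cmom (d:=d'.+1) sg' Uy t01))).
have c1 d' (g' : 'rV[R]_n -> R^o) x : smooth V g' -> U x ->
    cont01 (fun t => t ^+ d' * g' (ga x + t *: W x) : R^o).
  move=> sg Ux t t01.
  have cp : {for t, continuous (fun t : R => (x, t))} by exact: continuous_pairr.
  exact: (continuous_comp cp (cmom (d:=d') sg Ux t01)).
elim: k d g => [|k IH] d g sg /=.
  by move=> x Ux; apply: differentiable_continuous; have [] := main d g x sg Ux.
split=> [x Ux|i]; first by have [] := main d g x sg Ux.
pose S x : R^o := \sum_j (pd i ga j x * moment d (Dg g j) x +
   pd i W j x * moment d.+1 (Dg g j) x).
have E x : U x -> S x = 'D_(delta_mx 0 i) (moment d g) x.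
  move=> Ux; have [_ ->] := main d g x sg Ux.
  have cc (r : R) d' j : cont01 (fun t => r * (t ^+ d' * Dg g j (ga x + t *: W x)) : R^o).
    move=> t t01; have /c1/(_ Ux) := @smooth_partial _ _ _ _ _ j sg.
    by move=> /(_ d' t t01); apply: continuousM; exact: cst_continuous.
  rewrite int01_sum; last first.
    by move=> j t t01; exact: (continuousD (cc _ _ _ t t01) (cc _ _ _ t t01)).
  apply: eq_bigr => j _; have sg' := @smooth_partial _ _ _ _ _ j sg.
  by rewrite int01D ?int01Z //; exact: c1.
apply: Ck_eq oU E _; apply: Ck_sum => // j; apply: CkD => //.
- apply: CkM => //; last by apply: IH; exact: smooth_partial.
  exact: (@smooth_partial _ _ _ _ _ i (dK j sga) k).
- apply: CkM => //; last by apply: IH; exact: smooth_partial.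
  exact: (@smooth_partial _ _ _ _ _ i (dK j sW) k).
Qed.

(* The integral form of [g (ga + W) - g ga = W . (average of grad g)]. *)
Lemma increment_moment (g : 'rV[R]_n -> R^o) x : smooth V g -> U x ->
  g (ga x + W x) - g (ga x) =
  \sum_j W x 0 j * moment 0 ('D_(delta_mx 0 j) g) x.
Proof.
move=> sg Ux.
have cc j : cont01 (fun t => W x 0 j * (t ^+ 0 *
    'D_(delta_mx 0 j) g (ga x + t *: W x)) : R^o).
  move=> t t01; have sg' := @smooth_partial _ _ _ _ _ j sg.
  have cp : {for t, continuous (fun t : R => (x, t))} by exact: continuous_pairr.
  have := continuous_comp cp (cmom (d:=0) sg' Ux t01).
  by apply: continuousM; exact: cst_continuous.
have c0 j : cont01 (fun t => t ^+ 0 * 'D_(delta_mx 0 j) g (ga x + t *: W x) : R^o).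
  move=> t t01; have sg' := @smooth_partial _ _ _ _ _ j sg.
  have cp : {for t, continuous (fun t : R => (x, t))} by exact: continuous_pairr.
  exact: (continuous_comp cp (cmom (d:=0) sg' Ux t01)).
under eq_bigr do rewrite -int01Z //.
rewrite -int01_sum //.
have dg (t : R^o) : 0 <= t <= 1 -> is_derive t 1 (fun t => g (ga x + t *: W x))
    (\sum_j W x 0 j * (t ^+ 0 * 'D_(delta_mx 0 j) g (ga x + t *: W x))).
  move=> t01; have dg : differentiable g (ga x + t *: W x).
    by apply: smooth_differentiable sg _; exact: seg.
  apply: is_derive_eq (is_derive_line dg) _.
  by rewrite diff_partials //; apply: eq_bigr => j _; rewrite expr0 mul1r.
have cS := cont01_sum cc.
by rewrite (int01_FTC dg cS) scale1r scale0r addr0.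
Qed.

End smooth_integral.

Section smooth_closure.
Context {R : realType} {n : nat}.
Implicit Types (U : set 'rV[R]_n) (F G : 'rV[R]_n -> R^o).

Lemma smooth_cst (W : normedModType R) U (a : W) : smooth U (cst a).
Proof. by move=> k; exact: Ck_cst. Qed.

Lemma smooth_coord U i : smooth U (fun x : 'rV[R]_n => x 0 i : R^o).
Proof. by move=> k; exact: Ck_coord. Qed.

Lemma smoothD (W : normedModType R) U (F G : 'rV[R]_n -> W) :
  open U -> smooth U F -> smooth U G -> smooth U (fun x => F x + G x).
Proof. by move=> oU sF sG k; exact: (CkD oU (sF k) (sG k)). Qed.

Lemma smoothM U F G : open U -> smooth U F -> smooth U G ->
  smooth U (fun x => F x * G x : R^o).
Proof. by move=> oU sF sG k; exact: (CkM oU (sF k) (sG k)). Qed.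

Lemma smoothV U F : open U -> (forall x, U x -> F x != 0) -> smooth U F ->
  smooth U (fun x => (F x)^-1 : R^o).
Proof. by move=> oU F0 sF k; exact: (CkV oU F0 (sF k)). Qed.

Lemma smooth_sum (I : finType) U (F : I -> 'rV[R]_n -> R^o) : open U ->
  (forall i, smooth U (F i)) -> smooth U (fun x => \sum_i F i x : R^o).
Proof. by move=> oU sF k; apply: Ck_sum => // i; exact: sF. Qed.

Lemma smoothX U F k : open U -> smooth U F -> smooth U (fun x => F x ^+ k : R^o).
Proof.
move=> oU sF; elim: k => [|k IH]; first exact: smooth_cst.
rewrite (_ : (fun x => _) = (fun x => F x * F x ^+ k)); first exact: smoothM.
by apply/funext => x; rewrite exprS.
Qed.

Lemma smooth_id U : open U -> smooth U (@id 'rV[R]_n).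
Proof.
by move=> oU; apply/smooth_mxP => // i j; rewrite ord1; exact: smooth_coord.
Qed.

Lemma smoothZ p q U F (G : 'rV[R]_n -> 'M[R]_(p, q)) : open U ->
  smooth U F -> smooth U G -> smooth U (fun x => (F x : R) *: G x).
Proof.
move=> oU sF /(smooth_mxP _ oU) sG; apply/smooth_mxP => // i j.
rewrite (_ : (fun x => _) = (fun x => F x * G x i j)); first exact: smoothM.
by apply/funext => x; rewrite mxE.
Qed.

Lemma smooth_mulmx p q r U (F : 'rV[R]_n -> 'M[R]_(p, q))
    (G : 'rV[R]_n -> 'M[R]_(q, r)) : open U ->
  smooth U F -> smooth U G -> smooth U (fun x => F x *m G x).
Proof.
move=> oU /(smooth_mxP _ oU) sF /(smooth_mxP _ oU) sG.
apply/smooth_mxP => // i j.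
rewrite (_ : (fun x => _) = (fun x => \sum_l F x i l * G x l j)).
  by apply: smooth_sum => // l; exact: smoothM.
by apply/funext => x; rewrite mxE.
Qed.

Lemma smooth_trmx p q U (F : 'rV[R]_n -> 'M[R]_(p, q)) : open U ->
  smooth U F -> smooth U (fun x => (F x)^T).
Proof.
move=> oU /(smooth_mxP _ oU) sF; apply/smooth_mxP => // i j.
rewrite (_ : (fun x => _) = (fun x => F x j i)) //.
by apply/funext => x; rewrite mxE.
Qed.

End smooth_closure.

Section hadamard.
Context {R : realType}.

(** In the integral formula for the increment, [s] is a factor of every component of the
    displacement. Pulling it out leaves a quotient that is smooth even where [s] vanishes. *)
Lemma smooth_increment m n (U : set 'rV[R]_m) (V : set 'rV[R]_n)
    (ga B : 'rV[R]_m -> 'rV[R]_n) (s : 'rV[R]_m -> R^o) (g : 'rV[R]_n -> R^o) :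
  open U -> smooth U ga -> smooth U B -> smooth U s -> smooth V g ->
  (forall x (t : R), U x -> 0 <= t <= 1 -> V (ga x + t *: ((s x : R) *: B x))) ->
  exists2 C : 'rV[R]_m -> R^o, smooth U C &
    forall x, U x -> g (ga x + (s x : R) *: B x) - g (ga x) = s x * C x.
Proof.
move=> oU sga sB ss sg seg.
pose W x := (s x : R) *: B x.
have sW : smooth U W by exact: smoothZ.
exists (fun x => \sum_j B x 0 j * moment ga W 0 ('D_(delta_mx 0 j) g) x).
  apply: smooth_sum => // j; apply: smoothM => //.
    by move: sB => /(smooth_mxP _ oU); exact.
  move=> k; apply: (Ck_moment oU sga sW seg).
  exact: smooth_partial.
move=> x Ux; rewrite (increment_moment sga sW seg sg Ux) mulr_sumr.
by apply: eq_bigr => j _; rewrite /W mxE mulrA.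
Qed.

Lemma smooth_increment_mx m n p q (U : set 'rV[R]_m) (V : set 'rV[R]_n)
    (ga B : 'rV[R]_m -> 'rV[R]_n) (s : 'rV[R]_m -> R^o)
    (g : 'rV[R]_n -> 'M[R]_(p, q)) :
  open U -> open V -> smooth U ga -> smooth U B -> smooth U s -> smooth V g ->
  (forall x (t : R), U x -> 0 <= t <= 1 -> V (ga x + t *: ((s x : R) *: B x))) ->
  exists2 C : 'rV[R]_m -> 'M[R]_(p, q), smooth U C &
    forall x, U x -> g (ga x + (s x : R) *: B x) - g (ga x) = (s x : R) *: C x.
Proof.
move=> oU oV sga sB ss /(smooth_mxP _ oV) sg seg.
have H (ij : 'I_p * 'I_q) : exists C : 'rV[R]_m -> R^o, smooth U C /\
    forall x, U x -> g (ga x + (s x : R) *: B x) ij.1 ij.2 - g (ga x) ij.1 ij.2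
      = s x * C x.
  have [C sC EC] := smooth_increment oU sga sB ss (sg ij.1 ij.2) seg.
  by exists C.
have [C HC] := choice H.
exists (fun x => \matrix_(i, j) C (i, j) x).
  apply/smooth_mxP => // i j; have [sC _] := HC (i, j).
  by rewrite (_ : (fun x => _) = C (i, j)) //; apply/funext => x; rewrite mxE.
move=> x Ux; apply/matrixP => i j; have [_ /(_ x Ux)] := HC (i, j).
by rewrite !mxE.
Qed.

(** [ga] projects to the hyperplane where coordinate 0 vanishes, and there [u] is 0. Going back to
    [x] is an increment of size [x 0 0] in the fixed direction [e]. *)
Lemma hadamard n p q (a : 'rV[R]_n.+1) (r : R) (u : 'rV[R]_n.+1 -> 'M[R]_(p, q)) :
  a 0 0 = 0 -> smooth (ball a r) u ->
  (forall x, ball a r x -> x 0 0 = 0 -> u x = 0) ->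
  exists2 v : 'rV[R]_n.+1 -> 'M[R]_(p, q), smooth (ball a r) v &
    forall x, ball a r x -> u x = x 0 0 *: v x.
Proof.
move=> a0 su u0.
pose s (x : 'rV[R]_n.+1) : R^o := x 0 0.
pose e : 'rV[R]_n.+1 := delta_mx 0 0.
pose ga (x : 'rV[R]_n.+1) := x - s x *: e.
have oB : open (ball a r) by exact: ball_open.
have ss : smooth (ball a r) s by exact: smooth_coord.
have se : smooth (ball a r) (cst e) by exact: smooth_cst.
have sga : smooth (ball a r) ga.
  have sI := smooth_id oB.
  have sZ : smooth (ball a r) (fun x => (- s x : R) *: e).
    apply: (smoothZ oB _ se).
    rewrite (_ : (fun x => _) = (fun x => (-1) * s x)).
      by apply: smoothM => //; exact: smooth_cst.
    by apply/funext => x; rewrite mulN1r.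
  apply: smooth_eq oB _ (smoothD oB sI sZ) => x _.
  by rewrite /ga scaleNr.
(* Balls are products of intervals and [a 0 0 = 0], so shrinking coordinate 0 does not leave the
   ball. *)
have seg x (t : R) : ball a r x -> 0 <= t <= 1 ->
    ball a r (ga x + t *: (s x *: cst e x)).
  move=> [r0 Bx] /andP[t0 t1]; split => // i j; rewrite /ball /=.
  rewrite /ga /cst /e !mxE ord1 eqxx /=; have := Bx 0 j; rewrite /ball /=.
  case: eqVneq => [->|_]; last by rewrite !mulr0 oppr0 !addr0.
  rewrite a0 !mulr1n !mulr1 /s subrr !sub0r !normrN add0r normrM (ger0_norm t0).
  by apply: le_lt_trans; rewrite ler_piMl.
have [C sC EC] := smooth_increment_mx oB oB sga se ss su seg.
exists C => // x Bx; rewrite -(EC x Bx) /ga subrK [u (x - _)]u0 ?subr0 //.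
  by have := seg x 0 Bx; rewrite scale0r addr0; apply; rewrite lexx ler01.
by rewrite /e !mxE !eqxx mulr1 subrr.
Qed.

End hadamard.

(** * Bump functions *)

Section bump.
Context {R : realType}.

(** [flat 0] is the classical function that is smooth and vanishes to infinite order at 0. The
    negative powers make the span of the family stable under differentiation. *)
Definition flat k (x : R) : R := if 0 < x then x^-1 ^+ k * expR (- x^-1) else 0.

(** With [y = 1/x], a single term of the exponential series gives [y ^+ k.+1 / k.+1! <= expR y]. *)
Lemma flat_bound k x : `|flat k x| <= (k.+1)`!%:R * `|x|.
Proof.
rewrite /flat; case: ltP => [x0|_]; last by rewrite normr0 mulr_ge0.
have y0 : 0 < x^-1 by rewrite invr_gt0.
rewrite ger0_norm ?mulr_ge0 ?expR_ge0 ?exprn_ge0 ?(ltW y0) //.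
rewrite gtr0_norm // expRN ler_pdivrMr ?expR_gt0 //.
have := expR_ge1Dxn k (ltW y0); set y := x^-1 in y0 *; set E := expR y => H.
have {}H : y ^+ k.+1 / k.+1`!%:R <= E by apply: le_trans H; rewrite lerDr.
rewrite ler_pdivrMr ?ltr0n ?fact_gt0 // in H.
have -> : y ^+ k = x * y ^+ k.+1 by rewrite exprS mulrA mulfV ?mul1r // gt_eqF.
by rewrite mulrAC [X in _ <= X]mulrC ler_wpM2l ?(ltW x0) // mulrC.
Qed.

Lemma mul_flat k (h : R) : h != 0 -> h^-1 * flat k h = flat k.+1 h.
Proof.
move=> h0; rewrite /flat; case: ltP => _; last by rewrite mulr0.
by rewrite exprS mulrA.
Qed.

Lemma is_derive_flat k (x : R^o) :
  is_derive x 1 (flat k : R^o -> R^o) (flat k.+2 x - k%:R * flat k.+1 x).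
Proof.
have [x0|x0|->] := ltgtP x 0.
- have E : \near x, cst 0 x = flat k x.
    near=> y; rewrite /flat ltNge ltW //; near: y; exact: lt_nbhsl.
  have D : is_derive x 1 (cst 0 : R^o -> R^o) 0 by exact: is_derive_cst.
  have := near_eq_is_derive E D.
  by rewrite /flat !ltNge (ltW x0) /= mulr0 subr0.
- have E : \near x, ((fun y : R => y^-1) ^+ k * (expR \o (fun y : R => - y^-1)) : R^o -> R^o) x = flat k x.
    near=> y; rewrite /flat ifT ?exprfctE //; near: y; exact: lt_nbhsr.
  have xn0 : x != 0 by rewrite gt_eqF.
  have dI := @is_deriveV R (@id R^o) x 1 1 xn0 (is_derive_id _ _).
  have dk := is_deriveX k dI.
  have dN := is_derive1_comp (is_derive_expR _) (is_deriveN dI).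
  have D := is_deriveM dk dN.
  apply: near_eq_is_derive E _; apply: is_derive_eq D _.
  rewrite /flat x0 exprfctE /= /GRing.scale /=; clear dk; rewrite -exprVn; case: k => [|k].
    by ring.
  by rewrite [k.+1.-1]/= !exprS; ring.
(* At 0 the difference quotient of [flat k] is [flat k.+1], which tends to 0 by [flat_bound]. *)
- have H : (fun h : R => h^-1 *: (((flat k : R^o -> R^o) \o shift (0 : R^o)) (h *: (1 : R^o)) - flat k 0)) @ 0^' --> (0 : R^o).
    apply/cvgrPdist_le => e e0; near=> h.
    have h0 : h != 0 by near: h; exact: nbhs_dnbhs_neq.
    have -> : h *: (1 : R^o) = h by exact: mulr1.
    rewrite /= sub0r normrN addr0 {2}/flat ltxx subr0 /GRing.scale /= mul_flat //.
    apply: le_trans (flat_bound _ _) _.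
    rewrite -ler_pdivlMl ?ltr0n ?fact_gt0 // ltW //.
    near: h; apply: dnbhs0_lt; rewrite mulr_gt0 // invr_gt0 ltr0n fact_gt0 //.
  have -> : flat k.+2 0 - k%:R * flat k.+1 0 = 0 by rewrite /flat ltxx mulr0 subr0.
  split; first by apply/cvg_ex; exists 0.
  exact: cvg_lim H.
Unshelve. all: by end_near. Qed.

Lemma linear_regular (L : {linear R^o -> R^o}) (y : R) : L y = y * L 1.
Proof. by rewrite -[y in LHS]mulr1 [LHS]linearZ. Qed.

Lemma Ck_flat n (U : set 'rV[R]_n) (q : 'rV[R]_n -> R^o) k j : open U ->
  smooth U q -> Ck k U (fun x => flat j (q x) : R^o).
Proof.
move=> oU sq.
have df j' (y : R^o) : differentiable (flat j' : R^o -> R^o) y.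
  by have [+ _] := is_derive_flat j' y => /derivable1_diffP.
have dq x : U x -> differentiable q x by exact: smooth_differentiable.
have dc j' x : U x -> differentiable ((flat j' : R^o -> R^o) \o q) x.
  by move=> Ux; exact: (differentiable_comp (dq x Ux) (df j' (q x))).
elim: k j => [|k IH] j /=.
  by move=> x Ux; apply: differentiable_continuous; exact: dc.
split=> [x Ux|i]; first exact: dc.
have E x : U x -> (flat j.+2 (q x) + (- j%:R) * flat j.+1 (q x)) *
    'D_(delta_mx 0 i) q x = 'D_(delta_mx 0 i) (fun x => flat j (q x) : R^o) x.
  move=> Ux; rewrite [RHS]deriveE; last exact: dc.
  rewrite (diff_comp (dq x Ux) (df j (q x))) /= -(deriveE (delta_mx 0 i) (dq x Ux)).
  have [d1 d2] := is_derive_flat j (q x).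
  have d3 : 'd (flat j : R^o -> R^o) (q x) 1 = flat j.+2 (q x) - j%:R * flat j.+1 (q x).
    by rewrite -d2 deriveE.
  by rewrite mulNr mulrC -d3; exact/esym/linear_regular.
apply: (Ck_eq oU E); apply: (CkM oU _ (@smooth_partial _ _ _ _ _ i sq k)).
by apply: (CkD oU) => //; apply: (CkM oU) => //; exact: Ck_cst.
Qed.

(** [q] is built from the Euclidean distance, whose square is smooth. It is nonpositive as soon as
    one coordinate differs by [e], that is, outside the ball of the maximum norm. *)
Lemma bump n (a : 'rV[R]_n) (e : R) : 0 < e ->
  exists2 chi : 'rV[R]_n -> R^o, smooth setT chi &
    chi a != 0 /\ forall x, e <= `|x - a| -> chi x = 0.
Proof.
move=> e0; pose q (x : 'rV[R]_n) : R^o := e ^+ 2 + (-1) * \sum_i (x 0 i - a 0 i) ^+ 2.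
have oT : open (@setT 'rV[R]_n) by exact: openT.
have sq : smooth setT q.
  apply: smoothD => //; first exact: smooth_cst.
  apply: smoothM => //; first exact: smooth_cst.
  apply: smooth_sum => // i; apply: smoothX => //.
  by apply: smoothD => //; [exact: smooth_coord|exact: smooth_cst].
exists (fun x => flat 0 (q x)); first by move=> k; exact: Ck_flat.
split=> [|x ex]; rewrite /flat.
  have -> : q a = e ^+ 2.
    rewrite /q big1 ?mulr0 ?addr0 // => i _.
    by rewrite subrr expr0n.
  by rewrite exprn_gt0 // expr0 mul1r gt_eqF // expR_gt0.
rewrite ltNge [X in ~~ X](_ : _ = true) // /q mulN1r subr_le0.
have [i ei] : exists i, e <= `|x 0 i - a 0 i|.
  apply: contrapT => /forallNP H.
  suff : `|x - a| < e by rewrite ltNge ex.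
  rewrite [ltLHS]/Num.Def.normr /= mx_normrE; apply: bigmax_lt => // -[i j] _ /=.
  by rewrite ord1 !mxE ltNge; apply/negP; exact: H.
rewrite (bigD1 i) //= ler_wpDr ?sumr_ge0 //; first by move=> *; exact: sqr_ge0.
by rewrite -[leRHS]real_normK ?num_real // lerXn2r ?nnegrE ?(ltW e0).
Qed.

End bump.

(** * Charts *)

(** Allows scalar and matrix-valued maps to be treated together in charts; the two instances
    follow. *)
Definition compositional (R : realType) (W : normedModType R) :=
  forall n m (U : set 'rV[R]_m) (V : set 'rV[R]_n)
    (F : 'rV[R]_m -> 'rV[R]_n) (G : 'rV[R]_n -> W),
  open U -> open V -> (forall x, U x -> V (F x)) ->
  smooth U F -> smooth V G -> smooth U (G \o F).

Lemma compositionalR (R : realType) : compositional R^o.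
Proof. by move=> n m U V F G; exact: smooth_comp. Qed.

Lemma compositional_mx (R : realType) p q : compositional 'M[R]_(p, q).
Proof. by move=> n m U V F G; exact: smooth_comp_mx. Qed.

Section calculus_extra.
Context {R : realType} {n : nat}.

(** As [partial] is a right-sided limit, [f] has to agree with the differentiable [F] only along the
    forward ray from [x]. *)
Lemma partialE (i : 'I_n) (f : 'rV[R]_n -> R) (F : 'rV[R]_n -> R^o) x :
  (\forall h \near 0^'+, f (x + h *: delta_mx 0 i) = F (x + h *: delta_mx 0 i)) ->
  f x = F x -> differentiable F x -> partial i f x = 'D_(delta_mx 0 i) F x.
Proof.
move=> fF fx dF; have cF : derivable F x (delta_mx 0 i) by exact: diff_derivable.
have H : (fun h : R => h^-1 *: ((F \o shift x) (h *: delta_mx 0 i) - F x)) @ 0^'+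
    --> 'D_(delta_mx 0 i) F x by exact: (cvg_dnbhs_at_right cF).
apply: cvg_lim => //; apply: cvg_trans H; apply: near_eq_cvg.
by apply: filterS fF => h /= ->; rewrite fx [h *: _ + x]addrC.
Qed.

(** Two-sided counterpart of [jac], meant for the smooth extensions; [jacE] identifies the two at
    chart points. *)
Definition Jmx m (F : 'rV[R]_n -> 'rV[R]_m) (x : 'rV[R]_n) : 'M[R]_(n, m) :=
  \matrix_(i, j) 'D_(delta_mx 0 i) (fun y => F y 0 j : R^o) x.

Lemma smooth_Jmx m U (F : 'rV[R]_n -> 'rV[R]_m) : open U -> smooth U F ->
  smooth U (Jmx F).
Proof.
move=> oU /(smooth_mxP _ oU) sF; apply/smooth_mxP => // i j.
rewrite (_ : (fun x => _) = 'D_(delta_mx 0 i) (fun y => F y 0 j : R^o)).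
  by apply: smooth_partial; exact: sF.
by apply/funext => x; rewrite mxE.
Qed.

Lemma open_preimage_on (m : nat) (U : set 'rV[R]_n) (V : set 'rV[R]_m)
    (F : 'rV[R]_n -> 'rV[R]_m) :
  open U -> open V -> (forall x, U x -> {for x, continuous F}) ->
  open (U `&` F @^-1` V).
Proof.
move=> oU oV cF; rewrite openE => x [Ux Vx]; apply: filterI.
  exact: open_nbhs_nbhs.
by apply: (cF x Ux); exact: open_nbhs_nbhs.
Qed.

End calculus_extra.

Lemma Jmx_comp (R : realType) n m p (F : 'rV[R]_n -> 'rV[R]_m)
    (G : 'rV[R]_m -> 'rV[R]_p) x :
  differentiable F x -> differentiable G (F x) ->
  Jmx (G \o F) x = Jmx F x *m Jmx G (F x).
Proof.
move=> dF dG; apply/matrixP => i j; rewrite !mxE.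
have dGj : differentiable (fun y => G y 0 j : R^o) (F x).
  exact: (differentiable_comp dG (differentiable_coord (G (F x)) 0 j)).
rewrite (derive_compE (delta_mx 0 i) dF dGj).
by apply: eq_bigr => l _; rewrite !mxE.
Qed.

(** * Neighbourhoods and smoothness read in one chart *)

Section atlas.
Context {R : realType} {T : Type} {n : nat}.
Implicit Types (c d e : chart R T n) (p q : T) (P Q D : set T).

(* Neighbourhoods read in a chart: [bdT] carries no topology in this setting. *)
Definition cnbhs c p : set_system T :=
  [set P | \forall x \near c p, forall q, cdom c q -> c q = x -> P q].

Global Instance cnbhs_filter c p : Filter (cnbhs c p) | 100.
Proof.
split.
- exact: (@filterE _ (nbhs (c p))).
- move=> P Q HP HQ; apply: (@filterS2 _ (nbhs (c p)) _ _ _ _ _ HP HQ) => x {}HP {}HQ q cq e.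
  by split; [exact: HP|exact: HQ].
- move=> P Q PQ HP; apply: (@filterS _ (nbhs (c p)) _ _ _ _ HP) => x {}HP q cq e.
  by apply: PQ; exact: HP.
Qed.

#[global] Typeclasses Opaque cnbhs.

Lemma cnbhsP c p P : cnbhs c p P <->
  exists V, [/\ open V, V (c p) & forall q, cdom c q -> V (c q) -> P q].
Proof.
split=> [H0|[V [oV Vp H]]].
  have : nbhs (c p) [set x | forall q, cdom c q -> c q = x -> P q] := H0.
  rewrite nbhsE => -[V [oV Vp] H]; exists V; split=> // q cq Vq.
  exact: H Vq q cq erefl.
apply: (@filterS _ (nbhs (c p)) _ V _ _ (open_nbhs_nbhs (conj oV Vp))).
by move=> x Vx q cq e; apply: H => //; rewrite e.
Qed.

Lemma cnbhs_point c p P : cdom c p -> cnbhs c p P -> P p.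
Proof. by move=> cp /cnbhsP [V [_ Vp]]; exact. Qed.

Lemma cnbhs_preim c p (V : set 'rV[R]_n) : nbhs (c p) V -> cnbhs c p (c @^-1` V).
Proof.
by move=> nV; apply: (@filterS _ (nbhs (c p)) _ V _ _ nV) => x Vx q _ /= ->.
Qed.

Lemma cnbhs_dom c p : cnbhs c p (cdom c).
Proof. by apply: (@filterE _ (nbhs (c p))) => x q. Qed.

(** Pointwise form of [smooth_on]: [F] lives on a full open set and is constrained only at images of
    points of the chart, so at a boundary point its values on the far side are free. *)
Definition csmooth (W : normedModType R) c p (f : T -> W) :=
  exists V (F : 'rV[R]_n -> W), [/\ open V, V (c p), smooth V F &
    forall q, cdom c q -> V (c q) -> f q = F (c q)].

Section csmooth_gen.
Context {W : normedModType R}.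
Implicit Types (f g : T -> W).

Lemma csmooth_in c p f P : csmooth c p f -> cnbhs c p P ->
  exists (r : R) (F : 'rV[R]_n -> W), [/\ 0 < r, smooth (ball (c p) r) F &
    forall q, cdom c q -> ball (c p) r (c q) -> f q = F (c q) /\ P q].
Proof.
move=> [V [F [oV Vp sF EF]]] /cnbhsP [V' [oV' Vp' H]].
have : nbhs (c p) (V `&` V') by apply: filterI; exact: open_nbhs_nbhs.
move=> /nbhs_ballP [r r0 Hr]; exists r, F; split => //.
  by apply: smooth_subset sF => x /Hr [].
by move=> q cq /Hr [Vq Vq']; split; [exact: EF|exact: H].
Qed.

Lemma csmooth_eq c p f g : cnbhs c p [set q | f q = g q] ->
  csmooth c p f -> csmooth c p g.
Proof.
move=> E sf; have [r [F [r0 sF H]]] := csmooth_in sf E.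
exists (ball (c p) r), F; split=> //; first exact: ball_open.
  exact: ballxx.
by move=> q cq Bq; have [<- <-] := H q cq Bq.
Qed.

Lemma csmooth_near c p f : csmooth c p f -> cnbhs c p (csmooth c ^~ f).
Proof.
move=> [V [F [oV Vp sF EF]]]; apply/cnbhsP; exists V; split=> // q cq Vq.
by exists V, F.
Qed.

Lemma csmooth_cst c p (a : W) : csmooth c p (cst a).
Proof.
by exists setT, (cst a); split => //; [exact: openT|exact: smooth_cst].
Qed.

Lemma csmooth_continuous c p f (V : set W) : cdom c p -> csmooth c p f ->
  nbhs (f p) V -> cnbhs c p (f @^-1` V).
Proof.
move=> cp [U [F [oU Up sF EF]]]; rewrite (EF p cp Up) => nV.
have cF : {for c p, continuous F} by exact: smooth_continuous Up.
have : nbhs (c p) (U `&` F @^-1` V).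
  by apply: filterI; [exact: open_nbhs_nbhs|exact: cF].
by apply: filterS => x [Ux Vx] q cq e; rewrite /= EF // e.
Qed.

End csmooth_gen.

Lemma csmooth_map2 (W1 W2 W3 : normedModType R) (op : W1 -> W2 -> W3) c p f g :
  (forall U (F : 'rV[R]_n -> W1) (G : 'rV[R]_n -> W2), open U ->
    smooth U F -> smooth U G -> smooth U (fun x => op (F x) (G x))) ->
  csmooth c p f -> csmooth c p g -> csmooth c p (fun q => op (f q) (g q)).
Proof.
move=> H [U [F [oU Up sF EF]]] [V [G [oV Vp sG EG]]].
exists (U `&` V), (fun x => op (F x) (G x)); split => //; first exact: openI.
  apply: H; first exact: openI.
    by apply: smooth_subset sF => x [].
  by apply: smooth_subset sG => x [].
by move=> q cq [Uq Vq]; rewrite EF // EG.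
Qed.

Lemma csmooth_mxP k l c p (f : T -> 'M[R]_(k, l)) :
  csmooth c p f <-> forall i j, csmooth c p (fun q => f q i j : R^o).
Proof.
split=> [[U [F [oU Up sF EF]]] i j|H].
  exists U, (fun x => F x i j); split => //.
    by move: sF => /(smooth_mxP _ oU); exact.
  by move=> q cq Uq; rewrite EF.
have H' (ij : 'I_k * 'I_l) : exists F : 'rV[R]_n -> R^o,
    exists2 V, open V /\ V (c p) & smooth V F /\
      forall q, cdom c q -> V (c q) -> f q ij.1 ij.2 = F (c q).
  by have [V [F [oV Vp sF EF]]] := H ij.1 ij.2; exists F, V.
have [F HF] := choice H'.
(* [choice] expects a plain existential, so the [exists2] provided by [HF] is repacked. *)
have [V HV] := choice (fun ij => let: ex_intro2 V a b := HF ij in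
  ex_intro (fun V => (open V /\ V (c p)) /\ (smooth V (F ij) /\
      forall q, cdom c q -> V (c q) -> f q ij.1 ij.2 = F ij (c q))) V (conj a b)).
have : nbhs (c p) (\bigcap_(ij in setT) V ij).
  have N ij : \forall x \near c p, V ij x.
    by have [[oV Vp] _] := HV ij; exact: open_nbhs_nbhs.
  by apply: filterS (filter_forall _ N) => x Hx ij _; exact: Hx.
move=> /nbhs_ballP [r r0 Hr].
exists (ball (c p) r), (fun x => \matrix_(i, j) F (i, j) x); split.
- exact: ball_open.
- exact: ballxx.
- apply/smooth_mxP; first exact: ball_open.
  move=> i j; have [_ [sF _]] := HV (i, j).
  rewrite (_ : (fun x => _) = F (i, j)); last by apply/funext => x; rewrite mxE.
  by apply: smooth_subset sF => x /Hr /(_ (i, j)); exact.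
- move=> q cq /Hr Bq; apply/matrixP => i j; rewrite mxE.
  by have [_ [_]] := HV (i, j); apply => //; exact: Bq.
Qed.

Lemma csmoothD (W : normedModType R) c p (f g : T -> W) :
  csmooth c p f -> csmooth c p g -> csmooth c p (fun q => f q + g q).
Proof. by apply: csmooth_map2 => U F G; exact: smoothD. Qed.

Lemma csmoothM c p (f g : T -> R^o) :
  csmooth c p f -> csmooth c p g -> csmooth c p (fun q => f q * g q : R^o).
Proof. by apply: csmooth_map2 => U F G; exact: smoothM. Qed.

Lemma csmoothZ k l c p (f : T -> R^o) (g : T -> 'M[R]_(k, l)) :
  csmooth c p f -> csmooth c p g -> csmooth c p (fun q => (f q : R) *: g q).
Proof. by apply: (csmooth_map2 (op := fun a b => (a : R) *: b)) => U F G; exact: smoothZ. Qed.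

Lemma csmooth_mulmx k l m c p (f : T -> 'M[R]_(k, l)) (g : T -> 'M[R]_(l, m)) :
  csmooth c p f -> csmooth c p g -> csmooth c p (fun q => f q *m g q).
Proof. by apply: csmooth_map2 => U F G; exact: smooth_mulmx. Qed.

Lemma csmooth_trmx k l c p (f : T -> 'M[R]_(k, l)) :
  csmooth c p f -> csmooth c p (fun q => (f q)^T).
Proof.
move=> sf; apply: (csmooth_map2 (op := fun a b : 'M[R]_(k, l) => a^T) _ sf sf).
by move=> U F G oU sF _; exact: smooth_trmx.
Qed.

Lemma csmoothN k l c p (f : T -> 'M[R]_(k, l)) :
  csmooth c p f -> csmooth c p (fun q => - f q).
Proof.
move=> sf; have := csmoothZ (csmooth_cst c p (-1 : R^o)) sf.
by apply: csmooth_eq; apply: filterE => q /=; rewrite scaleN1r.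
Qed.

Lemma csmoothV c p (f : T -> R^o) : cdom c p -> f p != 0 ->
  csmooth c p f -> csmooth c p (fun q => (f q)^-1 : R^o).
Proof.
move=> cp f0 [U [F [oU Up sF EF]]].
have Fp : F (c p) != 0 by rewrite -EF.
have : nbhs (c p) (U `&` [set x | F x != 0]).
  apply: filterI; first exact: open_nbhs_nbhs.
  have cF : {for c p, continuous F} by exact: smooth_continuous Up.
  have nF : nbhs (F (c p)) [set y : R^o | y != 0].
    by apply: open_nbhs_nbhs; split; [exact: open_neq|].
  exact: (cF _ nF).
move=> /nbhs_ballP [r r0 Hr].
exists (ball (c p) r), (fun x => (F x)^-1); split.
- exact: ball_open.
- exact: ballxx.
- apply: smoothV; [exact: ball_open|by move=> x /Hr []|].
  by apply: smooth_subset sF => x /Hr [].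
- by move=> q cq /Hr [Uq _]; rewrite EF.
Qed.

Lemma csmoothX k c p (f : T -> R^o) :
  csmooth c p f -> csmooth c p (fun q => f q ^+ k : R^o).
Proof.
move=> sf; apply: (csmooth_map2 (op := fun a b : R^o => a ^+ k) _ sf sf).
by move=> U F G oU sF _; exact: smoothX.
Qed.

Lemma csmooth_chart c p : csmooth c p c.
Proof.
by exists setT, id; split=> //; [exact: openT|apply: smooth_id; exact: openT].
Qed.

Lemma csmooth_coord c p i : csmooth c p (fun q => c q 0 i : R^o).
Proof. by have /csmooth_mxP := csmooth_chart c p; exact. Qed.

End atlas.

Section maps.
Context {R : realType} {T T' : Type} {n n' : nat}.
Implicit Types (c : chart R T n) (d : chart R T' n').

Lemma cnbhs_map c d (f : T -> T') p (P : set T') : cdom c p ->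
  csmooth c p (d \o f) -> cnbhs c p [set q | cdom d (f q)] ->
  cnbhs d (f p) P -> cnbhs c p (f @^-1` P).
Proof.
move=> cp sf df /cnbhsP [V [oV Vp H]].
have := csmooth_continuous cp sf (open_nbhs_nbhs (conj oV Vp)).
by move: df; apply: filterS2 => q dq Vq; exact: H.
Qed.

Lemma csmooth_comp (W : normedModType R) c d (f : T -> T') p (u : T' -> W) :
  compositional W -> cdom c p ->
  csmooth c p (d \o f) -> cnbhs c p [set q | cdom d (f q)] ->
  csmooth d (f p) u -> csmooth c p (u \o f).
Proof.
move=> cW cp sf df [V [G [oV Vp sG EG]]].
have [r [F [r0 sF EF]]] := csmooth_in sf df.
have [EFp dp] := EF p cp (ballxx _ r0).
have oB : open (ball (c p) r) by exact: ball_open.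
exists (ball (c p) r `&` F @^-1` V), (G \o F).
have oU : open (ball (c p) r `&` F @^-1` V).
  by apply: open_preimage_on => // x; exact: smooth_continuous.
split => //.
- by split; [exact: ballxx|rewrite /= -EFp].
- apply: (cW _ _ _ V) => //; first by move=> x [].
  by apply: smooth_subset sF => x [].
- move=> q cq [/(EF q cq) [E dq]]; rewrite /= in E *; rewrite /= -E => Vq.
  exact: EG.
Qed.

End maps.

(* Common setting for a manifold with boundary ([H] the half-space) and for its
   boundary ([H] the whole space). *)
Record is_atlas (R : realType) (T : Type) (n : nat) (H : set 'rV[R]_n)
    (A : set (chart R T n)) : Prop := IsAtlas {
  atlas_orthant : forall x v : 'rV[R]_n, H x -> (forall i, 0 <= v 0 i) -> H (x + v);
  atlas_inj : forall c, A c -> forall p q, cdom c p -> cdom c q -> c p = c q -> p = q;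
  atlas_cover : forall p, exists2 c, A c & cdom c p;
  atlas_image : forall c p, A c -> cdom c p -> H (c p);
  atlas_open : forall c d p, A c -> A d -> cdom c p -> cdom d p ->
    \forall x \near c p, H x -> exists q, [/\ cdom c q, cdom d q & c q = x];
  atlas_transition : forall c d, A c -> A d ->
    smooth_on (cimage c (cdom d)) (coord c d)
}.

(** * Smooth maps, tensors and pullbacks on an atlas *)

Section atlas_theory.
Context {R : realType} {T : Type} {n : nat} {H : set 'rV[R]_n}.
Context {A : set (chart R T n)} (atl : is_atlas H A).
Implicit Types (c d e : chart R T n) (p q : T) (P D E : set T) (f g : T -> T).

Lemma coord_inj (W : normedModType R) c (f : T -> W) p :
  (forall p q, cdom c p -> cdom c q -> c p = c q -> p = q) ->
  cdom c p -> coord c f (c p) = f p.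
Proof.
move=> ic cp; rewrite /coord.
have [|q [cq e] <-] := @xgetPex _ 0 [set f q | q in [set q | cdom c q /\ c q = c p]].
  by exists (f p), p.
by rewrite (ic _ _ cq cp e).
Qed.

Lemma csmooth_smooth_on (W : normedModType R) c D (f : T -> W) :
  (forall p q, cdom c p -> cdom c q -> c p = c q -> p = q) ->
  (forall p, cdom c p -> D p -> csmooth c p f) -> smooth_on (cimage c D) (coord c f).
Proof.
move=> ic sf _ [p [cp Dp] <-]; have [V [F [oV Vp sF EF]]] := sf p cp Dp.
exists V, F; split=> // _ [q [cq Dq] <-] Vq.
by rewrite coord_inj // EF.
Qed.

Lemma coordE (W : normedModType R) c (f : T -> W) p : A c -> cdom c p ->
  coord c f (c p) = f p.
Proof. by move=> Ac; apply: coord_inj; exact: (atlas_inj atl). Qed.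

Lemma smooth_on_csmooth (W : normedModType R) c D (f : T -> W) p : A c ->
  cdom c p -> cnbhs c p D -> smooth_on (cimage c D) (coord c f) -> csmooth c p f.
Proof.
move=> Ac cp nD sf; have Dp := cnbhs_point cp nD.
have [|U [F [oU Up sF EF]]] := sf (c p); first by exists p.
have [V [oV Vp VD]] := (cnbhsP _ _ _).1 nD.
exists (U `&` V), F; split=> //; first exact: openI.
  by apply: smooth_subset sF => x [].
move=> q cq [Uq Vq]; rewrite -EF ?coordE //; exists q => //.
by split => //; exact: VD.
Qed.

Lemma cnbhs_cdom c d p : A c -> A d -> cdom c p -> cdom d p -> cnbhs c p (cdom d).
Proof.
move=> Ac Ad cp dp.
apply: (@filterS _ (nbhs (c p)) _ _ _ _ (atlas_open atl Ac Ad cp dp)).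
move=> x Hx q cq e.
 have [|q' [cq' dq' e']] := Hx.
  by rewrite -e; exact: (atlas_image atl).
by rewrite (atlas_inj atl Ac cq cq') // e.
Qed.

Lemma csmooth_transition c d p : A c -> A d -> cdom c p -> cdom d p -> csmooth c p d.
Proof.
move=> Ac Ad cp dp; apply: (smooth_on_csmooth Ac cp (cnbhs_cdom Ac Ad cp dp)).
exact: atlas_transition atl _ _ Ac Ad.
Qed.

Lemma csmooth_chart_change (W : normedModType R) c d p (f : T -> W) :
  compositional W -> A c -> A d -> cdom c p -> cdom d p ->
  csmooth d p f -> csmooth c p f.
Proof.
move=> cW Ac Ad cp dp sf.
exact: (csmooth_comp (f := id) cW cp (csmooth_transition Ac Ad cp dp)
  (cnbhs_cdom Ac Ad cp dp) sf).
Qed.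

Lemma cnbhs_chart_change c d p P : A c -> A d -> cdom c p -> cdom d p ->
  cnbhs d p P -> cnbhs c p P.
Proof.
move=> Ac Ad cp dp nP.
exact: (cnbhs_map (f := id) cp (csmooth_transition Ac Ad cp dp)
  (cnbhs_cdom Ac Ad cp dp) nP).
Qed.

(** [H] is stable under adding vectors with nonnegative coordinates, so short forward rays along the
    axes stay in the image of the chart. Hence [partial] sees only values that the function on the
    manifold determines. *)
Lemma near_orthant c q (P : set 'rV[R]_n) i : A c -> cdom c q -> nbhs (c q) P ->
  \forall h \near (0 : R)^'+, P (c q + h *: delta_mx 0 i) /\
    exists q', cdom c q' /\ c q' = c q + h *: delta_mx 0 i.
Proof.
move=> Ac cq nP.
pose Q x := P x /\ (H x -> exists q', [/\ cdom c q', cdom c q' & c q' = x]).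
have N0 : nbhs (c q + (0 : R) *: (delta_mx 0 i : 'rV[R]_n)) Q.
  by rewrite scale0r addr0; exact: filterI nP (atlas_open atl Ac Ac cq cq).
have cl : {for (0 : R), continuous (fun h : R => c q + h *: (delta_mx 0 i : 'rV[R]_n))}.
  have c1 : {for (0 : R), continuous (fun h : R => h *: (delta_mx 0 i : 'rV[R]_n))}.
    exact: scalel_continuous.
  exact: (continuousD (@cst_continuous _ _ (c q) _) c1).
have N := cvg_at_right_filter cl N0.
near=> h; have h0 : 0 < h by near: h; exact: nbhs_right_gt.
have [Ph Hh] : Q (c q + h *: delta_mx 0 i) by near: h; exact: N.
split=> //; have [|q' [cq' _ e]] := Hh; last by exists q'.
apply: atlas_orthant atl _ _ (atlas_image atl Ac cq) _ => j.
by rewrite !mxE eqxx /= mulr_ge0 // ltW.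
Unshelve. all: by end_near. Qed.

Lemma partial_coordE c (V : set 'rV[R]_n) (F : 'rV[R]_n -> R^o)
    (g : 'rV[R]_n -> R) q i : A c -> cdom c q -> open V -> V (c q) ->
  differentiable F (c q) ->
  (forall q', cdom c q' -> V (c q') -> g (c q') = F (c q')) ->
  partial i g (c q) = 'D_(delta_mx 0 i) F (c q).
Proof.
move=> Ac cq oV Vq dF EF; apply: partialE => //; last exact: EF.
apply: filterS (near_orthant i Ac cq (open_nbhs_nbhs (conj oV Vq))).
by move=> h [Vh [q' [cq' e]]]; rewrite -e; apply: EF => //; rewrite e.
Qed.

Lemma jacE m c (V : set 'rV[R]_n) (F : 'rV[R]_n -> 'rV[R]_m) (f : T -> 'rV[R]_m) q :
  A c -> cdom c q -> open V -> V (c q) -> smooth V F ->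
  (forall q', cdom c q' -> V (c q') -> f q' = F (c q')) ->
  jac (coord c f) (c q) = Jmx F (c q).
Proof.
move=> Ac cq oV Vq sF EF; apply/matrixP => i j; rewrite !mxE.
apply: (partial_coordE i Ac cq oV Vq).
  by move: sF => /(smooth_mxP _ oV)/(_ 0 j) /smooth_differentiable; exact.
by move=> q' cq' Vq'; rewrite coordE // EF.
Qed.

Lemma gradientE c (V : set 'rV[R]_n) (F : 'rV[R]_n -> R^o) (f : T -> R^o) q i :
  A c -> cdom c q -> open V -> V (c q) -> smooth V F ->
  (forall q', cdom c q' -> V (c q') -> f q' = F (c q')) ->
  gradient (coord c f) (c q) 0 i = 'D_(delta_mx 0 i) F (c q).
Proof.
move=> Ac cq oV Vq sF EF; rewrite mxE.
apply: (partial_coordE i Ac cq oV Vq).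
  exact: smooth_differentiable Vq.
by move=> q' cq' Vq'; rewrite coordE // EF.
Qed.

Lemma csmooth_jac m c p (f : T -> 'rV[R]_m) : A c -> csmooth c p f ->
  csmooth c p (fun q => jac (coord c f) (c q)).
Proof.
move=> Ac [V [F [oV Vp sF EF]]]; exists V, (Jmx F); split=> //.
  exact: smooth_Jmx.
by move=> q cq Vq; exact: (jacE Ac cq oV Vq sF EF).
Qed.

Lemma jac_comp c d p m f (u : T -> 'rV[R]_m) : A c -> A d -> cdom c p ->
  csmooth c p (d \o f) -> cnbhs c p [set q | cdom d (f q)] ->
  csmooth d (f p) u ->
  jac (coord c (u \o f)) (c p) =
  jac (coord c (d \o f)) (c p) *m jac (coord d u) (d (f p)).
Proof.
move=> Ac Ad cp sf df [V [G [oV Vp sG EG]]].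
have [r [F [r0 sF EF]]] := csmooth_in sf df.
have [EFp dp] := EF p cp (ballxx _ r0).
have oB : open (ball (c p) r) by exact: ball_open.
have oU : open (ball (c p) r `&` F @^-1` V).
  by apply: open_preimage_on => // x; exact: smooth_continuous.
have Bp : ball (c p) r (c p) by exact: ballxx.
rewrite /= in EFp; have Up : (ball (c p) r `&` F @^-1` V) (c p).
  by split => //; rewrite /= -EFp.
have sFU : smooth (ball (c p) r `&` F @^-1` V) F.
  by apply: smooth_subset sF => x [].
rewrite (jacE Ac cp oU Up (F := G \o F)); first last.
- move=> q cq [/(EF q cq) [/= Eq dq]]; rewrite /= -Eq => Vq; exact: EG.
- by apply: (compositional_mx oU oV _ sFU sG) => x [].
rewrite (jacE Ac cp oB Bp sF); last by move=> q cq /(EF q cq) [].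
rewrite (jacE Ad dp oV Vp sG EG) EFp Jmx_comp //.
  exact: smooth_differentiable sF Bp.
by apply: smooth_differentiable sG _; rewrite -EFp.
Qed.

Lemma gradient_comp c d p f (u : T -> R^o) : A c -> A d -> cdom c p ->
  csmooth c p (d \o f) -> cnbhs c p [set q | cdom d (f q)] ->
  csmooth d (f p) u ->
  gradient (coord c (u \o f : T -> R^o)) (c p) =
  gradient (coord d u) (d (f p)) *m (jac (coord c (d \o f)) (c p))^T.
Proof.
move=> Ac Ad cp sf df [V [G [oV Vp sG EG]]].
have [r [F [r0 sF EF]]] := csmooth_in sf df.
have [EFp dp] := EF p cp (ballxx _ r0).
have oB : open (ball (c p) r) by exact: ball_open.
have oU : open (ball (c p) r `&` F @^-1` V).
  by apply: open_preimage_on => // x; exact: smooth_continuous.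
have Bp : ball (c p) r (c p) by exact: ballxx.
rewrite /= in EFp; have Up : (ball (c p) r `&` F @^-1` V) (c p).
  by split => //; rewrite /= -EFp.
have sFU : smooth (ball (c p) r `&` F @^-1` V) F.
  by apply: smooth_subset sF => x [].
rewrite (jacE Ac cp oB Bp sF); last by move=> q cq /(EF q cq) [].
apply/matrixP => i0 i; rewrite (ord1 i0) {i0}.
rewrite (gradientE i Ac cp oU Up (F := G \o F)); first last.
- move=> q cq [/(EF q cq) [/= Eq dq]]; rewrite /= -Eq => Vq; exact: EG.
- by apply: (compositionalR oU oV _ sFU sG) => x [].
have dF := smooth_differentiable sF Bp.
have dG : differentiable G (F (c p)).
  by apply: smooth_differentiable sG _; rewrite -EFp.
rewrite (derive_compE (delta_mx 0 i) dF dG) mxE; apply: eq_bigr => j _.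
by rewrite (gradientE j Ad dp oV Vp sG EG) !mxE -EFp [LHS]mulrC.
Qed.

(** Rows are indexed by the source coordinates, so the chain rule composes from left to right and a
    tensor pulls back as [J *m t *m J^T]. *)
Definition dmx c d f p : 'M[R]_n := jac (coord c (d \o f)) (c p).

Lemma dmx_id c p : A c -> cdom c p -> dmx c c id p = 1%:M.
Proof.
move=> Ac cp.
rewrite /dmx (jacE Ac cp openT I (F := id)) //; last by apply: smooth_id; exact: openT.
by apply/matrixP => i j; rewrite !mxE derive_coord_delta.
Qed.

(** [smooth_map] provides one suitable pair of charts at each point. Computations need every pair;
    the transition maps bridge the gap in [smooth_mapP]. *)
Definition smap f := forall c d p, A c -> A d -> cdom c p -> cdom d (f p) ->
  cnbhs c p [set q | cdom d (f q)] /\ csmooth c p (d \o f).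

Lemma smooth_mapP f : smooth_map A f <-> smap f.
Proof.
split=> [sf c d p Ac Ad cp dp|sf p].
  have [c0 [d0 [V [[Ac0 Ad0] c0p [oV Vp] Hd sV]]]] := sf p.
  have d0p : cdom d0 (f p) by exact: Hd.
  have N0 : cnbhs c0 p [set q | cdom d0 (f q)].
    by apply/cnbhsP; exists V.
  have s0 : csmooth c0 p (d0 \o f).
    apply: smooth_on_csmooth sV => //.
    by apply: cnbhs_preim; exact: open_nbhs_nbhs.
  have N1 := cnbhs_map c0p s0 N0 (cnbhs_cdom Ad0 Ad d0p dp).
  have s1 : csmooth c0 p (d \o f).
    by apply: csmooth_comp c0p s0 N0 (csmooth_transition Ad0 Ad d0p dp);
       exact: compositional_mx.
  split; first exact: cnbhs_chart_change N1.
  by apply: csmooth_chart_change s1 => //; exact: compositional_mx.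
have [c Ac cp] := atlas_cover atl p.
have [d Ad dp] := atlas_cover atl (f p).
have [/cnbhsP [V [oV Vp Hd]] _] := sf c d p Ac Ad cp dp.
exists c, d, V; split => //.
apply: csmooth_smooth_on; first exact: (atlas_inj atl).
move=> q cq Vq.
by have [] := sf c d q Ac Ad cq (Hd q cq Vq).
Qed.

Lemma smap_id : smap id.
Proof.
move=> c d p Ac Ad cp dp; split; first exact: cnbhs_cdom.
exact: csmooth_transition.
Qed.

Lemma smap_comp f g : smap f -> smap g -> smap (g \o f).
Proof.
move=> sf sg c e p Ac Ae cp ep.
have [d Ad dp] := atlas_cover atl (f p).
have [Nf csf] := sf c d p Ac Ad cp dp.
have [Ng csg] := sg d e (f p) Ad Ae dp ep.
split; first exact: (cnbhs_map cp csf Nf Ng).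
exact: (csmooth_comp (compositional_mx (q:=_)) cp csf Nf csg).
Qed.

Lemma smap_near f c p P : smap f -> A c -> cdom c p ->
  (forall d, A d -> cdom d (f p) -> cnbhs d (f p) P) -> cnbhs c p (f @^-1` P).
Proof.
move=> sf Ac cp nP; have [d Ad dp] := atlas_cover atl (f p).
have [Nf csf] := sf c d p Ac Ad cp dp.
exact: (cnbhs_map cp csf Nf (nP d Ad dp)).
Qed.

Lemma smap_csmooth (W : normedModType R) f c d p (u : T -> W) :
  compositional W -> smap f -> A c -> A d -> cdom c p -> cdom d (f p) ->
  csmooth d (f p) u -> csmooth c p (u \o f).
Proof.
move=> cW sf Ac Ad cp dp su; have [Nf csf] := sf c d p Ac Ad cp dp.
exact: (csmooth_comp cW cp csf Nf su).
Qed.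

Lemma dmx_comp f g c d e p : smap f -> smap g -> A c -> A d -> A e ->
  cdom c p -> cdom d (f p) -> cdom e (g (f p)) ->
  dmx c e (g \o f) p = dmx c d f p *m dmx d e g (f p).
Proof.
move=> sf sg Ac Ad Ae cp dp ep.
have [Nf csf] := sf c d p Ac Ad cp dp.
have [Ng csg] := sg d e (f p) Ad Ae dp ep.
exact: (jac_comp Ac Ad cp csf Nf csg).
Qed.

Lemma dmx_chart f c c' d p : smap f -> A c -> A c' -> A d ->
  cdom c p -> cdom c' p -> cdom d (f p) ->
  dmx c d f p = dmx c c' id p *m dmx c' d f p.
Proof. by move=> sf Ac Ac' Ad cp c'p dp; exact: (dmx_comp smap_id sf). Qed.

Lemma dmx_inverse f g c d p : smap f -> smap g -> cancel f g -> A c -> A d ->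
  cdom c p -> cdom d (f p) -> dmx c d f p *m dmx d c g (f p) = 1%:M.
Proof.
move=> sf sg fg Ac Ad cp dp; rewrite -(dmx_comp sf sg Ac Ad Ac cp dp) ?fg //.
rewrite (_ : g \o f = id) ?dmx_id //.
exact/funext.
Qed.

Lemma Diff_smap f : Diff A f -> smap f.
Proof. by move=> [/smooth_mapP]. Qed.

Lemma Diff_inverse f : Diff A f -> exists g, [/\ Diff A g, cancel f g & cancel g f].
Proof. by move=> [sf [g [sg fg gf]]]; exists g; split=> //; split=> //; exists f. Qed.

Lemma dmx_unit f c d p : Diff A f -> A c -> A d -> cdom c p -> cdom d (f p) ->
  dmx c d f p \in unitmx.
Proof.
move=> Df Ac Ad cp dp; have [g [Dg fg gf]] := Diff_inverse Df.
have := dmx_inverse (Diff_smap Df) (Diff_smap Dg) fg Ac Ad cp dp.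
by move=> /mulmx1_unit [].
Qed.

Lemma Diff_id : Diff A id.
Proof.
have s : smooth_map A id by apply/smooth_mapP; exact: smap_id.
by split=> //; exists id.
Qed.

Lemma Diff_comp f g : Diff A f -> Diff A g -> Diff A (f \o g).
Proof.
move=> [/smooth_mapP sf [f' [/smooth_mapP sf' ff' f'f]]].
move=> [/smooth_mapP sg [g' [/smooth_mapP sg' gg' g'g]]].
split; first by apply/smooth_mapP; exact: smap_comp.
exists (g' \o f'); split; first by apply/smooth_mapP; exact: smap_comp.
  exact: can_comp.
exact: can_comp.
Qed.

Lemma Diff_group : is_group (Diff A).
Proof.
by split; [exact: Diff_id|exact: Diff_comp|exact: Diff_inverse].
Qed.

(** Replaces openness, so that the same lemmas serve for the boundary, where only charts are
    available. *)
Definition locally_open D := forall c p, A c -> cdom c p -> D p -> cnbhs c p D.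

Lemma locally_open_preimage f D : smap f -> locally_open D -> locally_open (f @^-1` D).
Proof.
by move=> sf oD c p Ac cp Dp; apply: smap_near => // d Ad dp; exact: oD.
Qed.

Lemma smooth_funP (W : normedModType R) D (f : T -> W) : locally_open D ->
  smooth_fun A D f <-> forall c p, A c -> cdom c p -> D p -> csmooth c p f.
Proof.
move=> oD; split=> [sf c p Ac cp Dp|sf c Ac].
  by apply: (smooth_on_csmooth Ac cp _ (sf c Ac)); exact: oD.
apply: csmooth_smooth_on; first exact: (atlas_inj atl).
by move=> p cp Dp; exact: sf.
Qed.

Lemma smooth_fun_comp (W : normedModType R) f D (u : T -> W) :
  compositional W -> smap f -> locally_open D ->
  smooth_fun A D u -> smooth_fun A (f @^-1` D) (u \o f).
Proof.
move=> cW sf oD /(smooth_funP _ oD) su.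
apply/smooth_funP; first exact: locally_open_preimage.
move=> c p Ac cp Dp; have [d Ad dp] := atlas_cover atl (f p).
by apply: (smap_csmooth cW sf Ac Ad cp dp); exact: su.
Qed.

Definition tensor_law D (t : tensor R T n) := forall c d, A c -> A d ->
  forall p, D p -> cdom c p -> cdom d p ->
  t c p = dmx c d id p *m t d p *m (dmx c d id p)^T.

Lemma is_tensorP D t : locally_open D ->
  is_tensor A D t <->
  (forall c p, A c -> cdom c p -> D p -> csmooth c p (t c)) /\ tensor_law D t.
Proof.
move=> oD; split=> -[st lt]; split => //.
  move=> c p Ac cp Dp.
  by apply: (smooth_on_csmooth Ac cp _ (st c Ac)); exact: oD.
move=> c Ac; apply: csmooth_smooth_on; first exact: (atlas_inj atl).
by move=> p cp Dp; exact: st.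
Qed.

Definition chart_at p : chart R T n := s2val (cid2 (atlas_cover atl p)).

Lemma chart_atP p : A (chart_at p) /\ cdom (chart_at p) p.
Proof. by rewrite /chart_at; case: cid2. Qed.

(** Witness for the relation [is_pullback]. The chart chosen at [f p] is immaterial by the
    transformation law of [t], as [pullP] shows. *)
Definition pull f (t : tensor R T n) : tensor R T n := fun c p =>
  let d := chart_at (f p) in
  dmx c d f p *m t d (f p) *m (dmx c d f p)^T.

Lemma pullP f D t : smap f -> tensor_law D t ->
  is_pullback A (f @^-1` D) f t (pull f t).
Proof.
move=> sf lt c d Ac Ad p Dp cp dp J; rewrite /pull.
have [Ae ep] := chart_atP (f p); set e := chart_at _ in Ae ep *.
rewrite /J -/(dmx c d f p) (lt d e) //.
have -> : dmx c e f p = dmx c d f p *m dmx d e id (f p).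
  exact: (dmx_comp sf smap_id).
by rewrite !trmx_mul !mulmxA.
Qed.

Lemma is_pullback_sub D E f t h : E `<=` D ->
  is_pullback A D f t h -> is_pullback A E f t h.
Proof. by move=> ED pt c d Ac Ad p /ED; exact: pt. Qed.

Lemma is_pullback_comp D f g (t h h' : tensor R T n) : smap f -> smap g ->
  (forall p, D p -> D (g p)) ->
  is_pullback A D f t h -> is_pullback A D g h h' -> is_pullback A D (f \o g) t h'.
Proof.
move=> sf sg gD pf pg c e Ac Ae p Dp cp ep J.
have [d Ad dp] := atlas_cover atl (g p).
rewrite (pg c d Ac Ad p Dp cp dp) (pf d e Ad Ae (g p) (gD p Dp) dp ep).
rewrite /J -/(dmx c e (f \o g) p) (dmx_comp sg sf Ac Ad Ae cp dp ep).
by rewrite !trmx_mul !mulmxA.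
Qed.

Lemma is_pullback_comp_inv D f g (t h h' : tensor R T n) : smap f -> smap g ->
  (forall p, D p -> D (g p)) ->
  is_pullback A D f t h -> is_pullback A D (f \o g) t h' -> is_pullback A D g h h'.
Proof.
move=> sf sg gD pf pfg c d Ac Ad p Dp cp dp J.
have [e Ae ep] := atlas_cover atl (f (g p)).
rewrite (pfg c e Ac Ae p Dp cp ep) (pf d e Ad Ae (g p) (gD p Dp) dp ep).
rewrite /J -/(dmx c d g p) -/(dmx c e (f \o g) p) -/(dmx d e f (g p)).
rewrite (dmx_comp sg sf Ac Ad Ae cp dp ep).
by rewrite !trmx_mul !mulmxA.
Qed.

Lemma pullback_tensor D f t h : smap f -> locally_open D -> is_tensor A D t ->
  is_pullback A (f @^-1` D) f t h -> is_tensor A (f @^-1` D) h.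
Proof.
move=> sf oD /(is_tensorP _ oD) [st lt] ph.
have oE := locally_open_preimage sf oD.
apply/is_tensorP => //; split=> [c p Ac cp Dp|c d Ac Ad p Dp cp dp]; last first.
  have [e Ae ep] := atlas_cover atl (f p).
  rewrite (ph c e Ac Ae p Dp cp ep) (ph d e Ad Ae p Dp dp ep).
  rewrite -/(dmx c e f p) -/(dmx d e f p) (dmx_chart sf Ac Ad Ae cp dp ep).
  by rewrite !trmx_mul !mulmxA.
have [d Ad dp] := atlas_cover atl (f p).
have [Nf csf] := sf c d p Ac Ad cp dp.
have cJ : csmooth c p (dmx c d f) by exact: csmooth_jac.
have ct : csmooth c p (t d \o f).
  by apply: (smap_csmooth _ sf Ac Ad cp dp); [exact: compositional_mx|exact: st].
have := csmooth_mulmx (csmooth_mulmx cJ ct) (csmooth_trmx cJ).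
apply: csmooth_eq; have NE := oE c p Ac cp Dp.
apply: filterS2 (filterI Nf NE) (cnbhs_dom c p) => q [dq Eq] cq /=.
by rewrite (ph c d Ac Ad q Eq cq dq).
Qed.

Lemma pullback_metric D f t h : Diff A f -> locally_open D ->
  (forall p, D p -> D (f p)) -> is_metric A D t ->
  is_pullback A D f t h -> is_metric A D h.
Proof.
move=> Df oD fD [tt st [k sk]] ph; have sf := Diff_smap Df.
have DD : D `<=` f @^-1` D by [].
split.
- have oE := locally_open_preimage sf oD.
  have [_ lt] := (is_tensorP _ oD).1 tt.
  have pp := pullP sf lt.
  have /(is_tensorP _ oE) [sp lp] := pullback_tensor sf oD tt pp.
  have E c p : A c -> cdom c p -> D p -> pull f t c p = h c p.
    move=> Ac cp Dp; have [d Ad dp] := atlas_cover atl (f p).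
    by rewrite (ph c d Ac Ad p Dp cp dp) (pp c d Ac Ad p (DD _ Dp) cp dp).
  apply/is_tensorP => //; split=> [c p Ac cp Dp|c d Ac Ad p Dp cp dp].
    apply: csmooth_eq (sp c p Ac cp (DD _ Dp)).
    by apply: filterS2 (oD c p Ac cp Dp) (cnbhs_dom c p) => q Dq cq /=; exact: E.
  by rewrite -!E //; apply: lp => //; exact: DD.
- move=> c Ac p Dp cp; have [d Ad dp] := atlas_cover atl (f p).
  rewrite (ph c d Ac Ad p Dp cp dp) !trmx_mul trmxK (st d Ad (f p) (fD p Dp) dp).
  by rewrite mulmxA.
- exists k => c Ac p Dp cp; have [d Ad dp] := atlas_cover atl (f p).
  have [P uP EP] := sk d Ad (f p) (fD p Dp) dp.
  have uJ := dmx_unit Df Ac Ad cp dp.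
  exists (P *m invmx (dmx c d f p)).
    by rewrite unitmx_mul uP unitmx_inv.
  rewrite (ph c d Ac Ad p Dp cp dp) -/(dmx c d f p) trmx_mul !mulmxA.
  rewrite mulmxKV // -(mulmxA (P *m t d (f p))) -trmx_mul mulVmx // trmx1 mulmx1.
  exact: EP.
Qed.

(** * Diffeomorphisms preserving a class of tensors *)

Section stabilizer.
Variables (D : set T) (C : set (tensor R T n)).
Hypothesis C_law : forall t, C t -> tensor_law D t.
Hypothesis C_ext : forall t t', C t ->
  (forall c p, A c -> D p -> cdom c p -> t c p = t' c p) -> C t'.
Hypothesis Diff_D : forall f p, Diff A f -> D p -> D (f p).

(** A pullback is determined only in the charts of [A] and over [D]. Closure of [C] under changes
    elsewhere, [C_ext], is what makes this an equality. *)
Lemma pullback_class_id : pullback_class A D id C = C.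
Proof.
apply/seteqP; split=> [h [t Ct ph]|t Ct].
  apply: C_ext Ct _ => c p Ac Dp cp.
  by rewrite (ph c c Ac Ac p Dp cp cp) -/(dmx c c id p) dmx_id // mul1mx trmx1 mulmx1.
by exists t => // c d Ac Ad p Dp cp dp; exact: (C_law Ct).
Qed.

Lemma pullback_class_comp f g : Diff A f -> Diff A g ->
  pullback_class A D (f \o g) C = pullback_class A D g (pullback_class A D f C).
Proof.
move=> Df Dg; have [sf sg] := (Diff_smap Df, Diff_smap Dg).
have gD p : D p -> D (g p) by exact: Diff_D.
apply/seteqP; split=> [h [t Ct ph]|h [h1 [t Ct ph1] ph]]; last first.
  by exists t => //; exact: is_pullback_comp ph1 ph.
have pt : is_pullback A D f t (pull f t).
  apply: is_pullback_sub (pullP sf (C_law Ct)) => p Dp; exact: Diff_D.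
by exists (pull f t); [exists t|exact: is_pullback_comp_inv pt ph].
Qed.

Lemma stabilizer_group : is_group [set f | Diff A f /\ pullback_class A D f C = C].
Proof.
split.
- by split; [exact: Diff_id|exact: pullback_class_id].
- move=> f g [Df Cf] [Dg Cg]; split; first exact: Diff_comp.
  by rewrite pullback_class_comp // Cf.
- move=> f [Df Cf]; have [g [Dg fg gf]] := Diff_inverse Df.
  exists g; split=> //; split=> //.
  rewrite -[in LHS]Cf -pullback_class_comp // (_ : f \o g = id).
    exact: pullback_class_id.
  exact/funext.
Qed.

End stabilizer.

End atlas_theory.
Arguments smap {R T n} A f.
Arguments locally_open {R T n} A D.
Arguments tensor_law {R T n} A D t.

(** * Manifolds with boundary *)

Section manifold.
Context {R : realType} {n : nat} {T : topologicalType}.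
Context {A : set (chart R T n.+1)} (hM : manifold_with_boundary A).
Implicit Types (c d : chart R T n.+1) (U D P : set T) (rho : T -> R)
  (p q : T) (f : T -> T) (g h s t : tensor R T n.+1).

Lemma manifold_atlas : is_atlas (@halfspace R n) A.
Proof.
case: hM => _ _ cov ch tr; split => //.
- move=> x v; rewrite /halfspace /= => x0 v0; rewrite mxE.
  by rewrite addr_ge0.
- by move=> c Ac; have [] := ch c Ac.
- move=> c p Ac cp; have [_ _ _ /(_ setT openT) [V oV EV]] := ch c Ac.
  have : cimage c setT (c p) by exists p.
  by rewrite EV => -[].
- move=> c d p Ac Ad cp dp; have [od _ _ _] := ch d Ad.
  have [_ _ _ /(_ _ od) [V oV EV]] := ch c Ac.
  have : cimage c (cdom d) (c p) by exists p.
  rewrite EV => -[Vp _]; have nV : nbhs (c p) V by exact: open_nbhs_nbhs.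
  apply: filterS nV => x Vx Hx; have : (V `&` @halfspace R n) x by [].
  by rewrite -EV => -[q [cq dq] <-]; exists q.
Qed.

Local Notation atl := manifold_atlas.
Local Notation bd := (boundary A).
Local Notation int := (interior_part A).

Lemma nbhs_cnbhs c p P : A c -> cdom c p -> nbhs p P -> cnbhs c p P.
Proof.
move=> Ac cp; rewrite nbhsE => -[U [oU Up] UP].
have [_ ic _ /(_ U oU) [V oV EV]] : is_chart c by case: hM => _ _ _ + _; exact.
have : cimage c U (c p) by exists p.
rewrite EV => -[Vp _]; apply/cnbhsP; exists V; split=> // q cq Vq.
have : (V `&` @halfspace R n) (c q) by split=> //; exact: atlas_image atl _ _ Ac cq.
by rewrite -EV => -[q' [cq' Uq'] e]; apply: UP; rewrite -(ic _ _ cq' cq e).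
Qed.

Lemma cnbhs_open c p P : A c -> cdom c p -> cnbhs c p P ->
  exists U, [/\ open U, U p & forall q, U q -> cdom c q /\ P q].
Proof.
move=> Ac cp /cnbhsP [V [oV Vp VP]].
have [oc ic cc _] : is_chart c by case: hM => _ _ _ + _; exact.
exists (cdom c `&` c @^-1` V); split => //; last first.
  by move=> q [cq Vq]; split=> //; exact: VP.
rewrite openE => q [cq Vq]; apply: filterI; first exact: open_nbhs_nbhs.
by apply: (cc q cq); exact: open_nbhs_nbhs.
Qed.

Lemma open_locally_open U : open U -> locally_open A U.
Proof.
by move=> oU c p Ac cp Up; apply: nbhs_cnbhs => //; exact: open_nbhs_nbhs.
Qed.

Lemma coord0_ge0 c p : A c -> cdom c p -> 0 <= c p 0 0.
Proof. by move=> Ac cp; have := atlas_image atl Ac cp. Qed.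

Lemma near_chart_image c p : A c -> cdom c p ->
  \forall x \near c p, 0 <= (x : 'rV[R]_n.+1) 0 0 -> exists q, cdom c q /\ c q = x.
Proof.
move=> Ac cp; apply: filterS (atlas_open atl Ac Ac cp cp) => x Hx x0.
by have [//|q [cq _ e]] := Hx; exists q.
Qed.

Lemma near_coord0_gt0 c p : 0 < c p 0 0 -> \forall x \near c p, 0 < (x : 'rV[R]_n.+1) 0 0.
Proof.
move=> cp0; have co : {for c p, continuous (fun x : 'rV[R]_n.+1 => x 0 0 : R^o)}.
  exact: coord_continuous.
have n0 : nbhs (c p 0 0 : R^o) [set y : R^o | 0 < y].
  by apply: open_nbhs_nbhs; split => //; exact: open_gt.
exact: (co _ n0).
Qed.

(* If [f p] were on the boundary, the boundary-defining coordinate of [f] would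
   have an interior minimum at [p], killing a column of the Jacobian. *)
Lemma Diff_coord0 f c d p : Diff A f -> A c -> A d -> cdom c p ->
  cdom d (f p) -> 0 < c p 0 0 -> 0 < d (f p) 0 0.
Proof.
move=> Df Ac Ad cp dp c0; rewrite lt_neqAle coord0_ge0 // andbT.
apply/negP => /eqP d0; have sf := Diff_smap atl Df.
have [Nf csf] := sf c d p Ac Ad cp dp.
have [r [F [r0 sF EF]]] := csmooth_in csf Nf.
have [EFp _] := EF p cp (ballxx _ r0).
have uJ := dmx_unit atl Df Ac Ad cp dp.
suff J0 i : dmx c d f p i 0 = 0.
  have /matrixP/(_ 0 0) := mulVmx uJ.
  rewrite !mxE eqxx big1; last by move=> j _; rewrite J0 mulr0.
  by move=> /eqP; rewrite eq_sym oner_eq0.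
have oB : open (ball (c p) r) by exact: ball_open.
have Bp : ball (c p) r (c p) by exact: ballxx.
rewrite /dmx (jacE atl Ac cp oB Bp sF); last by move=> q cq /(EF q cq) [].
rewrite mxE; set v := delta_mx 0 i.
pose F0 (x : 'rV[R]_n.+1) : R^o := F x 0 0.
have dF0 x : ball (c p) r x -> differentiable F0 x.
  by move=> Bx; move: sF => /(smooth_mxP _ oB)/(_ 0 0)/smooth_differentiable; exact.
(* As [c p] is off the boundary hyperplane, a full neighbourhood of it is in the image of the chart,
   so [F0] is nonnegative on both sides along the axis. *)
have N : \forall x \near c p, ball (c p) r x /\ 0 <= F0 x.
  have N1 := near_chart_image Ac cp; have N2 := near_coord0_gt0 c0.
  have N3 : nbhs (c p) (ball (c p) r) by exact: nbhsx_ballx.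
  near=> x; have Bx : ball (c p) r x by near: x.
  split=> //; have x0 : 0 <= x 0 0 by apply: ltW; near: x.
  have [|q [cq e]] := near N1 x _ x0; first by [].
  rewrite -e /F0 in Bx *; have [<- dq] := EF q cq Bx.
  exact: coord0_ge0.
have [e e0 He] := (nbhs_ballP _ _).1 N.
have Hline (s : R) : s \in `]- e, e[ -> ball (c p) e (c p + s *: v).
  rewrite in_itv /= => /andP[s1 s2].
  rewrite -ball_normE /= opprD addNKr normrN normrZ.
  have : `|v| <= 1.
    rewrite [leLHS]/Num.Def.normr /= mx_normrE; apply: bigmax_le => // -[a b] _ /=.
    by rewrite /v mxE; case: (_ && _); rewrite ?normr1 ?normr0 ?ler01.
  move=> v1; apply: le_lt_trans (_ : `|s| < e); last by rewrite ltr_norml s1.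
  by rewrite ler_piMr.
have dF00 : differentiable F0 (c p + (0 : R) *: v).
  by apply: dF0; rewrite scale0r addr0.
have [dl El] := is_derive_line dF00.
rewrite scale0r addr0 in El; rewrite -[LHS]El.
have [|s /Hline/He[Bs _]||s /Hline/He[Bs Fs]|_ ->//] :=
    @derive1_at_min R (fun s : R => F0 (c p + s *: v)) (- e) e 0.
- by rewrite (@le_trans _ _ 0) ?oppr_le0 // ltW.
- by have [] := is_derive_line (dF0 _ Bs).
- by rewrite in_itv /= oppr_lt0 e0.
- by rewrite scale0r addr0 {1}/F0 -EFp /= -d0.
Unshelve. all: by end_near. Qed.

(** Invariance of the boundary under change of chart: [Diff_coord0] for the identity, read between
    two charts. *)
Lemma boundaryE c p : A c -> cdom c p -> bd p <-> c p 0 0 = 0.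
Proof.
move=> Ac cp; split=> [[d Ad [dp d0]]|c0]; last by exists c.
apply/eqP; apply: contraT => cn0.
have c0 : 0 < c p 0 0 by rewrite lt_neqAle eq_sym cn0 coord0_ge0.
have := Diff_coord0 (Diff_id atl) Ac Ad cp dp c0.
by rewrite d0 ltxx.
Qed.

Lemma interiorE c p : A c -> cdom c p -> int p <-> 0 < c p 0 0.
Proof.
move=> Ac cp; rewrite /interior_part /setC /mkset (boundaryE Ac cp).
by rewrite lt_neqAle coord0_ge0 // andbT eq_sym; split=> /eqP.
Qed.

Lemma Diff_interior f p : Diff A f -> int p -> int (f p).
Proof.
move=> Df ip; have [c Ac cp] := atlas_cover atl p.
have [d Ad dp] := atlas_cover atl (f p).
apply/(interiorE Ad dp); apply: (Diff_coord0 Df Ac Ad cp dp).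
exact/(interiorE Ac cp).
Qed.

Lemma Diff_boundary f p : Diff A f -> bd (f p) <-> bd p.
Proof.
move=> Df; have [g [Dg fg gf]] := Diff_inverse Df; split=> b.
  by apply: contrapT => /(Diff_interior Df).
by apply: contrapT => /(Diff_interior Dg); rewrite fg.
Qed.

Lemma interior_locally_open : locally_open A int.
Proof.
move=> c p Ac cp /(interiorE Ac cp) c0.
have N : cnbhs c p (c @^-1` [set x | 0 < x 0 0]).
  by apply: cnbhs_preim; exact: near_coord0_gt0.
by apply: filterS2 N (cnbhs_dom c p) => q /= q0 cq; exact/(interiorE Ac cq).
Qed.

(* The interior is dense. *)
Lemma csmooth_closed (W : normedModType R) c p (Q : T -> W) (Z : set W) :
  A c -> cdom c p -> closed Z -> csmooth c p Q ->
  cnbhs c p [set q | int q -> Z (Q q)] -> cnbhs c p [set q | Z (Q q)].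
Proof.
move=> Ac cp cZ sQ NZ; have [r [F [r0 sF EF]]] := csmooth_in sQ NZ.
have oB : open (ball (c p) r) by exact: ball_open.
apply/cnbhsP; exists (ball (c p) r); split=> //; first exact: ballxx.
move=> q cq Bq /=; have [EFq ZQ] := EF q cq Bq.
have [|/contrapT bq] := pselect (int q); first exact: ZQ.
rewrite EFq; apply: cZ => V nV.
have cF : {for c q, continuous F} by exact: smooth_continuous sF Bq.
have N1 : nbhs (c q) (ball (c p) r `&` F @^-1` V).
  by apply: filterI; [exact: open_nbhs_nbhs|exact: cF].
(* A short forward step along coordinate 0 leads from a boundary point into the interior. *)
have N2 := near_orthant atl 0 Ac cq N1.
have [t [t0 [[Bt Vt] [q' [cq' e]]]]] : exists t : R, 0 < t /\
    ((ball (c p) r `&` F @^-1` V) (c q + t *: delta_mx 0 0) /\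
    exists q', cdom c q' /\ c q' = c q + t *: delta_mx 0 0).
  have : \forall h \near (0 : R)^'+, 0 < h /\
     ((ball (c p) r `&` F @^-1` V) (c q + h *: delta_mx 0 0) /\
      exists q', cdom c q' /\ c q' = c q + h *: delta_mx 0 0).
    by apply: filterI N2; exact: nbhs_right_gt.
  by move=> /filter_ex [t Ht]; exists t.
exists (F (c q + t *: delta_mx 0 0)); split=> //.
rewrite -e in Bt *; have [<-] := EF q' cq' Bt; apply.
apply/(interiorE Ac cq'); rewrite e !mxE eqxx mulr1.
by rewrite (boundaryE Ac cq).1 // add0r.
Qed.

(** Hadamard's lemma asks that the extension [F] vanish on the hyperplane. Near [c p] each point of
    the hyperplane is the image of a boundary point, so the assumption on [B] suffices; [r2] is
    small enough for this. *)
Lemma csmooth_hadamard k l c p (B : T -> 'M[R]_(k, l)) : A c -> cdom c p -> bd p ->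
  csmooth c p B -> cnbhs c p [set q | bd q -> B q = 0] ->
  exists2 B' : T -> 'M[R]_(k, l), csmooth c p B' &
    cnbhs c p [set q | B q = c q 0 0 *: B' q].
Proof.
move=> Ac cp bp sB NB.
have [r [F [r0 sF EF]]] := csmooth_in sB NB.
have [r1 r10 Hr1] := (nbhs_ballP _ _).1 (near_chart_image Ac cp).
pose r2 := Num.min r r1.
have r20 : 0 < r2 by rewrite lt_min r0.
have s1 : ball (c p) r2 `<=` ball (c p) r by apply: le_ball; rewrite ge_min lexx.
have s2 : ball (c p) r2 `<=` ball (c p) r1.
  by apply: le_ball; rewrite ge_min lexx orbT.
have [|||v sv Ev] := @hadamard R n k l (c p) r2 F.
- exact/(boundaryE Ac cp).
- exact: smooth_subset sF.
- move=> x Bx x0; have [|q [cq e]] := Hr1 x (s2 x Bx); first by rewrite x0.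
  rewrite -e in Bx x0 *; have [<-] := EF q cq (s1 _ Bx); apply.
  exact/(boundaryE Ac cq).
exists (v \o c).
  exists (ball (c p) r2), v; split=> //; [exact: ball_open|exact: ballxx].
apply/cnbhsP; exists (ball (c p) r2).
split; [exact: ball_open|exact: ballxx|move=> q cq Bq /=].
by have [-> _] := EF q cq (s1 _ Bq); rewrite Ev.
Qed.

Lemma Diff_open_preimage f U : Diff A f -> open U -> open (f @^-1` U).
Proof.
move=> Df oU; rewrite openE => p Up.
have [c Ac cp] := atlas_cover atl p.
have N := locally_open_preimage atl (Diff_smap atl Df) (open_locally_open oU) Ac cp Up.
have [B [oB Bp HB]] := cnbhs_open Ac cp N.
have nB : nbhs p B by exact: open_nbhs_nbhs.
by apply: filterS nB => q /HB [].
Qed.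

Lemma mul_unit_neq0 k (v : 'rV[R]_k) (J : 'M[R]_k) : J \in unitmx -> v != 0 ->
  v *m J != 0.
Proof.
move=> uJ; apply: contra => /eqP e.
by rewrite -[v](mulmxK uJ) e mul0mx.
Qed.

Lemma local_defining_function_pull f U rho : Diff A f ->
  local_defining_function A U rho ->
  local_defining_function A (f @^-1` U) (rho \o f).
Proof.
move=> Df [oU sr r0 rb gr]; have sf := Diff_smap atl Df.
have lU := open_locally_open oU.
split.
- exact: Diff_open_preimage.
- exact: (smooth_fun_comp atl (@compositionalR R) sf lU sr).
- by move=> p Up; exact: r0.
- by move=> p Up; rewrite -rb // Diff_boundary.
- move=> c p Ac cp Up bp; have [d Ad dp] := atlas_cover atl (f p).
  have [Nf csf] := sf c d p Ac Ad cp dp.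
  have csu : csmooth d (f p) (rho : T -> R^o).
    by apply: (smooth_funP atl _ lU).1 => //.
  rewrite (gradient_comp atl Ac Ad cp csf Nf csu).
  apply: mul_unit_neq0.
    by rewrite unitmx_tr; exact: (dmx_unit atl Df Ac Ad cp dp).
  by apply: gr => //; exact/Diff_boundary.
Qed.

Lemma gradient_coord0 c p : A c -> cdom c p ->
  gradient (coord c (fun q => c q 0 0 : R^o)) (c p) = delta_mx 0 0.
Proof.
move=> Ac cp; apply/matrixP => i0 i; rewrite (ord1 i0) {i0}.
rewrite (gradientE atl i Ac cp openT I (F := fun x => x 0 0 : R^o)) //; last first.
  exact: smooth_coord.
have /matrixP/(_ i 0) := dmx_id atl Ac cp.
rewrite /dmx (jacE atl Ac cp openT I (F := id)) //; last first.
  by apply: smooth_id; exact: openT.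
by rewrite !mxE => ->; rewrite eqxx eq_sym /=.
Qed.

(** All computations use this defining function. In another chart its gradient is changed by an
    invertible Jacobian, hence stays nonzero. *)
Lemma chart_defining_function c U : A c -> open U -> U `<=` cdom c ->
  local_defining_function A U (fun q => c q 0 0).
Proof.
move=> Ac oU Uc; have lU := open_locally_open oU; split=> //.
- apply/(smooth_funP atl _ lU) => d p Ad dp Up.
  apply: (csmooth_chart_change atl (@compositionalR R) Ad Ac dp (Uc _ Up)).
  exact: csmooth_coord.
- by move=> p /Uc; exact: coord0_ge0.
- by move=> p /Uc cp; exact: boundaryE.
- move=> d p Ad dp Up bp; have cp := Uc _ Up.
  have csu : csmooth c p (fun q => c q 0 0 : R^o) by exact: csmooth_coord.
  have [Nf csf] := smap_id atl Ad Ac dp cp.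
  rewrite (gradient_comp (f := id) atl Ad Ac dp csf Nf csu).
  apply: mul_unit_neq0.
    by rewrite unitmx_tr; exact: (dmx_unit atl (Diff_id atl) Ad Ac dp cp).
  rewrite gradient_coord0 //; apply/eqP => /matrixP/(_ 0 0).
  by rewrite !mxE eqxx /= => /eqP; rewrite oner_eq0.
Qed.

Lemma csmooth_scalar c p (u : T -> R^o) :
  csmooth c p u <-> csmooth c p (fun q => (u q)%:M : 'M[R]_1).
Proof.
rewrite csmooth_mxP; split=> [su i j|/(_ 0 0)].
  apply: csmooth_eq su; apply: filterE => q /=.
  by rewrite (ord1 i) (ord1 j) mxE eqxx mulr1n.
apply: csmooth_eq; apply: filterE => q /=.
by rewrite mxE eqxx mulr1n.
Qed.

Lemma csmooth_hadamard_scalar c p (u : T -> R^o) : A c -> cdom c p -> bd p ->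
  csmooth c p u -> cnbhs c p [set q | bd q -> u q = 0] ->
  exists2 u' : T -> R^o, csmooth c p u' &
    cnbhs c p [set q | u q = c q 0 0 * u' q].
Proof.
move=> Ac cp bp /csmooth_scalar su Nu.
have [|B sB EB] := csmooth_hadamard Ac cp bp su.
  by apply: filterS Nu => q /= uq bq; rewrite uq // raddf0.
exists (fun q => B q 0 0); first by have /csmooth_mxP := sB; exact.
apply: filterS EB => q /= /matrixP/(_ 0 0).
by rewrite !mxE eqxx mulr1n.
Qed.

(** Hadamard's lemma gives [phi], which is nonnegative by density of the interior. If [phi p] were
    0, the product rule would make the gradient of [rho] vanish at [p]. *)
Lemma defining_function_factor U rho c p : local_defining_function A U rho ->
  U p -> bd p -> A c -> cdom c p ->
  exists phi : T -> R^o, [/\ csmooth c p phi, 0 < phi p &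
    cnbhs c p [set q | rho q = c q 0 0 * phi q]].
Proof.
move=> [oU sr r0 rb gr] Up bp Ac cp; have lU := open_locally_open oU.
have NU : cnbhs c p U by exact: lU.
have cr : csmooth c p (rho : T -> R^o) by apply: (smooth_funP atl _ lU).1.
have [|phi sphi Ephi] := csmooth_hadamard_scalar Ac cp bp cr.
  by apply: filterS NU => q Uq bq; exact/rb.
exists phi; split=> //.
have c0 : c p 0 0 = 0 by exact/(boundaryE Ac cp).
have phi_ge0 : 0 <= phi p.
  have : cnbhs c p [set q | [set y : R^o | 0 <= y] (phi q)].
    apply: csmooth_closed sphi _ => //.
    apply: filterS2 (filterI NU Ephi) (cnbhs_dom c p) => q [Uq Eq] cq /= iq.
    have q0 := (interiorE Ac cq).1 iq.
    by have := r0 q Uq; rewrite Eq pmulr_rge0.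
  by move=> /(cnbhs_point cp).
rewrite lt_neqAle phi_ge0 andbT eq_sym; apply/eqP => phi0.
have /negP := gr c p Ac cp Up bp; apply; apply/eqP/matrixP => i0 i.
rewrite (ord1 i0) {i0} [RHS]mxE.
have [r [F [q0 sF EF]]] := csmooth_in sphi Ephi.
have oB : open (ball (c p) r) by exact: ball_open.
have Bp : ball (c p) r (c p) by exact: ballxx.
have sG : smooth (ball (c p) r) (fun x => x 0 0 * F x : R^o).
  by apply: smoothM => //; exact: smooth_coord.
rewrite (gradientE atl i Ac cp oB Bp sG); last first.
  by move=> q cq /(EF q cq) [<-].
have d1 : derivable (fun x : 'rV[R]_n.+1 => x 0 0 : R^o) (c p) (delta_mx 0 i).
  by apply: diff_derivable; exact: differentiable_coord.
have d2 : derivable F (c p) (delta_mx 0 i).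
  by apply: diff_derivable; exact: smooth_differentiable sF Bp.
have := deriveM d1 d2; rewrite /GRing.mul /= => ->.
have [<- _] := EF p cp Bp; rewrite c0 phi0.
by rewrite !scale0r addr0.
Qed.

End manifold.

(** * Conformally compact metrics *)

Section metrics.
Context {R : realType} {n : nat} {T : topologicalType}.
Context {A : set (chart R T n.+1)} (hM : manifold_with_boundary A).
Implicit Types (c d : chart R T n.+1) (U D P : set T) (rho : T -> R)
  (p q : T) (f : T -> T) (g h s t : tensor R T n.+1).

Local Notation atl := (manifold_atlas hM).
Local Notation bd := (boundary A).
Local Notation int := (interior_part A).

Lemma csmooth_det k c p (M : T -> 'M[R]_k) : csmooth c p M ->
  csmooth c p (fun q => \det (M q) : R^o).
Proof.
move=> /csmooth_mxP sM.
have big (I : Type) (r : seq I) (F : I -> T -> R^o) (op : R^o -> R^o -> R^o) (x0 : R^o) :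
    (forall u v : T -> R^o, csmooth c p u -> csmooth c p v ->
       csmooth c p (fun q => op (u q) (v q))) ->
    (forall i, csmooth c p (F i)) -> csmooth c p (fun q => \big[op/x0]_(i <- r) F i q).
  move=> Hop HF; elim: r => [|i r IH].
    by apply: csmooth_eq (csmooth_cst c p x0); apply: filterE => q /=; rewrite big_nil.
  apply: csmooth_eq (Hop _ _ (HF i) IH); apply: filterE => q /=.
  by rewrite big_cons.
apply: (big _ _ (fun (s : 'S_k) q => (-1) ^+ s * \prod_i M q i (s i)) +%R 0).
  by move=> u v; exact: csmoothD.
move=> s; apply: csmoothM; first exact: csmooth_cst.
apply: (big _ _ (fun i q => M q i (s i)) *%R 1).
  by move=> u v; exact: csmoothM.
by move=> i; exact: sM.
Qed.

Lemma csmooth_unit k c p (M : T -> 'M[R]_k) : cdom c p -> csmooth c p M ->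
  M p \in unitmx -> cnbhs c p [set q | M q \in unitmx].
Proof.
move=> cp /csmooth_det sd; rewrite unitmxE unitfE => d0.
have nd : nbhs (\det (M p) : R^o) [set y : R^o | y != 0].
  by apply: open_nbhs_nbhs; split; [exact: open_neq|].
apply: filterS (csmooth_continuous cp sd nd) => q /= dq.
by rewrite unitmxE unitfE.
Qed.

(** The defining function is carried along as [rho \o f], so no two defining functions have to be
    compared. *)
Lemma compactification_pull f U rho g t g' : Diff A f -> tensor_law A int g ->
  is_pullback A int f g g' -> compactification A g U rho t ->
  compactification A g' (f @^-1` U) (rho \o f) (pull atl f t).
Proof.
move=> Df lg pg [ldf tt eg ub]; have sf := Diff_smap atl Df.
have [oU _ _ _ _] := ldf; have lU := open_locally_open hM oU.
have [st lt] := (is_tensorP atl t lU).1 tt.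
have pt := pullP atl sf lt.
split.
- exact: (local_defining_function_pull hM).
- exact: (pullback_tensor atl sf lU tt pt).
- move=> c p Ac cp Up ip; have [d Ad dp] := atlas_cover atl (f p).
  rewrite (pt c d Ac Ad p Up cp dp) (pg c d Ac Ad p ip cp dp).
  rewrite (eg d (f p) Ad dp Up); last exact: Diff_interior.
  by rewrite -scalemxAr -scalemxAl.
- move=> c p Ac cp Up bp; have [d Ad dp] := atlas_cover atl (f p).
  have uJ := dmx_unit atl Df Ac Ad cp dp.
  rewrite (pt c d Ac Ad p Up cp dp) -/(dmx c d f p).
  rewrite !unitmx_mul unitmx_tr uJ andbT /=.
  by apply: ub => //; exact/Diff_boundary.
Qed.

Lemma conformally_compact_pull f g g' : Diff A f -> is_pullback A int f g g' ->
  conformally_compact A g -> conformally_compact A g'.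
Proof.
move=> Df pg [mg cg]; have [tg _ _] := mg.
have li := interior_locally_open hM.
have lg := ((is_tensorP atl g li).1 tg).2.
split.
  apply: (pullback_metric atl Df li _ mg pg) => p; exact: Diff_interior.
move=> p bp; have [|U [rho [t [Up ct]]]] := cg (f p); first exact/Diff_boundary.
by exists (f @^-1` U), (rho \o f), (pull atl f t); split; [|exact: compactification_pull ct].
Qed.

Lemma tensor_law_metric g : is_metric A int g -> tensor_law A int g.
Proof.
by move=> [tg _ _]; have li := interior_locally_open hM; case/(is_tensorP atl g li): tg.
Qed.

(** The squared length of [d rho] is invariant: the Jacobians in the gradient cancel those in the
    inverse of [J *m t *m J^T]. *)
Lemma ALH_pull f g g' : Diff A f -> is_pullback A int f g g' -> ALH A g -> ALH A g'.
Proof.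
move=> Df pg [cg ag]; split; first exact: conformally_compact_pull pg cg.
have lg : tensor_law A int g by case: cg => /tensor_law_metric.
move=> p bp; have [|U [rho [t [Up ct at1]]]] := ag (f p); first exact/Diff_boundary.
exists (f @^-1` U), (rho \o f), (pull atl f t); split => //.
  exact: compactification_pull ct.
have sf := Diff_smap atl Df.
have [ldf tt _ ub] := ct; have [oU sr _ _ _] := ldf.
have lU := open_locally_open hM oU.
have [st lt] := (is_tensorP atl t lU).1 tt.
move=> c q Ac cq Uq bq; have [d Ad dq] := atlas_cover atl (f q).
have [Nf csf] := sf c d q Ac Ad cq dq.
have csu : csmooth d (f q) (rho : T -> R^o) by apply: (smooth_funP atl _ lU).1.
rewrite (gradient_comp atl Ac Ad cq csf Nf csu).
rewrite (pullP atl sf lt Ac Ad Uq cq dq) -/(dmx c d f q).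
have uJ := dmx_unit atl Df Ac Ad cq dq.
have bfq : bd (f q) by exact/Diff_boundary.
have ut := ub d (f q) Ad dq Uq bfq.
have := at1 d (f q) Ad dq Uq bfq; rewrite /= => <-.
set J := dmx c d f q in uJ *; set a := gradient _ _.
have invM (X Y : 'M[R]_n.+1) : X \in unitmx -> Y \in unitmx ->
    invmx (X *m Y) = invmx Y *m invmx X.
  move=> uX uY; have uXY : X *m Y \in unitmx by rewrite unitmx_mul uX.
  have E : (X *m Y) *m (invmx Y *m invmx X) = 1%:M by rewrite mulmxA mulmxK // mulmxV.
  by rewrite -[RHS](mulKmx uXY) E mulmx1.
rewrite !invM ?unitmx_mul ?unitmx_tr ?uJ // !trmx_mul trmxK.
by rewrite !mulmxA mulmxK ?unitmx_tr // mulmxKV.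
Qed.

(** Chart form of [metric_sim] with coordinate 0 as defining function: [h] extends [x0^2 g] and
    [h - x0^k w] extends [x0^2 g']. Here [k] is the order for the compactified metrics, two more
    than the index of [metric_sim]. *)
Definition metric_sim_at k g g' c p := exists h w : T -> 'M[R]_n.+1,
  [/\ csmooth c p h, csmooth c p w, h p \in unitmx &
    cnbhs c p [set q | int q ->
      h q = c q 0 0 ^+ 2 *: g c q /\
      h q - c q 0 0 ^+ k *: w q = c q 0 0 ^+ 2 *: g' c q]].

Lemma metric_sim_at_trans k g g' g'' c p :
  metric_sim_at k g g' c p -> metric_sim_at k g' g'' c p -> metric_sim_at k g g'' c p.
Proof.
move=> [h [w [sh sw uh Nh]]] [h1 [w1 [sh1 sw1 uh1 Nh1]]].
exists h, (fun q => w q + w1 q); split => //; first exact: csmoothD.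
apply: filterS2 Nh Nh1 => q /= H H1 iq; have [E1 E2] := H iq; have [E3 E4] := H1 iq.
by split=> //; rewrite -E4 E3 -E2 scalerDr opprD addrA.
Qed.

Lemma metric_simW k g g' c p : metric_sim A k g g' -> bd p -> A c -> cdom c p ->
  metric_sim_at k.+2 g g' c p.
Proof.
move=> sim bp Ac cp; have [U [rho [s [t [Up cs ct [w tw Ew]]]]]] := sim p bp.
have [ldf ts es us] := cs; have [_ tt et _] := ct.
have [oU _ _ _ _] := ldf; have lU := open_locally_open hM oU.
have [phi [sphi phi0 Ephi]] := defining_function_factor hM ldf Up bp Ac cp.
have phip : phi p != 0 by rewrite gt_eqF.
have siphi := csmoothV cp phip sphi.
have siphi2 := csmoothX 2 siphi.
have [ss _] := (is_tensorP atl s lU).1 ts.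
have [sw _] := (is_tensorP atl w lU).1 tw.
(* As [rho = x0 phi], division by [phi^2] turns [rho^2 g] into [x0^2 g] and [rho^(k+2) w] into
   [x0^(k+2) phi^k w]. *)
exists (fun q => ((phi q)^-1 ^+ 2 : R) *: s c q), (fun q => (phi q ^+ k : R) *: w c q).
split.
- exact: (csmoothZ siphi2 (ss c p Ac cp Up)).
- exact: (csmoothZ (csmoothX k sphi) (sw c p Ac cp Up)).
- by rewrite unitmxZ ?us // unitfE expf_neq0 // invr_eq0.
have nphi : nbhs (phi p : R^o) [set y : R^o | y != 0].
  by apply: open_nbhs_nbhs; split; [exact: open_neq|].
have Nphi := csmooth_continuous cp sphi nphi.
apply: filterS2 (filterI Nphi Ephi) (filterI (lU c p Ac cp Up) (cnbhs_dom c p)).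
move=> q [/= phiq Eq] [Uq cq] iq.
rewrite (es c q Ac cq Uq iq) Eq scalerA -exprMn mulrCA mulVf // mulr1; split=> //.
have := Ew c q Ac cq Uq.
rewrite (es c q Ac cq Uq iq) (et c q Ac cq Uq iq) Eq => E.
have E2 : c q 0 0 ^+ 2 *: g' c q =
    c q 0 0 ^+ 2 *: g c q - ((phi q)^-1 ^+ 2) *: ((c q 0 0 * phi q) ^+ k.+2 *: w c q).
  rewrite -E scalerBr !scalerA -exprMn mulrCA mulVf // mulr1.
  by rewrite opprB addrCA subrr addr0.
rewrite E2 !scalerA; congr (_ - _ *: _).
rewrite exprMn mulrCA; congr (_ * _).
by rewrite -(addn2 k) exprD mulrCA -exprMn mulVf // expr1n mulr1.
Qed.

Definition chart_tensor c (h : T -> 'M[R]_n.+1) : tensor R T n.+1 :=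
  fun d q => dmx d c id q *m h q *m (dmx d c id q)^T.

Lemma chart_tensorP c (h : T -> 'M[R]_n.+1) U : open U -> A c ->
  (forall q, U q -> cdom c q /\ csmooth c q h) -> is_tensor A U (chart_tensor c h).
Proof.
move=> oU Ac Uc; apply/(is_tensorP atl _ (open_locally_open hM oU)); split.
  move=> d q Ad dq /Uc [cq sh].
  have sJ : csmooth d q (dmx d c id).
    by apply: (csmooth_jac atl Ad); exact: (csmooth_transition atl).
  have sh' := csmooth_chart_change atl (@compositional_mx R _ _) Ad Ac dq cq sh.
  exact: csmooth_mulmx (csmooth_mulmx sJ sh') (csmooth_trmx sJ).
move=> d e Ad Ae q /Uc [cq _] dq eq0; rewrite /chart_tensor.
rewrite (dmx_chart atl (smap_id atl) Ad Ae Ac dq eq0 cq).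
by rewrite !trmx_mul !mulmxA.
Qed.

Lemma chart_compactification g c (h : T -> 'M[R]_n.+1) U : tensor_law A int g -> A c -> open U ->
  (forall q, U q -> cdom c q /\ csmooth c q h) ->
  (forall q, U q -> h q \in unitmx) ->
  (forall q, U q -> int q -> h q = c q 0 0 ^+ 2 *: g c q) ->
  compactification A g U (fun q => c q 0 0) (chart_tensor c h).
Proof.
move=> lg Ac oU Uc Uu Ug; split.
- by apply: (chart_defining_function hM Ac oU) => q /Uc [].
- exact: chart_tensorP.
- move=> d q Ad dq Uq iq; have [cq _] := Uc q Uq.
  rewrite /chart_tensor Ug // (lg d c Ad Ac q iq dq cq).
  by rewrite -scalemxAr -scalemxAl.
- move=> d q Ad dq Uq bq; have [cq _] := Uc q Uq.
  have uJ := dmx_unit atl (Diff_id atl) Ad Ac dq cq.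
  by rewrite /chart_tensor !unitmx_mul unitmx_tr uJ Uu.
Qed.

Lemma metric_simI k g g' : tensor_law A int g -> tensor_law A int g' ->
  (forall p, bd p -> exists c, [/\ A c, cdom c p & metric_sim_at k.+2 g g' c p]) ->
  metric_sim A k g g'.
Proof.
move=> lg lg' H p bp; have [c [Ac cp [h [w [sh sw uh Nh]]]]] := H p bp.
have s0 k' : csmooth c p (fun q => c q 0 0 ^+ k' : R^o).
  by apply: csmoothX; exact: csmooth_coord.
pose h' q := h q - c q 0 0 ^+ k.+2 *: w q.
have sh' : csmooth c p h'.
  by apply: csmoothD => //; apply: csmoothN; exact: (csmoothZ (s0 _) sw).
have c0 : c p 0 0 = 0 by exact/(boundaryE hM Ac cp).
(* The exponent is positive, so [h'] and [h] coincide at [p]; nondegeneracy then spreads to a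
   neighbourhood. *)
have uh' : h' p \in unitmx by rewrite /h' c0 expr0n scale0r subr0.
have N1 : cnbhs c p [set q | (csmooth c q h /\ csmooth c q w) /\ csmooth c q h'].
  by apply: filterI; [apply: filterI|]; exact: csmooth_near.
have N2 : cnbhs c p [set q | h q \in unitmx /\ h' q \in unitmx].
  by apply: filterI; exact: csmooth_unit.
have [U [oU Up HU]] := cnbhs_open hM Ac cp (filterI (filterI N1 N2) Nh).
exists U, (fun q => c q 0 0), (chart_tensor c h), (chart_tensor c h'); split=> //.
- apply: chart_compactification => // q /HU [cq [[[[sq _] _] [uq _]] Eq]] //.
  by move=> /Eq [].
- apply: chart_compactification => // q /HU [cq [[[[_ _] sq] [_ uq]] Eq]] //.
  by move=> /Eq [].
- exists (chart_tensor c w).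
    by apply: chart_tensorP => // q /HU [cq [[[[_ sq] _] _] _]].
  move=> d q Ad dq Uq; rewrite /chart_tensor /h'.
  rewrite -mulmxBl -mulmxBr opprB addrCA subrr addr0.
  by rewrite -scalemxAr -scalemxAl.
Qed.

Lemma metric_sim_refl k g : conformally_compact A g -> metric_sim A k g g.
Proof.
move=> [mg cg] p bp; have [U [rho [t [Up ct]]]] := cg p bp.
exists U, rho, t, t; split=> //; exists (fun _ _ => 0).
  have [[oU _ _ _ _] _ _ _] := ct.
  apply/(is_tensorP atl _ (open_locally_open hM oU)); split.
    by move=> *; exact: csmooth_cst.
  by move=> *; rewrite mulmx0 mul0mx.
by move=> c q _ _ _; rewrite subrr scaler0.
Qed.

(** Agreement over the interior makes [g'] a pullback of [g] by the identity. *)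
Lemma ALH_ext g g' : ALH A g ->
  (forall c p, A c -> int p -> cdom c p -> g c p = g' c p) -> ALH A g'.
Proof.
move=> ag E; apply: (ALH_pull (Diff_id atl) _ ag) => c d Ac Ad p ip cp dp J.
have [[/tensor_law_metric lg _] _] := ag.
by rewrite -E //; exact: lg.
Qed.

Lemma metric_sim_ext k g g' g'' : metric_sim A k g g' ->
  (forall c p, A c -> int p -> cdom c p -> g' c p = g'' c p) -> metric_sim A k g g''.
Proof.
move=> sim E p bp; have [U [rho [s [t [Up cs ct st]]]]] := sim p bp.
exists U, rho, s, t; split=> //.
have [a b e u] := ct; split => // c q Ac cq Uq iq.
by rewrite -E //; exact: e.
Qed.

End metrics.
Arguments metric_sim_at {R n T} A k g g' c p.

(** * Diffeomorphisms fixing the boundary *)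

Section linear_algebra.
Context {R : realType} {n : nat}.
Local Notation e0 := (delta_mx 0 0 : 'cV[R]_n.+1).

Lemma e0_mulmx (v : 'rV[R]_n.+1) i j : (e0 *m v) i j = (i == 0)%:R * v 0 j.
Proof. by rewrite mxE big_ord1 mxE eqxx andbT. Qed.

(** Otherwise the two rows [i1] and [i2], available because [n] is at least 2, would both be
    supported in column 0. They would be linearly dependent, against invertibility. *)
Lemma exists_tangential_neq0 (h : 'M[R]_n.+1) : (2 <= n)%N -> h \in unitmx ->
  exists i j, [/\ i != 0, j != 0 & h i j != 0].
Proof.
move=> hn uh; apply: contrapT => H.
have h0 i j : i != 0 -> j != 0 -> h i j = 0.
  move=> i0 j0; apply/eqP; apply: contrapT => /negP hij.
  by apply: H; exists i, j.
pose i1 : 'I_n.+1 := inord 1; pose i2 : 'I_n.+1 := inord 2.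
have v1 : i1 = 1%N :> nat by rewrite inordK // ltnS ltnW.
have v2 : i2 = 2%N :> nat by rewrite inordK // ltnS.
have i10 : i1 != 0 by rewrite -val_eqE /= v1.
have i20 : i2 != 0 by rewrite -val_eqE /= v2.
have i12 : i1 != i2 by rewrite -val_eqE /= v1 v2.
have inj (v : 'rV[R]_n.+1) : v *m h = 0 -> v = 0.
  by move=> vh; rewrite -[v](mulmxK uh) vh mul0mx.
(* The combination of the two rows that cancels in column 0; its vanishing forces [h i1 0 = 0], and
   then row [i1] is zero. *)
pose v : 'rV[R]_n.+1 := h i2 0 *: delta_mx 0 i1 - h i1 0 *: delta_mx 0 i2.
have v0 : v = 0.
  apply: inj; rewrite mulmxBl -!scalemxAl -!rowE; apply/rowP => j.
  rewrite !mxE; have [->|j0] := eqVneq j 0; first by rewrite mulrC subrr.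
  by rewrite (h0 i1 j) // (h0 i2 j) // !mulr0 subrr.
have /rowP/(_ i2) := v0; rewrite !mxE !eqxx /= eq_sym (negbTE i12) mulr0 mulr1 sub0r.
move=> /eqP; rewrite oppr_eq0 => /eqP h10.
have /inj d0 : (delta_mx 0 i1 : 'rV[R]_n.+1) *m h = 0.
  rewrite -rowE; apply/rowP => j; rewrite !mxE.
  by have [->|j0] := eqVneq j 0; [exact: h10|exact: h0].
by have /rowP/(_ i1) := d0; rewrite !mxE !eqxx /= => /eqP; rewrite oner_eq0.
Qed.

(* The tangential block of the equation forces the normal component of [b] to
   vanish, and then its first row forces [b *m h] to vanish. *)
Lemma leading_term_eq0 (h : 'M[R]_n.+1) (b : 'rV[R]_n.+1) (k : nat) (dl : R) :
  (2 <= n)%N -> h \in unitmx -> h^T = h -> 0 <= 1 + dl * b 0 0 ->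
  (2 * b 0 0 + dl * b 0 0 ^+ 2) *: h =
    k.+1%:R *: (e0 *m b *m h + h *m (e0 *m b)^T) +
    dl *: (k.+1%:R ^+ 2 *: (e0 *m b *m h *m (e0 *m b)^T)) ->
  b = 0.
Proof.
move=> hn uh sh pos E; pose w := b *m h.
have E1 i j : (e0 *m b *m h) i j = (i == 0)%:R * w 0 j.
  by rewrite -mulmxA e0_mulmx.
have E2 i j : (h *m (e0 *m b)^T) i j = (j == 0)%:R * w 0 i.
  by rewrite -[h in LHS]sh -trmx_mul mxE E1.
have E3 i j : (e0 *m b *m h *m (e0 *m b)^T) i j =
    (i == 0)%:R * (j == 0)%:R * \sum_l w 0 l * b 0 l.
  rewrite mxE mulr_sumr; apply: eq_bigr => l _; rewrite E1 [_^T _ _]mxE e0_mulmx; ring.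
have Eij i j : (2 * b 0 0 + dl * b 0 0 ^+ 2) * h i j =
    k.+1%:R * ((i == 0)%:R * w 0 j + (j == 0)%:R * w 0 i) +
    dl * (k.+1%:R ^+ 2 * ((i == 0)%:R * (j == 0)%:R * \sum_l w 0 l * b 0 l)).
  have /matrixP/(_ i j) := E.
  by rewrite -E1 -E2 -E3 !mxE.
have [i [j [i0 j0 hij]]] := exists_tangential_neq0 hn uh.
have b0 : b 0 0 = 0.
  have := Eij i j; rewrite (negbTE i0) (negbTE j0) !mul0r addr0 !mulr0 addr0.
  move=> /eqP; rewrite mulf_eq0 (negbTE hij) orbF.
  (* By [pos] the second factor is at least 1, so [b 0 0] is the factor that vanishes. *)
  have -> : 2 * b 0 0 + dl * b 0 0 ^+ 2 = b 0 0 * (1 + (1 + dl * b 0 0)) by ring.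
  by rewrite mulf_eq0 => /orP[/eqP//|]; rewrite gt_eqF // ltr_wpDr.
have kn0 : k.+1%:R != 0 :> R by rewrite pnatr_eq0.
have wi l : l != 0 -> w 0 l = 0.
  move=> l0; have := Eij 0 l; rewrite b0 eqxx (negbTE l0).
  rewrite expr0n /= !mulr0 addr0 !mul0r !mulr0 !addr0 mul1r => /esym/eqP.
  by rewrite mulf_eq0 (negbTE kn0) => /eqP.
have S0 : \sum_l w 0 l * b 0 l = 0.
  by apply: big1 => l _; have [->|l0] := eqVneq l 0; rewrite ?b0 ?mulr0 // wi // mul0r.
have w0 : w 0 0 = 0.
  have := Eij 0 0; rewrite b0 S0 eqxx expr0n /= !mulr0 addr0 mul0r addr0 mul1r.
  move=> /esym/eqP; rewrite mulf_eq0 (negbTE kn0) /= -mulr2n mulrn_eq0 /=.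
  by move=> /eqP.
have : w = 0.
  apply/rowP => l; rewrite [RHS]mxE; have [->//|l0] := eqVneq l 0; exact: wi.
by rewrite /w => bh; rewrite -[b](mulmxK uh) bh mul0mx.
Qed.

End linear_algebra.

(** * Expansions of a diffeomorphism at the boundary *)

Section asymptotics.
Context {R : realType} {n : nat} {T : topologicalType}.
Context {A : set (chart R T n.+1)} (hM : manifold_with_boundary A).
Implicit Types (c d : chart R T n.+1) (U D P : set T) (rho : T -> R)
  (p q : T) (f Psi : T -> T) (g s t : tensor R T n.+1).

Local Notation atl := (manifold_atlas hM).
Local Notation bd := (boundary A).
Local Notation int := (interior_part A).
Local Notation e0 := (delta_mx 0 0 : 'cV[R]_n.+1).

Definition expansion K Psi c p (B : T -> 'rV[R]_n.+1) :=
  csmooth c p B /\ cnbhs c p [set q | c (Psi q) = c q + c q 0 0 ^+ K *: B q].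

(** [Psi p = p] is required separately: the expansion alone says nothing if [Psi p] is outside
    [cdom c], where the values of [c] are arbitrary. *)
Definition tangent K Psi := forall c p, A c -> cdom c p -> bd p ->
  Psi p = p /\ exists B, expansion K Psi c p B.

Lemma csmooth_coord0X c p k : csmooth c p (fun q => c q 0 0 ^+ k : R^o).
Proof. by apply: csmoothX; exact: csmooth_coord. Qed.

Lemma near_cdom_image Psi c p : smap A Psi -> A c -> cdom c p -> Psi p = p ->
  cnbhs c p [set q | cdom c (Psi q)].
Proof. by move=> sP Ac cp e; have [] := sP c c p Ac Ac cp; rewrite ?e. Qed.

(** Instance of [smooth_increment_mx] with displacement [x0^(K+1) B]. This vanishes on the boundary,
    so near [p] the segments from [x] to its image stay where [u] has a smooth extension. *)
Lemma expansion_increment K Psi c p B k l (u : T -> 'M[R]_(k, l)) :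
  smap A Psi -> A c -> cdom c p -> bd p -> Psi p = p ->
  expansion K.+1 Psi c p B -> csmooth c p u ->
  exists2 C : T -> 'M[R]_(k, l), csmooth c p C &
    cnbhs c p [set q | u (Psi q) = u q + c q 0 0 ^+ K.+1 *: C q].
Proof.
move=> sP Ac cp bp Pp [sB NB] [V [G [oV Vp sG EG]]].
have c0 : c p 0 0 = 0 by exact/(boundaryE hM Ac cp).
have [r [F [r0 sF EF]]] := csmooth_in sB (filterI NB (near_cdom_image sP Ac cp Pp)).
have [r1 r10 HV] := (nbhs_ballP _ _).1 (open_nbhs_nbhs (conj oV Vp)).
have oB : open (ball (c p) r) by exact: ball_open.
have Bp : ball (c p) r (c p) by exact: ballxx.
pose sK (x : 'rV[R]_n.+1) : R^o := x 0 0 ^+ K.+1.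
have ssK (U : set 'rV[R]_n.+1) : open U -> smooth U sK.
  by move=> oU; apply: smoothX => //; exact: smooth_coord.
pose W (x : 'rV[R]_n.+1) := (sK x : R) *: F x.
have cW : {for c p, continuous W}.
  by have sW := smoothZ oB (ssK _ oB) sF; exact: smooth_continuous sW Bp.
have r20 : 0 < r1 / 2 by rewrite divr_gt0.
have W0 : W (c p) = 0 by rewrite /W /sK c0 expr0n scale0r.
have NW : nbhs (c p) [set x | `|W x| < r1 / 2].
  have /cvgrPdist_lt/(_ _ r20) := cW; apply: filterS => x.
  by rewrite W0 sub0r normrN.
have NN : nbhs (c p) (ball (c p) r `&` ball (c p) (r1 / 2) `&` [set x | `|W x| < r1 / 2]).
  by apply: filterI => //; apply: filterI; exact: nbhsx_ballx.
have [r3 r30 H3] := (nbhs_ballP _ _).1 NN.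
have oU : open (ball (c p) r3) by exact: ball_open.
(* One half of [r1] bounds the distance of [x] to [c p], the other half the displacement. *)
have seg x (t : R) : ball (c p) r3 x -> 0 <= t <= 1 -> V (x + t *: ((sK x : R) *: F x)).
  move=> /H3 [[_ Bx] Wx] /andP[t0 t1]; apply: HV; rewrite -ball_normE /= in Bx *.
  rewrite opprD addrA (splitr r1); apply: le_lt_trans (ler_normB _ _) _.
  apply: ltrD => //; apply: le_lt_trans Wx.
  by rewrite normrZ ger0_norm // ler_piMl.
have sFU : smooth (ball (c p) r3) F by apply: smooth_subset sF => x /H3 [[]].
have [C sC EC] := smooth_increment_mx oU oV (smooth_id oU) sFU (ssK _ oU) sG seg.
have Up : ball (c p) r3 (c p) by exact: ballxx.
exists (C \o c); first by exists (ball (c p) r3), C.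
apply/cnbhsP; exists (ball (c p) r3); split=> // q cq Uq /=.
have [[Bq _] _] := H3 _ Uq; have [EFq [/= Eq dq]] := EF q cq Bq.
have S1 := seg _ 1 Uq; rewrite scale1r -EFq -Eq in S1.
have S0 := seg _ 0 Uq; rewrite scale0r addr0 in S0.
rewrite !EG //; last 2 first.
- by apply: S0; rewrite lexx ler01.
- by apply: S1; rewrite lexx ler01.
by rewrite Eq EFq -(EC _ Uq) [RHS]addrC subrK.
Qed.

(** Differentiating the factor [x0^(K+1)] contributes to row 0 only and costs one power of [x0];
    differentiating [B] costs none. Writing the order as [K.+1] avoids subtraction in exponents. *)
Lemma expansion_jacobian K Psi c p B : smap A Psi -> A c -> cdom c p -> Psi p = p ->
  expansion K.+1 Psi c p B ->
  exists2 DB : T -> 'M[R]_n.+1, csmooth c p DB &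
    cnbhs c p [set q | dmx c c Psi q =
      1%:M + c q 0 0 ^+ K *: (K.+1%:R *: (e0 *m B q) + c q 0 0 *: DB q)].
Proof.
move=> sP Ac cp Pp [sB NB]; have [r [F [r0 sF EF]]] := csmooth_in sB NB.
have oB : open (ball (c p) r) by exact: ball_open.
have Bp : ball (c p) r (c p) by exact: ballxx.
exists (Jmx F \o c).
  by exists (ball (c p) r), (Jmx F); split => //; exact: smooth_Jmx.
apply/cnbhsP; exists (ball (c p) r); split=> // q cq Bq.
pose G (x : 'rV[R]_n.+1) := x + (x 0 0 ^+ K.+1) *: F x.
have sG : smooth (ball (c p) r) G.
  apply: smoothD => //; first exact: smooth_id.
  apply: (smoothZ (F := fun x => x 0 0 ^+ K.+1 : R^o) oB _ sF).
  by apply: smoothX => //; exact: smooth_coord.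
rewrite /= /dmx (jacE atl Ac cq oB Bq sG); last first.
  by move=> q' cq' Bq'; have [E1 /= ->] := EF q' cq' Bq'; rewrite /G -E1.
have [-> _] := EF q cq Bq.
apply/matrixP => i j; rewrite [LHS]mxE.
have dx l : derivable (fun x : 'rV[R]_n.+1 => x 0 l : R^o) (c q) (delta_mx 0 i).
  by apply: diff_derivable; exact: differentiable_coord.
have dF : derivable (fun x => F x 0 j : R^o) (c q) (delta_mx 0 i).
  apply: diff_derivable.
  by move: sF => /(smooth_mxP _ oB)/(_ 0 j)/smooth_differentiable; exact.
pose x0 : 'rV[R]_n.+1 -> R := fun x => x 0 0.
pose xj : 'rV[R]_n.+1 -> R := fun y => y 0 j.
pose Fj : 'rV[R]_n.+1 -> R := fun y => F y 0 j.
have -> : (fun y => G y 0 j) = xj + x0 ^+ K.+1 * Fj.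
  by apply/funext => y; rewrite exprfctE /G /x0 !mxE.
have dX := @derivableX _ _ x0 K.+1 (c q) (delta_mx 0 i) (dx 0).
have D0 : 'D_(delta_mx 0 i) x0 (c q) = (i == 0)%:R by exact: derive_coord_delta.
have Dj : 'D_(delta_mx 0 i) xj (c q) = (i == j)%:R by exact: derive_coord_delta.
rewrite (deriveD (dx j) (derivableM dX dF)).
rewrite (deriveM dX dF) (deriveX _ (dx 0)) D0 Dj exprfctE /x0 [RHS]mxE.
rewrite ![in RHS]mxE big_ord1 !mxE eqxx andbT /GRing.scale /= exprS.
by rewrite /Fj; ring.
Qed.

(* [1 + x0^K B0] is the ratio of the pullback of [x0] to [x0]. *)
Lemma expansion_pullback K Psi c p B g g' (h : T -> 'M[R]_n.+1) :
  Diff A Psi -> is_pullback A int Psi g g' ->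
  A c -> cdom c p -> bd p -> Psi p = p -> expansion K.+1 Psi c p B ->
  csmooth c p h -> cnbhs c p [set q | int q -> h q = c q 0 0 ^+ 2 *: g c q] ->
  exists2 M : T -> 'M[R]_n.+1, csmooth c p M &
    cnbhs c p [set q |
      (int q -> (1 + c q 0 0 ^+ K * B q 0 0) ^+ 2 *: (c q 0 0 ^+ 2 *: g' c q) =
         h q + c q 0 0 ^+ K *: M q) /\
      (bd q -> M q = K.+1%:R *: (e0 *m B q *m h q + h q *m (e0 *m B q)^T) +
         c q 0 0 ^+ K *: (K.+1%:R ^+ 2 *: (e0 *m B q *m h q *m (e0 *m B q)^T)))].
Proof.
move=> DP pg Ac cp bp Pp EB sh Nh; have sP := Diff_smap atl DP.
have Nc := near_cdom_image sP Ac cp Pp.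
have [sB NB] := EB.
have [C sC NC] := expansion_increment sP Ac cp bp Pp EB sh.
have [DB sDB NDB] := expansion_jacobian sP Ac cp Pp EB.
pose K1 q := K.+1%:R *: (e0 *m B q) + c q 0 0 *: DB q.
pose X q := h q + c q 0 0 ^+ K.+1 *: C q.
have s0 k : csmooth c p (fun q => c q 0 0 ^+ k : R^o) by exact: csmooth_coord0X.
have s1 : csmooth c p (fun q => c q 0 0 : R^o) by exact: csmooth_coord.
have sK1 : csmooth c p K1.
  apply: csmoothD; last exact: (csmoothZ s1 sDB).
  apply: (csmoothZ (csmooth_cst c p (K.+1%:R : R^o))).
  exact: (csmooth_mulmx (csmooth_cst c p e0) sB).
have sX : csmooth c p X by apply: csmoothD => //; exact: (csmoothZ (s0 _) sC).
(* With [a = x0^K], [X = h + a x0 C] is [h] at the image point and [1 + a K1] is the Jacobian. This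
   is the difference of [(1 + a K1) X (1 + a K1)^T] and [h], divided by [a]. *)
exists (fun q => c q 0 0 *: C q + (K1 q *m X q + X q *m (K1 q)^T) +
    c q 0 0 ^+ K *: (K1 q *m X q *m (K1 q)^T)).
  apply: csmoothD; last first.
    by apply: (csmoothZ (s0 _)); exact: csmooth_mulmx (csmooth_mulmx sK1 sX) (csmooth_trmx sK1).
  apply: csmoothD; first exact: (csmoothZ s1 sC).
  by apply: csmoothD; [exact: csmooth_mulmx|exact: csmooth_mulmx (csmooth_trmx sK1)].
have NhP : cnbhs c p (Psi @^-1` [set q | cdom c q /\ (int q -> h q = c q 0 0 ^+ 2 *: g c q)]).
  have [Nf csf] := sP c c p Ac Ac cp (eq_ind_r (cdom c) cp Pp).
  apply: (cnbhs_map cp csf Nf); rewrite Pp.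
  by apply: filterI Nh; exact: cnbhs_dom.
have N1 : cnbhs c p [set q | (c (Psi q) = c q + c q 0 0 ^+ K.+1 *: B q /\
   h (Psi q) = X q) /\ dmx c c Psi q = 1%:M + c q 0 0 ^+ K *: K1 q].
  by apply: filterI NDB; exact: filterI NB NC.
apply: filterS2 (filterI N1 NhP) (cnbhs_dom c p) => q [[[Eq1 Eq2] Eq3] /= [cPq Eh]] cq.
split=> [iq|bq]; last first.
  have q0 : c q 0 0 = 0 by exact/(boundaryE hM Ac cq).
  rewrite /K1 /X q0 (expr0n _ K.+1) !scale0r !addr0 add0r.
  rewrite linearZ /= -!scalemxAl -!scalemxAr scalerDr; congr (_ + _).
  by congr (_ *: _); rewrite scalerA -expr2.
have iPq := Diff_interior hM DP iq.
have E4 := pg c c Ac Ac q iq cq cPq.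
rewrite -/(dmx c c Psi q) /= in E4.
have E5 : c (Psi q) 0 0 = c q 0 0 * (1 + c q 0 0 ^+ K * B q 0 0).
  by rewrite Eq1 !mxE exprS; ring.
rewrite scalerA -exprMn mulrC -E5 E4.
rewrite scalemxAl scalemxAr -(Eh iPq) Eq2 Eq3.
set a := c q 0 0 ^+ K; have Ea : c q 0 0 ^+ K.+1 = a * c q 0 0 by rewrite exprSr.
have -> : h q = X q - (a * c q 0 0) *: C q by rewrite /X Ea addrK.
have -> : (1%:M + a *: K1 q)^T = 1%:M + a *: (K1 q)^T.
  by rewrite linearD /= trmx1 linearZ.
rewrite mulmxDl mul1mx mulmxDr mulmx1 mulmxDl.
rewrite -!scalemxAl -!scalemxAr !scalerDr !scalerA.
set Y := K1 q *m X q; set Z := X q *m _; set S := Y *m _.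
by rewrite -!addrA; congr (_ + _); rewrite addKr.
Qed.

End asymptotics.
Arguments tangent {R n T} A K Psi.

Lemma closed_zero (R : realType) (W : normedModType R) : closed [set X : W | X = 0].
Proof. by apply: compact_closed; [exact: norm_hausdorff|exact: compact_set1]. Qed.

Section asymptotic_diffeomorphisms.
Context {R : realType} {n : nat} {T : topologicalType}.
Context {A : set (chart R T n.+1)} (hM : manifold_with_boundary A).
Implicit Types (c d : chart R T n.+1) (U D P : set T) (rho : T -> R)
  (p q : T) (f Psi : T -> T) (g s t : tensor R T n.+1).

Local Notation atl := (manifold_atlas hM).
Local Notation bd := (boundary A).
Local Notation int := (interior_part A).
Local Notation e0 := (delta_mx 0 0 : 'cV[R]_n.+1).

Lemma csmooth_unit_factor k c p (B : T -> 'rV[R]_n.+1) : csmooth c p B ->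
  csmooth c p (fun q => 1 + c q 0 0 ^+ k * B q 0 0 : R^o).
Proof.
move=> /csmooth_mxP sB; apply: (csmoothD (csmooth_cst c p (1 : R^o))).
by apply: csmoothM; [exact: csmooth_coord0X|exact: sB].
Qed.

(** Hadamard's lemma for [c \o Psi - c], which vanishes on the boundary. *)
Lemma tangent1 Psi : Diff A Psi -> (forall p, bd p -> Psi p = p) -> tangent A 1 Psi.
Proof.
move=> DP idb c p Ac cp bp; split; first exact: idb.
have sP := Diff_smap atl DP.
have Pcp : cdom c (Psi p) by rewrite idb.
have [_ csf] := sP c c p Ac Ac cp Pcp.
have sB : csmooth c p (fun q => c (Psi q) - c q).
  by apply: csmoothD => //; apply: csmoothN; exact: csmooth_chart.
have [|B sB' EB] := csmooth_hadamard hM Ac cp bp sB.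
  by apply: filterE => q /= bq; rewrite idb // subrr.
exists B; split=> //; apply: filterS EB => q /= E.
by rewrite expr1 -E addrC subrK.
Qed.

(** With [u] the ratio of [x0 \o Psi] to [x0], the product [u^2 x0^2 g'] equals [u^2 (h - x0^N w)]
    by similarity and [h + x0^K M] by pullback. Comparing the two at order [x0^K] on the boundary
    yields the equation of [leading_term_eq0] for [B]. *)
Lemma tangent_step N K Psi g g' : (2 <= n)%N -> (K < N)%N -> Diff A Psi ->
  is_metric A int g -> is_pullback A int Psi g g' ->
  (forall c p, A c -> cdom c p -> bd p -> metric_sim_at A N g g' c p) ->
  tangent A K.+1 Psi -> tangent A K.+2 Psi.
Proof.
move=> hn KN DP [_ gs _] pg sim tP c p Ac cp bp.
have [Pp [B EB]] := tP c p Ac cp bp; split=> //.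
have sP := Diff_smap atl DP.
have [h [w [sh sw uh Nh]]] := sim c p Ac cp bp.
have Nh1 : cnbhs c p [set q | int q -> h q = c q 0 0 ^+ 2 *: g c q].
  by apply: filterS Nh => q H iq; have [] := H iq.
have [M sM NM] := expansion_pullback hM DP pg Ac cp bp Pp EB sh Nh1.
have [sB NB] := EB.
have su := csmooth_unit_factor K sB.
pose u q : R := 1 + c q 0 0 ^+ K * B q 0 0.
(* After division by [x0^K] the error term in [w] keeps the positive power [x0^(m+1)], hence
   disappears on the boundary. *)
pose m := (N - K.+1)%N; have EN : N = (K + m.+1)%N by rewrite addnS -addSn subnKC.
pose cf q : R := 2 * B q 0 0 + c q 0 0 ^+ K * B q 0 0 ^+ 2.
have scf : csmooth c p (cf : T -> R^o).
  have /csmooth_mxP sBc := sB.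
  apply: csmoothD; first by apply: csmoothM; [exact: csmooth_cst|exact: sBc].
  by apply: csmoothM; [exact: csmooth_coord0X|apply: csmoothX; exact: sBc].
have Eu q : u q ^+ 2 = 1 + c q 0 0 ^+ K * cf q by rewrite /u /cf; ring.
(* The difference of the two expressions for [u^2 x0^2 g'], divided by [x0^K]. It is zero in the
   interior, hence everywhere near [p] by density. *)
pose Q q := cf q *: h q - (u q ^+ 2 * c q 0 0 ^+ m.+1) *: w q - M q.
have sQ : csmooth c p Q.
  apply: csmoothD; last exact: csmoothN.
  apply: csmoothD; first exact: (csmoothZ scf sh).
  apply: csmoothN.
  have sc : csmooth c p (fun q => u q ^+ 2 * c q 0 0 ^+ m.+1 : R^o).
    by apply: csmoothM; [exact: csmoothX|exact: csmooth_coord0X].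
  exact: (csmoothZ sc sw).
have NQ : cnbhs c p [set q | [set X : 'M[R]_n.+1 | X = 0] (Q q)].
  apply: (csmooth_closed hM Ac cp _ sQ); first exact: closed_zero.
  apply: filterS2 (filterI Nh NM) (cnbhs_dom c p) => q [H1 [H2 _]] cq /= iq.
  have [_ E1] := H1 iq; have E2 := H2 iq.
  have q0 : c q 0 0 != 0 by rewrite gt_eqF //; exact/(interiorE hM Ac cq).
  have a0 : c q 0 0 ^+ K != 0 by rewrite expf_neq0.
  apply: (scalerI a0); rewrite scaler0 /Q !scalerBr !scalerA.
  move: E2; rewrite -E1 -/(u q) Eu scalerBr scalerDl scale1r -[in X in _ - X]Eu scalerA => E2.
  rewrite mulrCA -exprD -EN; apply/eqP; rewrite subr_eq0; apply/eqP.
  by apply: (addrI (h q)); rewrite -E2 addrA -Eu.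
(* In the interior [x0 u] is the coordinate 0 of the image point, hence nonnegative, and [x0] is
   positive. The limit is the sign condition of [leading_term_eq0]. *)
have Nu : cnbhs c p [set q | [set y : R^o | 0 <= y] (u q : R^o)].
  apply: (csmooth_closed hM Ac cp _ su) => //.
  apply: filterS2 (filterI NB (near_cdom_image sP Ac cp Pp)) (cnbhs_dom c p).
  move=> q [/= Eq cPq] cq iq; have q0 := (interiorE hM Ac cq).1 iq.
  have := coord0_ge0 hM Ac cPq; rewrite Eq !mxE.
  have -> : c q 0 0 + c q 0 0 ^+ K.+1 * B q 0 0 = c q 0 0 * u q by rewrite /u exprS; ring.
  by rewrite pmulr_rge0.
have Ns : cnbhs c p [set q | [set X : 'M[R]_n.+1 | X = 0] ((h q)^T - h q)].
  apply: (csmooth_closed hM Ac cp); first exact: closed_zero.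
    by apply: csmoothD; [exact: csmooth_trmx|exact: csmoothN].
  apply: filterS2 Nh1 (cnbhs_dom c p) => q Eh cq /= iq.
  by rewrite Eh // linearZ /= gs // subrr.
have Nuh := csmooth_unit cp sh uh.
have NB0 : cnbhs c p [set q | bd q -> B q = 0].
  have NN : cnbhs c p [set q | [/\ Q q = 0, 0 <= u q, (h q)^T = h q & h q \in unitmx]].
    apply: filterS2 (filterI NQ Nu) (filterI Ns Nuh) => q [/= H1 H2] [/= H3 H4].
    by split=> //; apply/eqP; rewrite -subr_eq0; apply/eqP.
  apply: filterS2 (filterI NN NM) (cnbhs_dom c p) => q [[Q0 u0 hs hu] [_ HM]] cq /= bq.
  have q0 : c q 0 0 = 0 by exact/(boundaryE hM Ac cq).
  (* On the boundary [c q 0 0 ^+ K] is 1 for [K = 0] and 0 otherwise, so the quadratic terms are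
     present only at the first step. *)
  apply: (@leading_term_eq0 _ _ (h q) (B q) K (c q 0 0 ^+ K)) => //.
  rewrite -(HM bq) -/(cf q); apply/eqP; rewrite -subr_eq0; apply/eqP.
  by rewrite -[RHS]Q0 /Q q0 expr0n mulr0 scale0r subr0.
have [B' sB' EB'] := csmooth_hadamard hM Ac cp bp sB NB0.
exists B'; split=> //; apply: filterS2 NB EB' => q /= -> ->.
by rewrite scalerA -exprSr.
Qed.

(** The pullback identity is solved for [x0^2 g'] by dividing by [u^2], which is invertible near
    [p]: a positive [N] gives [u p = 1]. *)
Lemma metric_sim_at_pullback N Psi g g' c p : Diff A Psi -> conformally_compact A g ->
  is_pullback A int Psi g g' -> tangent A N.+1 Psi -> A c -> cdom c p -> bd p ->
  (0 < N)%N -> metric_sim_at A N g g' c p.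
Proof.
move=> DP cg pg tP Ac cp bp N0.
(* Similarity of [g] with itself serves only to extract the extension [h] of [x0^2 g] in the chart
   [c]. *)
have sim : metric_sim A 0 g g by exact: metric_sim_refl.
have [h [w0 [sh _ uh Nh]]] := metric_simW hM sim bp Ac cp.
have [Pp [B EB]] := tP c p Ac cp bp.
have Nh1 : cnbhs c p [set q | int q -> h q = c q 0 0 ^+ 2 *: g c q].
  by apply: filterS Nh => q H iq; have [] := H iq.
have [M sM NM] := expansion_pullback hM DP pg Ac cp bp Pp EB sh Nh1.
have [sB NB] := EB.
pose u q : R := 1 + c q 0 0 ^+ N * B q 0 0.
have su : csmooth c p (u : T -> R^o) by exact: csmooth_unit_factor.
have c0 : c p 0 0 = 0 by exact/(boundaryE hM Ac cp).
have up : u p != 0 by rewrite /u c0 expr0n gtn_eqF // mul0r addr0 oner_eq0.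
have nu : nbhs (u p : R^o) [set y : R^o | y != 0].
  by apply: open_nbhs_nbhs; split; [exact: open_neq|].
have Nu := csmooth_continuous cp su nu.
pose cf q : R := 2 * B q 0 0 + c q 0 0 ^+ N * B q 0 0 ^+ 2.
have scf : csmooth c p (cf : T -> R^o).
  have /csmooth_mxP sBc := sB.
  apply: csmoothD; first by apply: csmoothM; [exact: csmooth_cst|exact: sBc].
  by apply: csmoothM; [exact: csmooth_coord0X|apply: csmoothX; exact: sBc].
have Eu q : u q ^+ 2 = 1 + c q 0 0 ^+ N * cf q by rewrite /u /cf; ring.
have siu := csmoothX 2 (csmoothV cp up su).
(* This [w] comes from [u^2 = 1 + x0^N cf], since [u^2 h - (h + x0^N M) = x0^N (cf h - M)]. *)
exists h, (fun q => ((u q)^-1 ^+ 2) *: (cf q *: h q - M q)); split=> //.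
  apply: (csmoothZ siu); apply: csmoothD; last exact: csmoothN.
  exact: (csmoothZ scf sh).
apply: filterS2 (filterI Nh1 NM) Nu => q [H1 [H2 _]] /= uq iq; split; first exact: H1.
have := H2 iq; rewrite -/(u q) => E.
have u2 : u q ^+ 2 != 0 by rewrite expf_neq0.
apply: (scalerI u2); rewrite E scalerBr !scalerA exprVn -mulrA mulrCA mulfV // mulr1.
rewrite Eu scalerDl scale1r scalerBr -scalerA opprB -addrA; congr (_ + _).
by rewrite addrCA subrr addr0.
Qed.

Lemma tangent_Diff0 K Psi : Diff A Psi -> tangent A K.+1 Psi -> Diff0 A K.+1 Psi.
Proof.
move=> DP tP; split=> // f sf p bp; have sP := Diff_smap atl DP.
have lT : locally_open A setT by move=> *; exact: filterT.
have [c Ac cp] := atlas_cover atl p.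
have [Pp [B EB]] := tP c p Ac cp bp.
have cf : csmooth c p (f : T -> R^o) by apply: (smooth_funP atl _ lT).1.
have [C sC NC] := expansion_increment hM sP Ac cp bp Pp EB ((csmooth_scalar _ _ _).1 cf).
have sC0 : csmooth c p (fun q => C q 0 0 : R^o) by have /csmooth_mxP := sC.
have [U [oU Up HU]] := cnbhs_open hM Ac cp (filterI NC (csmooth_near sC0)).
exists U, (fun q => c q 0 0), (fun q => C q 0 0); split=> //.
- by apply: (chart_defining_function hM Ac oU) => q /HU [].
- apply/(smooth_funP atl _ (open_locally_open hM oU)) => d q Ad dq /HU [cq [_ sq]].
  exact: (csmooth_chart_change atl (@compositionalR R) Ad Ac dq cq sq).
- move=> q /HU [_ [/= /matrixP/(_ 0 0) + _]].
  by rewrite !mxE eqxx !mulr1n => ->; rewrite addrAC subrr add0r.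
Qed.

Lemma fun_sim_chart K (f1 f2 : T -> R) c p : fun_sim A K f1 f2 -> bd p -> A c ->
  cdom c p -> exists2 a : T -> R^o, csmooth c p a &
    cnbhs c p [set q | f1 q - f2 q = c q 0 0 ^+ K * a q].
Proof.
move=> sim bp Ac cp; have [U [rho [a [ldf Up sa Ea]]]] := sim p bp.
have [oU _ _ _ _] := ldf; have lU := open_locally_open hM oU.
have [phi [sphi phi0 Ephi]] := defining_function_factor hM ldf Up bp Ac cp.
exists (fun q => phi q ^+ K * a q).
  by apply: csmoothM; [exact: csmoothX|exact: (smooth_funP atl _ lU).1].
apply: filterS2 Ephi (lU c p Ac cp Up) => q /= Eq Uq.
by rewrite Ea // Eq exprMn mulrA.
Qed.

(** The set is closed in all of [T] and not just in the domain of the chart: it is the image of a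
    compact piece of the half-space under the continuous inverse [v], and [T] is Hausdorff. *)
Lemma chart_ball_closed c p (r : R) : A c -> cdom c p ->
  (forall x, ball (c p) r x -> 0 <= x 0 0 -> exists q, cdom c q /\ c q = x) ->
  forall e, e < r -> closed [set q | cdom c q /\ `|c q - c p| <= e].
Proof.
move=> Ac cp Hr e er.
have [hT _ _ ch _] := hM; have [_ ic _ Vc] := ch c Ac.
pose Z : set 'rV[R]_n.+1 := [set x | `|x - c p| <= e /\ 0 <= x 0 0].
have bZ x : Z x -> ball (c p) r x.
  by move=> [xe _]; rewrite -ball_normE /= distrC; exact: le_lt_trans er.
have Hg x : exists q, Z x -> cdom c q /\ c q = x.
  have [Zx|nZ] := pselect (Z x); last by exists p.
  by have [q Hq] := Hr x (bZ x Zx) Zx.2; exists q.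
have [v Hv] := choice Hg.
have -> : [set q | cdom c q /\ `|c q - c p| <= e] = v @` Z.
  apply/seteqP; split=> [q [cq qe]|_ [x Zx <-]]; last first.
    have [cv ev] := Hv x Zx; split=> //; rewrite ev; exact: Zx.1.
  have Zq : Z (c q) by split=> //; exact: coord0_ge0 hM _ _ Ac cq.
  exists (c q) => //; have [cv ev] := Hv _ Zq; exact: ic cv cq ev.
apply: compact_closed => //; apply: continuous_compact; last first.
  apply: bounded_closed_compact.
    exists (`|c p| + e); split; first exact: num_real.
    move=> x Mx y [ye _]; apply: le_trans (ltW Mx).
    rewrite -[y](subrK (c p)) addrC; apply: le_trans (ler_normD _ _) _.
    by rewrite lerD2l.
  apply: closedI.
    have cn : continuous (fun x : 'rV[R]_n.+1 => `|x - c p| : R^o).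
      move=> x.
      have c1 : {for x, continuous (fun y : 'rV[R]_n.+1 => y - c p)}.
        exact: (continuousB (@cvg_id _ (nbhs x)) (@cst_continuous _ _ (c p) _)).
      exact: (continuous_comp c1 (@norm_continuous _ _ _)).
    by have /continuous_closedP/(_ _ (@closed_le R e)) := cn.
  have cn : continuous (fun x : 'rV[R]_n.+1 => x 0 0 : R^o) by exact: coord_continuous.
  by have /continuous_closedP/(_ _ (@closed_ge R 0)) := cn.
apply/subspace_continuousP => x Zx; have [cv ev] := Hv x Zx.
move=> W; rewrite /= nbhsE => -[U [oU Uv] UW].
have [V oV EV] := Vc U oU.
have Vx : (V `&` @halfspace R n) x by rewrite -EV -[x]ev; exists (v x).
have nV : nbhs x V by apply: open_nbhs_nbhs; split=> //; case: Vx.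
rewrite /within /=; apply: filterS nV => y Vy Zy; apply: UW.
have : (V `&` @halfspace R n) y by split=> //; exact: Zy.2.
rewrite -EV => -[q [cq Uq] eq]; have [cvy evy] := Hv y Zy.
by change (U (v y)); rewrite (ic _ _ cvy cq) // evy.
Qed.

(** [chi] is a bump read in the chart and extended by 0. Multiplication by it makes a function
    smooth in the chart only into a global smooth one, which can be tested in [Diff0]. *)
Lemma cutoff c p (U : set T) : A c -> cdom c p -> nbhs p U ->
  exists chi : T -> R, [/\ chi p != 0, forall q, chi q != 0 -> U q &
    forall u : T -> R^o, (forall q, cdom c q -> csmooth c q u) ->
      smooth_fun A setT (fun q => chi q * u q : R^o)].
Proof.
move=> Ac cp nU.
have N := nbhs_cnbhs hM Ac cp nU; have [V [oV Vp VU]] := (cnbhsP _ _ _).1 N.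
have nV : nbhs (c p) V by exact: open_nbhs_nbhs.
have [r r0 Hr] := (nbhs_ballP _ _).1 (filterI nV (near_chart_image hM Ac cp)).
have er0 : 0 < r / 2 by rewrite divr_gt0.
have er : r / 2 < r by rewrite ltr_pdivrMr // mulr_natr mulr2n ltrDl.
have cZ := chart_ball_closed Ac cp (fun x Bx => (Hr x Bx).2) er.
have [chi0 schi [chip chi_out]] := bump (c p) er0.
pose chi q : R := if pselect (cdom c q) then chi0 (c q) else 0.
have chiE q : cdom c q -> chi q = chi0 (c q) by rewrite /chi; case: pselect.
have lT : locally_open A setT by move=> *; exact: filterT.
exists chi; split; first by rewrite chiE.
  move=> q; rewrite /chi; case: (pselect (cdom c q)) => [cq|ncq]; last by rewrite eqxx.
  move=> cn0; apply: VU => //.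
  suff : ball (c p) r (c q) by move=> /Hr [].
  rewrite -ball_normE /= distrC; apply: lt_trans er.
  by rewrite ltNge; apply: contra cn0 => /chi_out ->.
move=> u su; apply/(smooth_funP atl _ lT) => d q Ad dq _.
have [cq|ncq] := pselect (cdom c q).
  apply: (csmooth_chart_change atl (@compositionalR R) Ad Ac dq cq).
  apply: csmoothM; last exact: su.
  exists setT, chi0; split=> //; first exact: openT.
  by move=> q' cq' _; exact: chiE.
(* A point outside the chart has a neighbourhood disjoint from the closed chart ball, and [chi]
   vanishes there. *)
have nZ : nbhs q (~` [set q | cdom c q /\ `|c q - c p| <= r / 2]).
  by apply: open_nbhs_nbhs; split; [exact: closed_openC|move=> []].
apply: csmooth_eq (csmooth_cst d q (0 : R^o)).
apply: filterS (nbhs_cnbhs hM Ad dq nZ) => q' /= nq'.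
rewrite /chi; case: (pselect (cdom c q')) => [cq'|ncq']; last by rewrite mul0r.
rewrite chi_out ?mul0r //; apply: ltW; rewrite ltNge; apply/negP => H.
by apply: nq'.
Qed.

(* The coordinates of [Psi] are recovered from the global functions [chi] and
   [chi * c_i], where the cutoff [chi] does not vanish at [p]. *)
Lemma Diff0_tangent K Psi : Diff0 A K.+1 Psi -> tangent A K.+1 Psi.
Proof.
move=> [DP sim] c p Ac cp bp; have sP := Diff_smap atl DP.
have [hT _ _ _ _] := hM.
have c0 : c p 0 0 = 0 by exact/(boundaryE hM Ac cp).
have one c' q : csmooth c' q (cst 1 : T -> R^o) by exact: csmooth_cst.
have Pp : Psi p = p.
  (* If [Psi] moved [p], a cutoff vanishing at [Psi p] but not at [p] would contradict the estimate
     at [p], where [x0^(K+1)] is 0. *)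
  apply: contrapT => nP.
  have nU : nbhs p (~` [set Psi p]).
    apply: open_nbhs_nbhs; split; last by move=> /esym.
    by apply: closed_openC; apply: compact_closed => //; exact: compact_set1.
  have [chi [chip chiU schi]] := cutoff Ac cp nU.
  have [a _ Na] := fun_sim_chart (sim _ (schi _ (fun q _ => one c q))) bp Ac cp.
  have /= := cnbhs_point cp Na; rewrite c0 expr0n mul0r !mulr1.
  have -> : chi (Psi p) = 0.
    by apply/eqP; apply: contrapT => /negP /chiU /(_ erefl).
  by rewrite sub0r => /eqP; rewrite oppr_eq0 (negbTE chip).
split=> //; have [chi [chip _ schi]] := cutoff Ac cp (@filterT _ (nbhs p) _).
have [a0 sa0 Na0] := fun_sim_chart (sim _ (schi _ (fun q _ => one c q))) bp Ac cp.
have Hi i := fun_sim_chart (sim _ (schi _ (fun q _ => csmooth_coord c q i))) bp Ac cp.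
have [a Ha] := choice (fun i => let: ex_intro2 a s N := Hi i in
  ex_intro (fun a : T -> R^o => csmooth c p a /\ _) a (conj s N)).
have lT : locally_open A setT by move=> *; exact: filterT.
have schi1 : csmooth c p (chi : T -> R^o).
  have /(smooth_funP atl _ lT)/(_ c p Ac cp I) := schi _ (fun q _ => one c q).
  by apply: csmooth_eq; apply: filterE => q /=; rewrite mulr1.
have Pcp : cdom c (Psi p) by rewrite Pp.
have schiP : csmooth c p ((chi : T -> R^o) \o Psi).
  have sP2 : csmooth c (Psi p) (chi : T -> R^o) by rewrite Pp.
  exact: (smap_csmooth (@compositionalR R) sP Ac Ac cp Pcp sP2).
have chiPp : (chi \o Psi) p != 0 by rewrite /= Pp.
(* Subtracting [c_i] times the estimate for [chi] from that for [chi c_i] gives [chi(Psi) (c_i(Psi)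
   - c_i) = x0^(K+1) (a_i - a0 c_i)]. *)
exists (fun q => \row_i ((chi (Psi q))^-1 * (a i q + (-1) * (a0 q * c q 0 i)))).
split.
  apply/csmooth_mxP => i0 i; have [sa _] := Ha i.
  apply: (csmooth_eq (f := fun q => (chi (Psi q))^-1 * (a i q + (-1) * (a0 q * c q 0 i)))).
    by apply: filterE => q; rewrite /= mxE.
  apply: csmoothM; first exact: csmoothV.
  apply: csmoothD => //; apply: csmoothM; first exact: csmooth_cst.
  by apply: csmoothM => //; exact: csmooth_coord.
have nch : nbhs ((chi \o Psi) p : R^o) [set y : R^o | y != 0].
  by apply: open_nbhs_nbhs; split; [exact: open_neq|].
have Nch := csmooth_continuous cp schiP nch.
have NH : cnbhs c p [set q | forall i, chi (Psi q) * c (Psi q) 0 i - chi q * c q 0 i =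
    c q 0 0 ^+ K.+1 * a i q].
  have NHi i : cnbhs c p [set q | chi (Psi q) * c (Psi q) 0 i - chi q * c q 0 i =
    c q 0 0 ^+ K.+1 * a i q] by have [] := Ha i.
  exact: (filter_forall _ NHi).
apply: filterS2 (filterI Na0 NH) Nch => q [/= E0 Ei] /= nq.
apply/rowP => i; rewrite !mxE; rewrite !mulr1 in E0.
apply: (mulfI nq); rewrite mulrDr mulrCA (mulrA (chi (Psi q)) _^-1) mulfV // mul1r.
rewrite mulrDr -Ei mulN1r mulrN mulrA -E0; ring.
Qed.

End asymptotic_diffeomorphisms.

(** * The boundary as a manifold *)

Section face.
Context {R : realType} {n : nat}.

(** Right inverse of dropping coordinate 0, with values in the hyperplane where it vanishes.
    Composing with it restricts an extension on [R^(n+1)] to the boundary. *)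
Definition face (y : 'rV[R]_n) : 'rV[R]_n.+1 :=
  \row_i (if unlift 0 i is Some j then y 0 j else 0).

Lemma face0 y : face y 0 0 = 0.
Proof. by rewrite mxE unlift_none. Qed.

Lemma face_lift y j : face y 0 (lift 0 j) = y 0 j.
Proof. by rewrite mxE liftK. Qed.

Lemma col'_face y : col' 0 (face y) = y.
Proof. by apply/rowP => j; rewrite mxE face_lift. Qed.

Lemma face_col' (x : 'rV[R]_n.+1) : x 0 0 = 0 -> face (col' 0 x) = x.
Proof.
move=> x0; apply/rowP => i; rewrite mxE.
by case: unliftP => [j ->|->]; rewrite ?mxE.
Qed.

Lemma smooth_face (U : set 'rV[R]_n) : open U -> smooth U face.
Proof.
move=> oU; apply/smooth_mxP => // i0 i; rewrite (ord1 i0) {i0}.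
case: (unliftP 0 i) => [j ->|->].
  have -> : (fun x => face x 0 (lift 0 j) : R^o) = (fun x : 'rV[R]_n => x 0 j : R^o).
    by apply/funext => x; rewrite face_lift.
  exact: smooth_coord.
have -> : (fun x => face x 0 0 : R^o) = cst (0 : R^o).
  by apply/funext => x; rewrite face0.
exact: smooth_cst.
Qed.

Lemma continuous_face y : {for y, continuous face}.
Proof. exact: smooth_continuous (smooth_face openT) I. Qed.

Lemma derive_face (F : 'rV[R]_n.+1 -> R^o) y j : differentiable F (face y) ->
  'D_(delta_mx 0 j) (F \o face) y = 'D_(delta_mx 0 (lift 0 j)) F (face y).
Proof.
move=> dF; have df : differentiable face y.
  exact: smooth_differentiable (smooth_face openT) I.
rewrite derive_compE // (bigD1 (lift 0 j)) //= big1 ?addr0.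
  have -> : (fun y => face y 0 (lift 0 j) : R^o) = (fun x : 'rV[R]_n => x 0 j : R^o).
    by apply/funext => x; rewrite face_lift.
  by rewrite derive_coord_delta eqxx scale1r.
move=> i; case: (unliftP 0 i) => [l ->|-> _].
  rewrite (inj_eq lift_inj) => lj.
  have -> : (fun y => face y 0 (lift 0 l) : R^o) = (fun x : 'rV[R]_n => x 0 l : R^o).
    by apply/funext => x; rewrite face_lift.
  by rewrite derive_coord_delta eq_sym (negbTE lj) scale0r.
have -> : (fun y => face y 0 0 : R^o) = cst (0 : R^o).
  by apply/funext => x; rewrite face0.
by rewrite derive_cst scale0r.
Qed.

(** The rows of [J] other than row 0 have no entry in column 0, so every term with a normal index
    drops out of the double sum. *)
Lemma tangential_congruence (J t : 'M[R]_n.+1) :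
  (forall i, J (lift 0 i) 0 = 0) ->
  row' 0 (col' 0 (J *m t *m J^T)) =
  row' 0 (col' 0 J) *m row' 0 (col' 0 t) *m (row' 0 (col' 0 J))^T.
Proof.
move=> J0; apply/matrixP => i j; rewrite !mxE big_ord_recl !mxE J0 mulr0 add0r.
apply: eq_bigr => l _; rewrite !mxE big_ord_recl J0 mul0r add0r; congr (_ * _).
by apply: eq_bigr => k _; rewrite !mxE.
Qed.

End face.

Section boundary_manifold.
Context {R : realType} {n : nat} {T : topologicalType}.
Context {A : set (chart R T n.+1)} (hM : manifold_with_boundary A).
Implicit Types (c d : chart R T n.+1) (p q : bdT A) (Psi : T -> T)
  (psi : bdT A -> bdT A).

Local Notation atl := (manifold_atlas hM).
Local Notation bd := (boundary A).

Lemma bd_val p : bd (val p).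
Proof. exact: set_mem (valP p). Qed.

Lemma bd_sub x : bd x -> exists p : bdT A, val p = x.
Proof. by move=> bx; exists (SigSub (mem_set bx)). Qed.

Lemma face_bchart c p : A c -> cdom c (val p) -> face (bchart A c p) = c (val p).
Proof.
by move=> Ac cp; apply: face_col'; exact: (boundaryE hM Ac cp).1 (bd_val p).
Qed.

Lemma bchart_csmooth (W : normedModType R) c p (u : T -> W) :
  compositional W -> A c -> cdom c (val p) -> csmooth c (val p) u ->
  csmooth (bchart A c) p (u \o val).
Proof.
move=> cW Ac cp [V [F [oV Vp sF EF]]].
have oU : open (setT `&` @face R n @^-1` V).
  by apply: open_preimage_on; [exact: openT|done|move=> x _; exact: continuous_face].
exists (setT `&` @face R n @^-1` V), (F \o face); split => //.
- by split => //; rewrite /= face_bchart.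
- by apply: (cW _ _ _ V) => //; [move=> x []|exact: smooth_face].
- move=> q /= cq [_]; rewrite /= face_bchart // => Vq; exact: EF.
Qed.

Lemma bchart_cnbhs c p (P : set T) : A c -> cdom c (val p) -> cnbhs c (val p) P ->
  cnbhs (bchart A c) p (val @^-1` P).
Proof.
move=> Ac cp /cnbhsP [V [oV Vp VP]]; apply/cnbhsP.
have oU : open (setT `&` @face R n @^-1` V).
  by apply: open_preimage_on; [exact: openT|done|move=> x _; exact: continuous_face].
exists (setT `&` @face R n @^-1` V); split=> //.
  by split => //; rewrite /= face_bchart.
by move=> q /= cq [_]; rewrite /= face_bchart // => Vq; exact: VP.
Qed.

Lemma restriction_csmooth Psi psi c d p : is_restriction A Psi psi ->
  A c -> cdom c (val p) -> csmooth c (val p) (d \o Psi) ->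
  csmooth (bchart A c) p (bchart A d \o psi).
Proof.
move=> rP Ac cp sf.
have /csmooth_mxP sb := bchart_csmooth (@compositional_mx R _ _) Ac cp sf.
apply/csmooth_mxP => i j; rewrite (ord1 i).
apply: csmooth_eq (sb 0 (lift 0 j)); apply: filterE => q.
by rewrite /= mxE rP.
Qed.

Lemma boundary_atlas : is_atlas setT (@batlas R n T A).
Proof.
split=> //.
- move=> _ [c Ac <-] p q /= cp cq e; apply: val_inj.
  apply: (atlas_inj atl Ac cp cq).
  by rewrite -(face_bchart Ac cp) -(face_bchart Ac cq); congr face.
- move=> p; have [c Ac cp] := atlas_cover atl (val p).
  by exists (bchart A c) => //; exists c.
- move=> _ _ p [c Ac <-] [d Ad <-] /= cp dp.
  have N := atlas_open atl Ac Ad cp dp.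
  have N' : nbhs (face (bchart A c p)) [set x | @halfspace R n x ->
      exists q : T, [/\ cdom c q, cdom d q & c q = x]] by rewrite face_bchart.
  have N2 : \forall y \near bchart A c p, @halfspace R n (face y) ->
      exists q : T, [/\ cdom c q, cdom d q & c q = face y].
    exact: (@continuous_face R n (bchart A c p) _ N').
  apply: filterS N2 => y Hy _.
  have [|x [cx dx ex]] := Hy; first by rewrite /halfspace /= face0.
  have bx : bd x by apply/(boundaryE hM Ac cx); rewrite ex face0.
  have [q eq] := bd_sub bx; exists q; split; rewrite /= ?eq //.
  by rewrite ex col'_face.
- move=> _ _ [c Ac <-] [d Ad <-]; apply: csmooth_smooth_on.
    move=> p q /= cp cq e; apply: val_inj; apply: (atlas_inj atl Ac cp cq).
    by rewrite -(face_bchart Ac cp) -(face_bchart Ac cq); congr face.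
  move=> p /= cp dp.
  apply: (restriction_csmooth (Psi := id) (psi := id)) => //.
  exact: csmooth_transition atl _ _ _ Ac Ad cp dp.
Qed.

Local Notation batl := boundary_atlas.

Lemma restriction_smap Psi psi : is_restriction A Psi psi -> smap A Psi ->
  smap (@batlas R n T A) psi.
Proof.
move=> rP sP _ _ p [c Ac <-] [d Ad <-] /= cp dp.
rewrite rP in dp; have [Nf csf] := sP c d (val p) Ac Ad cp dp.
split; last exact: restriction_csmooth csf.
by apply: filterS (bchart_cnbhs Ac cp Nf) => q /=; rewrite rP.
Qed.

(** Derivatives of [F] along the face are derivatives of its restriction. The second clause holds
    because [Psi] preserves the boundary: coordinate 0 of the image is constantly 0 along the
    face. *)
Lemma dmx_restriction Psi psi c d p : is_restriction A Psi psi -> smap A Psi ->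
  A c -> A d -> cdom c (val p) -> cdom d (Psi (val p)) ->
  dmx (bchart A c) (bchart A d) psi p = row' 0 (col' 0 (dmx c d Psi (val p))) /\
  forall i, dmx c d Psi (val p) (lift 0 i) 0 = 0.
Proof.
move=> rP sP Ac Ad cp dp; have [Nf csf] := sP c d (val p) Ac Ad cp dp.
have Bc : batlas (bchart A c) by exists c.
have [r [F [r0 sF EF]]] := csmooth_in csf Nf.
have oB : open (ball (c (val p)) r) by exact: ball_open.
have Bp : ball (c (val p)) r (c (val p)) by exact: ballxx.
set U := ball _ _ in sF EF oB Bp.
pose y := bchart A c p; have fy : face y = c (val p) by exact: face_bchart.
have oV : open (setT `&` @face R n @^-1` U).
  by apply: open_preimage_on; [exact: openT|done|move=> x _; exact: continuous_face].
have Vy : (setT `&` @face R n @^-1` U) y by split=> //; rewrite /= fy.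
have sFf : smooth (setT `&` @face R n @^-1` U) (F \o face).
  by apply: (compositional_mx oV oB) => //; [move=> x []|exact: smooth_face].
pose Fb (x : 'rV[R]_n) : 'rV[R]_n := col' 0 (F (face x)).
have sFb : smooth (setT `&` @face R n @^-1` U) Fb.
  apply/smooth_mxP => // i j; rewrite (ord1 i).
  have -> : (fun x => Fb x 0 j : R^o) = (fun x => (F \o face) x 0 (lift 0 j) : R^o).
    by apply/funext => x; rewrite mxE.
  by move: sFf => /(smooth_mxP _ oV); exact.
have dF j : differentiable (fun x => F x 0 j : R^o) (face y).
  rewrite fy; move: sF => /(smooth_mxP _ oB)/(_ 0 j)/smooth_differentiable; exact.
have EJ : dmx c d Psi (val p) = Jmx F (face y).
  rewrite fy /dmx (jacE atl Ac cp oB Bp sF) // => q cq Uq.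
  by have [] := EF q cq Uq.
rewrite EJ; split.
  rewrite /dmx (jacE batl Bc cp oV Vy sFb).
    apply/matrixP => i j; rewrite [LHS]mxE [RHS]mxE [RHS]mxE [RHS]mxE.
    rewrite -(derive_face i (dF (lift 0 j))).
    have -> : (fun x => Fb x 0 j : R^o) = (fun x => F x 0 (lift 0 j) : R^o) \o face.
      by apply/funext => x; rewrite mxE.
    by [].
  move=> q /= cq [_]; rewrite /= /Fb face_bchart // => Uq.
  by rewrite rP; have [<- _] := EF (val q) cq Uq.
move=> i; rewrite mxE -(derive_face i (dF 0)).
suff N : \forall x \near y, ((fun x => F x 0 0 : R^o) \o face) x = cst (0 : R^o) x.
  by rewrite (near_eq_derive _ N) derive_cst.
have nU : nbhs (face y) (U `&` [set x : 'rV[R]_n.+1 | 0 <= x 0 0 -> exists q : T, cdom c q /\ c q = x]).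
  rewrite fy; apply: filterI; first exact: open_nbhs_nbhs.
  exact: (near_chart_image hM Ac cp).
have N2 : \forall x \near y, U (face x) /\
    (0 <= face x 0 0 -> exists q : T, cdom c q /\ c q = face x).
  exact: (@continuous_face R n y _ nU).
apply: filterS N2 => x [Ux [|q [cq eq]]]; first by rewrite face0.
rewrite /= -eq in Ux *; have [<- dq] := EF q cq Ux.
apply/(boundaryE hM Ad dq).
have bq : bd q by apply/(boundaryE hM Ac cq); rewrite eq face0.
by have [q' <-] := bd_sub bq; rewrite -rP; exact: bd_val.
Qed.

End boundary_manifold.

(** * The groups *)

(** Pulling [C] back by [f' \o f = id] means pulling back by [f'] and then by [f]. So the inclusion
    for [f'] gives the reverse inclusion for [f]. *)
Lemma pullback_class_eq (R : realType) (T' : Type) k (H : set 'rV[R]_k) (A' : set (chart R T' k))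
    (al : is_atlas H A') (D : set T') (C : set (tensor R T' k)) (f f' : T' -> T') :
  (forall t, C t -> tensor_law A' D t) ->
  (forall t t', C t ->
     (forall c p, A' c -> D p -> cdom c p -> t c p = t' c p) -> C t') ->
  (forall f p, Diff A' f -> D p -> D (f p)) ->
  Diff A' f -> Diff A' f' -> cancel f f' ->
  pullback_class A' D f C `<=` C -> pullback_class A' D f' C `<=` C ->
  pullback_class A' D f C = C.
Proof.
move=> Cl Ce DD Df Df' ff' fC f'C; apply/seteqP; split=> // t Ct.
have : pullback_class A' D id C t by rewrite (pullback_class_id al Cl Ce).
rewrite (_ : id = f' \o f); last exact/esym/funext.
rewrite (pullback_class_comp al Cl DD Df' Df) => -[h Hh ph].
by exists h => //; exact: f'C.
Qed.

Section diffeomorphism_groups.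
Context {R : realType} {n : nat} {T : topologicalType}.
Context {A : set (chart R T n.+1)} (hM : manifold_with_boundary A).
Implicit Types (Psi Phi f s : T -> T) (g h : tensor R T n.+1).

Local Notation atl := (manifold_atlas hM).
Local Notation batl := (boundary_atlas hM).
Local Notation bA := (@batlas R n T A).
Local Notation bd := (boundary A).
Local Notation int := (interior_part A).

Lemma locally_openT (T' : Type) k (A' : set (chart R T' k)) : locally_open A' setT.
Proof. by move=> c p _ _ _; exact: filterT. Qed.

Lemma smooth_fun_compT (u : T -> R^o) f : smap A f -> smooth_fun A setT u ->
  smooth_fun A setT (u \o f).
Proof.
move=> sf su.
exact: (smooth_fun_comp atl (@compositionalR R) sf (locally_openT (A' := A)) su).
Qed.

Lemma fun_simI K (u v : T -> R) :
  (forall p, bd p -> exists2 c, A c /\ cdom c p & exists2 a : T -> R^o, csmooth c p a &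
    cnbhs c p [set q | u q - v q = c q 0 0 ^+ K * a q]) -> fun_sim A K u v.
Proof.
move=> H p bp; have [c [Ac cp] [a sa Na]] := H p bp.
have [U [oU Up HU]] := cnbhs_open hM Ac cp (filterI Na (csmooth_near sa)).
exists U, (fun q => c q 0 0), a; split=> //.
- by apply: (chart_defining_function hM Ac oU) => q /HU [].
- apply/(smooth_funP atl _ (open_locally_open hM oU)) => d q Ad dq /HU [cq [_ sq]].
  exact: (csmooth_chart_change atl (@compositionalR R) Ad Ac dq cq sq).
- by move=> q /HU [_ []].
Qed.

Lemma fun_sim_refl K (u : T -> R) : fun_sim A K u u.
Proof.
apply: fun_simI => p _; have [c Ac cp] := atlas_cover atl p; exists c => //.
exists (cst 0); first exact: csmooth_cst.
by apply: filterE => q /=; rewrite subrr mulr0.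
Qed.

Lemma fun_sim_sym K (u v : T -> R) : fun_sim A K u v -> fun_sim A K v u.
Proof.
move=> sim; apply: fun_simI => p bp; have [c Ac cp] := atlas_cover atl p; exists c => //.
have [a sa Na] := fun_sim_chart hM sim bp Ac cp.
exists (fun q => -1 * a q); first by apply: csmoothM => //; exact: csmooth_cst.
by apply: filterS Na => q /= E; rewrite mulN1r mulrN -E opprB.
Qed.

Lemma fun_sim_trans K (u v w : T -> R) :
  fun_sim A K u v -> fun_sim A K v w -> fun_sim A K u w.
Proof.
move=> s1 s2; apply: fun_simI => p bp; have [c Ac cp] := atlas_cover atl p; exists c => //.
have [a sa Na] := fun_sim_chart hM s1 bp Ac cp.
have [b sb Nb] := fun_sim_chart hM s2 bp Ac cp.
exists (fun q => a q + b q); first exact: csmoothD.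
apply: filterS2 Na Nb => q /= Ea Eb; rewrite mulrDr -Ea -Eb.
by rewrite addrA subrK.
Qed.

Lemma fun_sim_comp K (u v : T -> R) f : Diff A f ->
  fun_sim A K u v -> fun_sim A K (u \o f) (v \o f).
Proof.
move=> Df sim p bp; have sf := Diff_smap atl Df.
have [|U [rho [a [ldf Up sa Ea]]]] := sim (f p); first exact/(Diff_boundary hM).
have [oU _ _ _ _] := ldf; have lU := open_locally_open hM oU.
exists (f @^-1` U), (rho \o f), (a \o f); split=> //.
- exact: local_defining_function_pull.
- exact: (smooth_fun_comp atl (@compositionalR R) sf lU sa).
- by move=> q Uq; exact: Ea.
Qed.

Lemma Diff0_group K : is_group (Diff0 A K).
Proof.
split.
- split; first exact: (Diff_id atl).
  by move=> f _; exact: fun_sim_refl.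
- move=> s s' [Ds Hs] [Ds' Hs']; split; first exact: (Diff_comp atl).
  move=> f sf; apply: (fun_sim_trans (v := f \o s)); last exact: Hs.
  apply: Hs'; exact: smooth_fun_compT (Diff_smap atl Ds) sf.
- move=> s [Ds Hs]; have [s' [Ds' ss' s's]] := Diff_inverse Ds.
  exists s'; split=> //; split=> // f sf; apply: fun_sim_sym.
  have := Hs _ (smooth_fun_compT (Diff_smap atl Ds') sf).
  by rewrite (_ : (f \o s') \o s = f) //; apply/funext => x /=; rewrite ss'.
Qed.

(** To test [f \o s \o f'] on [u], the estimate for [s] on [u \o f] is composed with [f']. Such
    estimates are stable under diffeomorphisms, because defining functions pull back to defining
    functions. *)
Lemma Diff0_normal K : is_normal_subgroup (Diff0 A K) (Diff A).
Proof.
split.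
- exact: (Diff_group atl).
- exact: Diff0_group.
- by move=> f [].
- move=> s f f' [Ds Hs] Df Df' ff' f'f.
  split; first by apply: (Diff_comp atl) => //; exact: (Diff_comp atl).
  move=> u su; have := fun_sim_comp Df' (Hs _ (smooth_fun_compT (Diff_smap atl Df) su)).
  by rewrite (_ : (u \o f) \o f' = u) //; apply/funext => x /=; rewrite f'f.
Qed.

(** Defined for arbitrary maps; the default [p] is never reached by a diffeomorphism, which
    preserves the boundary. *)
Definition restrict Psi (p : bdT A) : bdT A :=
  if pselect (bd (Psi (val p))) is left b then SigSub (mem_set b) else p.

Lemma restrictP Psi : Diff A Psi -> is_restriction A Psi (restrict Psi).
Proof.
move=> DP p; rewrite /restrict; case: pselect => // nb.
by case: nb; apply/(Diff_boundary hM _ DP); exact: bd_val.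
Qed.

Lemma restrict_cancel Psi Phi : Diff A Psi -> Diff A Phi -> cancel Psi Phi ->
  cancel (restrict Psi) (restrict Phi).
Proof.
by move=> DP DQ K p; apply: val_inj; rewrite !restrictP // K.
Qed.

Lemma restrict_Diff Psi : Diff A Psi -> Diff bA (restrict Psi).
Proof.
move=> DP; have [Phi [DQ K1 K2]] := Diff_inverse DP.
have sr F : Diff A F -> smooth_map bA (restrict F).
  move=> DF; apply/(smooth_mapP batl).
  exact: (restriction_smap hM (restrictP DF) (Diff_smap atl DF)).
split; first exact: sr.
by exists (restrict Phi); split; [exact: sr|exact: restrict_cancel|exact: restrict_cancel].
Qed.

(** * Action on a class of ALH metrics and on its conformal infinity *)

Section ALH_class.
Variables (N : nat) (G : set (tensor R T n.+1)).
Hypotheses (hn : (2 <= n)%N) (hN : (3 <= N)%N) (hG : is_ALH_class A (N - 2) G).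

Lemma ALH_class_law g : G g -> tensor_law A int g.
Proof. by case: hG => g0 _ -> [[[mg _] _] _]; exact: (tensor_law_metric hM). Qed.

Lemma ALH_class_ext g g' : G g ->
  (forall c p, A c -> int p -> cdom c p -> g c p = g' c p) -> G g'.
Proof.
case: hG => g0 _ -> [ag sg] E; split; first exact: (ALH_ext hM ag E).
exact: metric_sim_ext sg E.
Qed.

Lemma Diff_class_group : is_group (Diff_class A G).
Proof.
exact: (stabilizer_group atl ALH_class_law ALH_class_ext (@Diff_interior _ _ _ _ hM)).
Qed.

Lemma ALH_class_pull Psi g : Diff_class A G Psi -> G g -> G (pull atl Psi g).
Proof.
move=> [DP EG] Gg; rewrite -EG; exists g => //.
apply: is_pullback_sub (pullP atl (Diff_smap atl DP) (ALH_class_law Gg)).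
by move=> p ip; exact: (Diff_interior hM DP).
Qed.

(** Transitivity from the reference metric [g0] to [g] and from [g] to its pullback. The index
    [N - 2] of the class becomes order [N] in the chart. *)
Lemma Diff0_pullback Psi : Diff0 A N.+1 Psi -> pullback_class A int Psi G `<=` G.
Proof.
move=> D0 h [g Gg ph]; have tP := Diff0_tangent hM D0; case: D0 => DP _.
have lg := ALH_class_law Gg.
case: hG => g0 ag0 EG; rewrite EG in Gg *; have [ag sg] := Gg.
have ah := ALH_pull hM DP ph ag; split=> //.
have [[[mg0 _] _] [[mh _] _]] := (ag0, ah).
apply: (metric_simI hM (tensor_law_metric hM mg0) (tensor_law_metric hM mh)) => p bp.
have [c Ac cp] := atlas_cover atl p; exists c; split=> //.
apply: metric_sim_at_trans (metric_simW hM sg bp Ac cp) _.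
have -> : (N - 2).+2 = N by rewrite -addn2 subnK // ltnW.
apply: (metric_sim_at_pullback hM DP _ ph tP) => //; first by case: ag.
by rewrite (leq_trans _ hN).
Qed.

Lemma Diff0_sub_Diff_class : Diff0 A N.+1 `<=` Diff_class A G.
Proof.
move=> Psi D0; have [DP _] := D0; split=> //.
have [Phi [D0' K1 _]] : exists Phi, [/\ Diff0 A N.+1 Phi, cancel Psi Phi & cancel Phi Psi].
  by have [_ _ inv] := Diff0_group N.+1; exact: inv.
have [DQ _] := D0'.
by apply: (pullback_class_eq atl ALH_class_law ALH_class_ext
  (@Diff_interior _ _ _ _ hM) DP DQ K1); exact: Diff0_pullback.
Qed.

Local Notation C := (conformal_infinity A G).

Lemma conformal_infinity_law t : C t -> tensor_law bA setT t.
Proof. by move=> [[tt _ _] _]; case/(is_tensorP batl t (locally_openT (A' := bA))): tt. Qed.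

Lemma conformal_infinity_ext (t t' : tensor R (bdT A) n) : C t ->
  (forall c p, bA c -> setT p -> cdom c p -> t c p = t' c p) -> C t'.
Proof.
move=> Ct; have lt := conformal_infinity_law Ct; case: Ct => mt [g Gg Hg] E; split.
  apply: (pullback_metric batl (Diff_id batl) (locally_openT (A' := bA)) _ mt) => //.
  by move=> c d Bc Bd p _ cp dp J; rewrite -E //; exact: lt.
exists g => // p; have [U [rho [s [phi [Up cs sphi phi0 Et]]]]] := Hg p.
exists U, rho, s, phi; split=> // c q Ac cq Uq.
by rewrite -E ?Et //; exists c.
Qed.

(** All data representing [gam] are pulled back together: [rho], the compactification and the
    conformal factor. The tangential block commutes with this by [dmx_restriction] and
    [tangential_congruence]. *)
Lemma Diff_class_conformal Psi : Diff_class A G Psi ->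
  pullback_class bA setT (restrict Psi) C `<=` C.
Proof.
move=> SP h [gam [mgam [g Gg Hg]] ph]; have [DP EG] := SP.
have sP := Diff_smap atl DP; have rP := restrictP DP.
have sr := restriction_smap hM rP sP.
have lT := locally_openT (A' := @batlas R n T A).
split; first exact: (pullback_metric batl (restrict_Diff DP) lT _ mgam ph).
exists (pull atl Psi g); first exact: ALH_class_pull.
have lg := ALH_class_law Gg.
have pg : is_pullback A int Psi g (pull atl Psi g).
  apply: is_pullback_sub (pullP atl sP lg).
  by move=> p ip; exact: (Diff_interior hM DP).
move=> p; have [U [rho [t [phi [Up ct sphi phi0 Et]]]]] := Hg (restrict Psi p).
exists (Psi @^-1` U), (rho \o Psi), (pull atl Psi t), (phi \o restrict Psi).
have [[oU _ _ _ _] tt _ _] := ct; have lU := open_locally_open hM oU.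
have EU : [set q : bdT A | (Psi @^-1` U) (val q)] =
    restrict Psi @^-1` [set q : bdT A | U (val q)].
  by apply/seteqP; split=> q /=; rewrite rP.
split.
- by rewrite /= -rP.
- exact: (compactification_pull hM DP lg pg ct).
- rewrite EU; apply: (smooth_fun_comp batl (@compositionalR R) sr _ sphi).
  move=> _ q [c Ac <-] /= cq Uq; apply: (bchart_cnbhs hM Ac cq).
  exact: lU.
- by move=> q Uq; apply: phi0; rewrite rP.
- move=> c q Ac cq Uq; have [d Ad dq] := atlas_cover atl (Psi (val q)).
  have Bc : bA (bchart A c) by exists c.
  have Bd : bA (bchart A d) by exists d.
  have dq' : cdom (bchart A d) (restrict Psi q) by rewrite /= rP.
  rewrite (ph _ _ Bc Bd q I cq dq') -/(dmx (bchart A c) (bchart A d) (restrict Psi) q).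
  have [-> J0] := dmx_restriction hM rP sP Ac Ad cq dq.
  have lt := ((is_tensorP atl t lU).1 tt).2.
  rewrite (Et d (restrict Psi q) Ad dq') ?rP //.
  rewrite (pullP atl sP lt Ac Ad Uq cq dq) -/(dmx c d Psi (val q)).
  by rewrite tangential_congruence // -scalemxAr -scalemxAl.
Qed.

Lemma restrict_Conf Psi : Diff_class A G Psi -> Conf A C (restrict Psi).
Proof.
move=> SP; have [DP _] := SP; split; first exact: restrict_Diff.
have [_ _ inv] := Diff_class_group; have [Phi [SQ K1 _]] := inv _ SP.
have [DQ _] := SQ.
by apply: (pullback_class_eq batl conformal_infinity_law conformal_infinity_ext _
  (restrict_Diff DP) (restrict_Diff DQ) (restrict_cancel DP DQ K1)) => //;
  exact: Diff_class_conformal.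
Qed.

Lemma restrict_hom : is_group_hom (Diff_class A G) (Conf A C) restrict.
Proof.
split.
- exact: Diff_class_group.
- exact: (stabilizer_group batl conformal_infinity_law conformal_infinity_ext).
- exact: restrict_Conf.
- move=> f f' [Df _] [Df' _]; apply/funext => p; apply: val_inj => /=.
  by rewrite !restrictP //; exact: (Diff_comp atl).
Qed.

Lemma restrict_kernel : kernel (Diff_class A G) restrict = Diff0 A N.+1.
Proof.
apply/seteqP; split=> [Psi [SP rid]|Psi D0]; last first.
  split; first exact: Diff0_sub_Diff_class.
  have [DP _] := D0; apply/funext => p; apply: val_inj.
  have [c Ac cp] := atlas_cover atl (val p).
  rewrite restrictP //.
  by have [] := Diff0_tangent hM D0 Ac cp (bd_val p).
have [DP _] := SP.
have idb p : bd p -> Psi p = p.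
  by move=> /bd_sub [q <-]; rewrite -restrictP // rid.
apply: (tangent_Diff0 hM DP).
(* A single metric of the class is enough: only the comparison of [g0] with its own pullback enters
   the induction. *)
case: (hG) => g0 ag0 EG; have [cg0 _] := ag0; have [mg0 _] := cg0.
have Gg0 : G g0 by rewrite EG; split=> //; exact: metric_sim_refl.
have pg : is_pullback A int Psi g0 (pull atl Psi g0).
  apply: is_pullback_sub (pullP atl (Diff_smap atl DP) (ALH_class_law Gg0)).
  by move=> p ip; exact: (Diff_interior hM DP).
have sim c p : A c -> cdom c p -> bd p -> metric_sim_at A N g0 (pull atl Psi g0) c p.
  move=> Ac cp bp; have := ALH_class_pull SP Gg0; rewrite EG => -[_ sg].
  have := metric_simW hM sg bp Ac cp.
  by rewrite -addn2 subnK // ltnW.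
have tK K : (K <= N)%N -> tangent A K.+1 Psi.
  elim: K => [|K IH] KN; first exact: tangent1.
  exact: (tangent_step hM hn KN DP mg0 pg sim (IH (ltnW KN))).
exact: tK.
Qed.

End ALH_class.

End diffeomorphism_groups.

Theorem theorem3p11 (R : realType) (n : nat) (hn : (2 <= n)%N)
    (T : topologicalType) (A : set (chart R T n.+1))
    (hM : manifold_with_boundary A)
    (N : nat) (hN : (3 <= N)%N)
    (G : set (tensor R T n.+1)) (hG : is_ALH_class A (N - 2) G) :
  (is_normal_subgroup (Diff0 A N.+1) (Diff A) /\
   Diff0 A N.+1 `<=` Diff_class A G) /\
  (exists r : (T -> T) -> (bdT A -> bdT A),
    [/\ forall Psi, Diff_class A G Psi -> is_restriction A Psi (r Psi),
        is_group_hom (Diff_class A G) (Conf A (conformal_infinity A G)) r &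
        kernel (Diff_class A G) r = Diff0 A N.+1]).
Proof.
split; first by split; [exact: Diff0_normal|exact: Diff0_sub_Diff_class hG].
exists (@restrict R n T A); split.
- by move=> Psi [DP _]; exact: restrictP.
- exact: restrict_hom hG.
- exact: restrict_kernel hG.
Qed.
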